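(* Let $\mathcal{K}$ be the smallest class of log-concave measures which is closed under products, linear transformations and weak limits and which contains all log-concave measures on $\mathbb{R}^1$. Let $\mu\in\mathcal{K}$ be the uniform probability measure on a convex body $B\subset\mathbb{R}^d$. Then $B$ is a parallelotope.
   Context: A log-concave measure on $\mathbb{R}^n$ (any $n\ge1$) is a Borel probability measure $\mu$ with $\mu(tA+(1-t)B)\ge \mu(A)^t\mu(B)^{1-t}$ for all compact $A,B\subset\mathbb{R}^n$ and $t\in(0,1)$, and with $\mu(H)=0$ for every affine subspace $H\subset\mathbb{R}^n$ of dimension less than $n$. A class of log-concave measures is a collection of such measures, where the dimension $n$ may vary. A class $\mathcal{C}$ of log-concave measures is: closed under products if $\mu_1,\mu_2\in\mathcal{C}$ implies $\mu_1\otimes\mu_2\in\mathcal{C}$; closed under linear transformations if for every $\mu\in\mathcal{C}$ on $\mathbb{R}^n$ and every linear map $T:\mathbb{R}^n\to\mathbb{R}^m$ such that $\nu=\mu\circ T^{-1}$ is again a log-concave measure on $\mathbb{R}^m$, that is, a Borel probability measure with $\nu(tA+(1-t)B)\ge\nu(A)^t\nu(B)^{1-t}$ for all compact $A,B\subset\mathbb{R}^m$ and $t\in(0,1)$, and with $\nu(H)=0$ for every affine subspace $H\subset\mathbb{R}^m$ of dimension less than $m$ (i.e. $T$ is onto), $\mu\circ T^{-1}\in\mathcal{C}$; closed under weak limits if every log-concave measure $\nu$ on $\mathbb{R}^n$ (that is, a Borel probability measure with $\nu(tA+(1-t)B)\ge\nu(A)^t\nu(B)^{1-t}$ for all compact $A,B\subset\mathbb{R}^n$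 and $t\in(0,1)$, and with $\nu(H)=0$ for every affine subspace $H\subset\mathbb{R}^n$ of dimension less than $n$) which is the weak limit of a sequence of measures on $\mathbb{R}^n$ belonging to $\mathcal{C}$ belongs to $\mathcal{C}$. A convex body is a compact convex set with nonempty interior. A parallelotope in $\mathbb{R}^d$ is the image of the cube $[0,1]^d$ under an invertible affine map. *)

(* Defs.v *)
From HB Require Import structures.
From mathcomp Require Import all_boot all_order all_algebra.
From mathcomp Require Import all_classical all_reals all_analysis.
From mathcomp Require Import measurable_realfun.

Set Implicit Arguments.
Unset Strict Implicit.
Unset Printing Implicit Defensive.

Import Order.TTheory GRing.Theory Num.Theory.
Import numFieldNormedType.Exports.

Local Open Scope classical_set_scope.
Local Open Scope ring_scope.

Section borel_rV.
Context {R : realType} {n : nat}.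

HB.instance Definition _ := Measurable.copy 'rV[R]_n
  (g_sigma_algebraType (@open 'rV[R]_n)).

End borel_rV.

Section measurability_rV.
Context {R : realType}.

Lemma open_measurable_rV n (U : set 'rV[R]_n) : open U -> measurable U.
Proof. exact: sub_sigma_algebra. Qed.

Lemma measurable_coord n (i : 'I_n) :
  measurable_fun [set: 'rV[R]_n] (fun v => v ord0 i).
Proof.
apply: (measurability _ (RGenOpens.measurableE R)).
move=> _ [_ [a [b ->] <-]]; rewrite setTI; apply: open_measurable_rV.
by apply: open_comp => [v _|]; [exact: coord_continuous|exact: interval_open].
Qed.

Lemma measurable_rV d (T : measurableType d) n (f : T -> 'rV[R]_n) :
  (forall i, measurable_fun setT (fun x => f x ord0 i)) ->
  measurable_fun setT f.
Proof.
move=> mf; apply: (measurability (@open 'rV[R]_n)) => // _ [U oU <-].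
rewrite setTI.
pose q (z : 'rV[rat]_n) : 'rV[R]_n := map_mx ratr z.
pose S (zk : 'rV[rat]_n * nat) := ball (q zk.1) (zk.2.+1%:R^-1 : R).
have -> : f @^-1` U = \bigcup_(zk in [set zk | S zk `<=` U]) (f @^-1` S zk).
  apply/seteqP; split=> [x Ufx|x [zk /= SU Sx]]; last exact: SU.
  have /nbhs_ballP[e /= e0 eU] : nbhs (f x) U by exact: open_nbhs_nbhs.
  have e20 : 0 < e / 2 by rewrite divr_gt0.
  have [k ke] := ltr_add_invr e20; rewrite add0r in ke.
  have k0 : (0 : R) < k.+1%:R^-1 by rewrite invr_gt0.
  have /choice[r rf] (i : 'I_n) :
      exists r : rat, `|ratr r - f x ord0 i| < (k.+1%:R^-1 : R).
    have /rat_in_itvoo[r] :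
        f x ord0 i - k.+1%:R^-1 < f x ord0 i + k.+1%:R^-1.
      by rewrite ltrD2l gtrN.
    by rewrite in_itv/= => rx; exists r; rewrite ltr_distl.
  exists (\row_i r i, k) => /=; last first.
    by split => // i j; rewrite !mxE ord1; exact: rf.
  move=> y [_ ry]; apply: eU; split => // i j; rewrite ord1.
  have := ry ord0 j; rewrite /ball /= !mxE => ryj.
  rewrite (splitr e) -(subrKA (ratr (r j))).
  rewrite (le_lt_trans (ler_normD _ _))// ltrD// (lt_trans _ ke)//.
  by rewrite distrC; exact: rf.
rewrite bigcup_mkcond; apply: countable_bigcupT_measurable => // zk.
case: ifPn => // _.
have -> : f @^-1` S zk =
    \bigcap_(i in [set: 'I_n])
      ((fun x => f x ord0 i) @^-1` ball (q zk.1 ord0 i) (zk.2.+1%:R^-1 : R)).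
  apply/seteqP; split=> [x [_ xS] i _|x xS]; first exact: xS.
  by split=> [|i j]; [rewrite invr_gt0|rewrite ord1; exact: xS].
apply: fin_bigcap_measurable => // i _; rewrite -[X in measurable X]setTI.
by apply: mf => //; exact: measurable_ball.
Qed.

Definition join_rV m n (p : 'rV[R]_m * 'rV[R]_n) : 'rV[R]_(m + n) :=
  row_mx p.1 p.2.

Lemma measurable_join_rV m n : measurable_fun setT (@join_rV m n).
Proof.
apply: measurable_rV => i; rewrite /join_rV -(fintype.splitK i).
case: (fintype.split i) => j /=.
  under eq_fun do rewrite row_mxEl.
  exact: measurableT_comp (measurable_coord j) measurable_fst.
under eq_fun do rewrite row_mxEr.
exact: measurableT_comp (measurable_coord j) measurable_snd.
Qed.

HB.instance Definition _ m n := isMeasurableFun.Build _ _ _ _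
  (@join_rV m n) (@measurable_join_rV m n).

Definition cons_rV n (p : R * 'rV[R]_n) : 'rV[R]_n.+1 :=
  join_rV (p.1%:M : 'rV[R]_1, p.2).

Lemma measurable_cons_rV n : measurable_fun setT (@cons_rV n).
Proof.
apply: (measurableT_comp (@measurable_join_rV 1 n)).
apply/measurable_fun_pairP; split; last exact: measurable_snd.
apply: measurable_rV => i; rewrite [i]ord1.
apply: (eq_measurable_fun fst); last exact: measurable_fst.
by move=> x _ /=; rewrite mxE mulr1n.
Qed.

End measurability_rV.

Section lebesgue_rV.
Context {R : realType}.
Local Open Scope ereal_scope.

Section cons_measure.
Variable n : nat.
Variable m : {sigma_finite_measure set 'rV[R]_n -> \bar R}.

Definition cons_lebesgue : set 'rV[R]_n.+1 -> \bar R :=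
  pushforward (lebesgue_measure \x m) (@cons_rV R n).

Let pushforward_cons : {measure set 'rV[R]_n.+1 -> \bar R} :=
  measure_function_pushforward__canonical__measure_function_Measure
    (lebesgue_measure \x m) (@measurable_cons_rV R n).

Let cons_lebesgue0 : cons_lebesgue set0 = 0.
Proof. exact: (measure0 pushforward_cons). Qed.

Let cons_lebesgue_ge0 A : 0 <= cons_lebesgue A.
Proof. exact: (measure_ge0 pushforward_cons). Qed.

Let cons_lebesgue_sigma_additive : semi_sigma_additive cons_lebesgue.
Proof. exact: (@measure_semi_sigma_additive _ _ _ pushforward_cons). Qed.

HB.instance Definition _ := isMeasure.Build _ _ _ cons_lebesgue
  cons_lebesgue0 cons_lebesgue_ge0 cons_lebesgue_sigma_additive.

Let cons_lebesgue_sigma_finite : sigma_finite setT cons_lebesgue.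
Proof.
have /sigma_finiteP[F [TF ndF Foo]] := sigma_finiteT (@lebesgue_measure R).
have /sigma_finiteP[G [TG ndG Goo]] := sigma_finiteT m.
pose hd (v : 'rV[R]_n.+1) : R := v ord0 ord0.
pose tl (v : 'rV[R]_n.+1) : 'rV[R]_n := \row_i v ord0 (lift ord0 i).
have mhd : measurable_fun setT hd by exact: measurable_coord.
have mtl : measurable_fun setT tl.
  apply: measurable_rV => i; rewrite /tl.
  under eq_fun do rewrite mxE.
  exact: measurable_coord.
exists (fun k => (hd @^-1` F k) `&` (tl @^-1` G k)).
  apply/esym/seteqP; split => // v _.
  have [i _ Fi] : (\bigcup_i F i) (hd v) by rewrite -TF.
  have [j _ Gj] : (\bigcup_i G i) (tl v) by rewrite -TG.
  exists (maxn i j) => //; split => /=.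
    by move: (hd v) Fi; exact/subsetPset/ndF/leq_maxl.
  by move: (tl v) Gj; exact/subsetPset/ndG/leq_maxr.
move=> k; have [mF Fk] := Foo k; have [mG Gk] := Goo k; split.
  apply: measurableI; rewrite -[X in measurable X]setTI;
    [exact: mhd|exact: mtl].
have -> : cons_lebesgue (hd @^-1` F k `&` tl @^-1` G k) =
    (lebesgue_measure \x m) (F k `*` G k).
  rewrite /cons_lebesgue /pushforward; congr product_measure1.
  have hdE x v : hd (cons_rV (x, v)) = x.
    transitivity (row_mx (x%:M : 'rV_1) v ord0 (lshift n ord0)).
      by congr (fun_of_matrix _ _ _); exact/val_inj.
    by rewrite row_mxEl mxE mulr1n.
  have tlE x v : tl (cons_rV (x, v)) = v.
    apply/rowP => i; rewrite mxE.
    transitivity (row_mx (x%:M : 'rV_1) v ord0 (rshift 1 i)).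
      by congr (fun_of_matrix _ _ _); exact/val_inj.
    by rewrite row_mxEr.
  by apply/seteqP; split=> -[x v]; rewrite /= hdE tlE.
by rewrite product_measure1E// lte_mul_pinfty// ge0_fin_numE.
Qed.

HB.instance Definition _ := Measure_isSigmaFinite.Build _ _ _ cons_lebesgue
  cons_lebesgue_sigma_finite.

End cons_measure.

Fixpoint lebesgue_rV n : {sigma_finite_measure set 'rV[R]_n -> \bar R} :=
  if n is n'.+1 then cons_lebesgue (lebesgue_rV n') else \d_(0%R : 'rV[R]_0).

End lebesgue_rV.

Section log_concave.
Context {R : realType}.

(* The dimension [n] is at least 1; [x - v \in W] ranges over the affine
   subspaces of dimension [\dim W]. *)
Definition log_concave n (mu : probability 'rV[R]_n R) : Prop :=
  [/\ (0 < n)%N,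
      forall (t : R) (A B : set 'rV[R]_n),
        0 < t < 1 -> compact A -> compact B ->
        (mu A `^ t * mu B `^ (1 - t) <=
         mu [set t *: a + (1 - t) *: b | a in A & b in B]%R)%E
    & forall (v : 'rV[R]_n) (W : {vspace 'rV[R]_n}), (\dim W < n)%N ->
        mu [set x | x - v \in W] = 0%E].

Definition product_rV m n (mu : probability 'rV[R]_m R)
    (nu : probability 'rV[R]_n R) : probability 'rV[R]_(m + n) R :=
  distribution (mu \x nu)%E (@join_rV R m n).

Definition weak_cvg n (mu_ : nat -> probability 'rV[R]_n R)
    (nu : probability 'rV[R]_n R) : Prop :=
  forall f : 'rV[R]_n -> R, continuous f -> bounded_fun f ->
    \int[mu_ k]_x f x @[k --> \oo] --> \int[nu]_x f x.

Definition measure_class := forall n, set (probability 'rV[R]_n R).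

Implicit Type C : measure_class.

Definition log_concave_class C : Prop :=
  forall n (mu : probability 'rV[R]_n R), C n mu -> log_concave mu.

Definition closed_products C : Prop :=
  forall m n (mu : probability 'rV[R]_m R) (nu : probability 'rV[R]_n R),
    C m mu -> C n nu -> C (m + n)%N (product_rV mu nu).

(* A [probability] also assigns a value to every nonmeasurable set, hence the
   image measure is compared with [nu] on Borel sets only. *)
Definition closed_linear C : Prop :=
  forall m n (mu : probability 'rV[R]_m R) (nu : probability 'rV[R]_n R)
    (T : {linear 'rV[R]_m -> 'rV[R]_n}),
    C m mu -> log_concave nu ->
    (forall A, measurable A -> nu A = pushforward mu T A) -> C n nu.

Definition closed_weak_limits C : Prop :=
  forall n (mu_ : nat -> probability 'rV[R]_n R) (nu : probability 'rV[R]_n R),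
    (forall k, C n (mu_ k)) -> log_concave nu -> weak_cvg mu_ nu -> C n nu.

Definition contains_dim1 C : Prop :=
  forall mu : probability 'rV[R]_1 R, log_concave mu -> C 1%N mu.

Definition smallest_class : measure_class := fun n mu =>
  forall C, log_concave_class C -> closed_products C -> closed_linear C ->
    closed_weak_limits C -> contains_dim1 C -> C n mu.

Definition convex_body n (B : set 'rV[R]_n) : Prop :=
  [/\ compact B, convex_set B & B° !=set0].

Definition uniform_on n (B : set 'rV[R]_n) (mu : probability 'rV[R]_n R) :
    Prop :=
  forall A, measurable A ->
    mu A = (lebesgue_rV n (A `&` B) / lebesgue_rV n B)%E.

Definition unit_cube n : set 'rV[R]_n := [set x | forall i, 0 <= x ord0 i <= 1].

Definition parallelotope n (B : set 'rV[R]_n) : Prop :=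
  exists (M : 'M[R]_n) (v : 'rV[R]_n),
    M \in unitmx /\ B = [set x *m M + v | x in @unit_cube n].

End log_concave.

(* Main.v *)
Require Import Defs.
From HB Require Import structures.
From mathcomp Require Import all_boot all_order all_algebra.
From mathcomp Require Import all_classical all_reals all_analysis.
From mathcomp Require Import measurable_realfun ring lra.

(** A law in the smallest class is a weak limit of laws of vectors w *m M,
    where the coordinates of w are independent, one-dimensional and
    log-concave (smallest_class_approximable). This uses that products of
    log-concave measures are log-concave (log_concave_product), which
    follows from the Brunn-Minkowski inequality for boxes by the cutting
    argument of Hadwiger and Ohmann (brunn_minkowski_boxes). The number of
    coordinates of w is not bounded. The heart of the proof is that, when
    the limit is uniform on a convex body B of dimension d, at most d
    coordinates matter.

    Consider the mass of the limit near the top of B in a direction u. A cap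
    of depth e contains the intersection of B with a ball of radius of order
    e, so its mass is at least of order e^d (cap_mass). On the other hand, a
    log-concave variable that is not concentrated comes within e of its top
    only with probability of order e (spread_tail); if d.+1 disjoint groups
    of coordinates all had a contribution to the direction u that is not
    concentrated, then by independence the sum would come within e of its
    top only with probability of order e^(d+1) (total_tail). Hence there are
    never d.+1 such groups (no_spread_groups). Two consequences follow, for
    each scale r: at most d coordinates are spread at scale r
    (card_spread_idx), and the sum of all the others is almost constant
    (rest_concentrated), because otherwise d.+1 groups could be split off
    greedily (greedy_groups).

    So w *m M is, up to a translation and a small error, a combination of at
    most d unit vectors with independent coefficients. Along an ultrafilter
    of better and better approximations these unit vectors converge to the
    rows of a matrix V, and V is invertible since the uniform measure is not
    concentrated in any direction (limit_frame). In the coordinates given by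
    V the approximating laws are then products up to a small error
    (independent_coordinates). Therefore a point each of whose coordinates
    is the coordinate of some point of B belongs to B
    (coordinates_recombine): the measure charges every neighbourhood of it,
    as the probability there is almost a product of positive numbers. This
    says that B is a box in the coordinates given by V
    (recombining_parallelotope). *)

Set Implicit Arguments.
Unset Strict Implicit.
Unset Printing Implicit Defensive.

Import Order.TTheory GRing.Theory Num.Theory.
Import numFieldNormedType.Exports.

Local Open Scope classical_set_scope.
Local Open Scope ring_scope.

(** * Real-valued probabilities and quantiles *)

Section measurable_comparison.
Context d (T : measurableType d) (R : realType) (Y : T -> R).
Hypothesis mY : measurable_fun setT Y.

Let mitv (i : interval R) : measurable [set x | Y x \in i].
Proof. by have := mY measurableT (measurable_itv i); rewrite setTI. Qed.

Lemma measurable_le c : measurable [set x | Y x <= c].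
Proof. by have := mitv `]-oo, c]; under eq_set do rewrite in_itv. Qed.

Lemma measurable_lt c : measurable [set x | Y x < c].
Proof. by have := mitv `]-oo, c[; under eq_set do rewrite in_itv. Qed.

Lemma measurable_ge c : measurable [set x | c <= Y x].
Proof.
by have := mitv `[c, +oo[; under eq_set do rewrite in_itv/= andbT.
Qed.

Lemma measurable_gt c : measurable [set x | c < Y x].
Proof.
by have := mitv `]c, +oo[; under eq_set do rewrite in_itv/= andbT.
Qed.

End measurable_comparison.

Section real_probability.
Context d (T : measurableType d) (R : realType) (P : probability T R).
Implicit Types (A B : set T) (e : R).

Definition pr A : R := fine (P A).

Lemma prE A : measurable A -> P A = (pr A)%:E.
Proof. by move=> mA; rewrite /pr fineK// fin_num_measure. Qed.

Lemma pr_ge0 A : 0 <= pr A. Proof. exact: fine_ge0. Qed.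

Lemma pr0 : pr set0 = 0. Proof. by rewrite /pr measure0. Qed.

Lemma prT : pr setT = 1. Proof. by rewrite /pr probability_setT. Qed.

Lemma le_pr A B : measurable A -> measurable B -> A `<=` B -> pr A <= pr B.
Proof.
by move=> mA mB AB; rewrite -lee_fin -!prE// le_measure// inE.
Qed.

Lemma pr_le1 A : measurable A -> pr A <= 1.
Proof. by move=> mA; rewrite -prT; exact: le_pr. Qed.

Lemma prU_le A B : measurable A -> measurable B ->
  pr (A `|` B) <= pr A + pr B.
Proof.
move=> mA mB; rewrite -lee_fin EFinD -!prE ?measureU2//; exact: measurableU.
Qed.

Lemma pr_disjU A B : measurable A -> measurable B -> A `&` B = set0 ->
  pr (A `|` B) = pr A + pr B.
Proof.
move=> mA mB AB; apply: EFin_inj.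
rewrite EFinD -!prE// ?measureU//; exact: measurableU.
Qed.

Lemma prC A : measurable A -> pr (~` A) = 1 - pr A.
Proof.
move=> mA; rewrite -prT -(setUv A) pr_disjU ?setICr//; last exact: measurableC.
by rewrite addrAC subrr add0r.
Qed.

Lemma pr_setID A B : measurable A -> measurable B ->
  pr A = pr (A `&` B) + pr (A `&` ~` B).
Proof.
move=> mA mB; have mCB : measurable (~` B) by exact: measurableC.
rewrite -pr_disjU ?setIUr -?setIUr ?setUv ?setIT//; try exact: measurableI.
by rewrite setIACA setICr setI0.
Qed.

Lemma pr_bigcap_lt (F : nat -> set T) e : (forall n, measurable (F n)) ->
  {homo F : m n / (m <= n)%N >-> (n <= m)%O} -> 0 < e ->
  exists n, pr (F n) < pr (\bigcap_n F n) + e.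
Proof.
move=> mF dF e0; have mI : measurable (\bigcap_n F n) by exact: bigcapT_measurable.
have : (P (F n) @[n --> \oo] --> P (\bigcap_n F n))%classic.
  apply: nonincreasing_cvg_mu => //.
  by rewrite (le_lt_trans (probability_le1 _ (mF _)))// ltry.
rewrite prE// => /fine_cvgP[_ /cvgrPdist_lt/(_ e e0)[n _ /(_ n (leqnn n))]] /=.
rewrite ltr_distlC => /andP[_]; by exists n.
Qed.

Lemma pr_bigcup_gt (F : nat -> set T) e : (forall n, measurable (F n)) ->
  {homo F : m n / (m <= n)%N >-> (m <= n)%O} -> 0 < e ->
  exists n, pr (\bigcup_n F n) - e < pr (F n).
Proof.
move=> mF dF e0; have mI : measurable (\bigcup_n F n) by exact: bigcupT_measurable.
have : (P (F n) @[n --> \oo] --> P (\bigcup_n F n))%classic.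
  by apply: nondecreasing_cvg_mu => //; exact: dF.
rewrite prE// => /fine_cvgP[_ /cvgrPdist_lt/(_ e e0)[n _ /(_ n (leqnn n))]] /=.
rewrite ltr_distlC => /andP[+ _]; by exists n.
Qed.

(** A threshold for Y at which the mass of B is cut into v and the rest; the
    strict and the weak inequality account for an atom of Y at c. The
    threshold is the supremum of the levels up to which the mass is less
    than v. *)
Lemma quantile (Y : T -> R) B (v : R) : measurable B ->
  measurable_fun setT Y -> 0 < v < pr B ->
  exists c, pr (B `&` [set x | Y x < c]) <= v <= pr (B `&` [set x | Y x <= c]).
Proof.
move=> mB mY /andP[v0 vB].
have mle c : measurable (B `&` [set x | Y x <= c]).
  by apply: measurableI => //; exact: measurable_le.
have mlt c : measurable (B `&` [set x | Y x < c]).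
  by apply: measurableI => //; exact: measurable_lt.
pose S := [set c | pr (B `&` [set x | Y x <= c]) < v].
have [n0 n0v] : exists n : nat, S (- n%:R).
  have [|n] := @pr_bigcap_lt (fun n => B `&` [set x | Y x <= - n%:R]) v (fun n => mle _) _ v0.
    move=> m n mn; apply/subsetPset => x [Bx /= Yx]; split => //=.
    by rewrite (le_trans Yx)// lerN2 ler_nat.
  rewrite (_ : \bigcap_n _ = set0) ?pr0 ?add0r; first by exists n.
  apply/seteqP; split => // x /= H.
  have [_ /=] := H (Num.truncn (- Y x)).+1 I.
  by rewrite lerNr leNgt truncnS_gt.
have [n1 n1v] : exists n : nat, v < pr (B `&` [set x | Y x <= n%:R]).
  have [|||n] := @pr_bigcup_gt (fun n => B `&` [set x | Y x <= n%:R]) (pr B - v).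
  - by move=> n; exact: mle.
  - move=> m n mn; apply/subsetPset => x [Bx /= Yx]; split => //=.
    by rewrite (le_trans Yx)// ler_nat.
  - by rewrite subr_gt0.
  rewrite (_ : \bigcup_n _ = B); first by rewrite opprB addrC subrK; exists n.
  apply/seteqP; split => [x [? _ []]//|x Bx].
  by exists (Num.truncn (Y x)).+1 => //; split => //=; rewrite ltW// truncnS_gt.
have Sle c c' : c <= c' -> S c' -> S c.
  move=> cc'; apply: le_lt_trans; apply: le_pr => // x [Bx /= Yx]; split => //=.
  exact: le_trans cc'.
have supS : has_sup S.
  split; first by exists (- n0%:R).
  exists n1%:R => c Sc; rewrite leNgt; apply/negP => /ltW /Sle /(_ Sc).
  by rewrite /S/= ltNge (ltW n1v).
exists (sup S); apply/andP; split.
  rewrite leNgt; apply/negP => H.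
  have [|||n] := @pr_bigcup_gt (fun n => B `&` [set x | Y x <= sup S - n.+1%:R^-1])
    (pr (B `&` [set x | Y x < sup S]) - v).
  - by move=> n; exact: mle.
  - move=> m n mn; apply/subsetPset => x [Bx /= Yx]; split => //=.
    by rewrite (le_trans Yx)// lerD2l lerN2 lef_pV2 ?posrE// ler_nat ltnS.
  - by rewrite subr_gt0.
  rewrite (_ : \bigcup_n _ = B `&` [set x | Y x < sup S]).
    rewrite opprB addrC subrK ltNge => /negP; apply.
    have [|c Sc] := @sup_adherent _ S (n.+1%:R^-1) _ supS.
      by rewrite invr_gt0.
    move=> /ltW /Sle /(_ Sc); exact: ltW.
  apply/seteqP; split => [x [k _ [Bx /= Yx]]|x [Bx /= Yx]].
    by split => //=; rewrite (le_lt_trans Yx)// gtrDl oppr_lt0 invr_gt0.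
  have [k] := ltr_add_invr Yx.
  by exists k => //; split => //=; rewrite lerBrDr ltW.
rewrite leNgt; apply/negP => H.
have [|||n] := @pr_bigcap_lt (fun n => B `&` [set x | Y x <= sup S + n.+1%:R^-1])
    (v - pr (B `&` [set x | Y x <= sup S])).
- by move=> n; exact: mle.
- move=> m n mn; apply/subsetPset => x [Bx /= Yx]; split => //=.
  by rewrite (le_trans Yx)// lerD2l lef_pV2 ?posrE// ler_nat ltnS.
- by rewrite subr_gt0.
rewrite (_ : \bigcap_n _ = B `&` [set x | Y x <= sup S]).
  rewrite [ltRHS]addrC subrK => Sn.
  have := sup_upper_bound supS; move/(_ _ Sn).
  by rewrite leNgt ltrDl invr_gt0 ltr0n.
apply/seteqP; split => [x Yx|x [Bx /= Yx] k _].
  split; first by have [] := Yx 0%N I.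
  rewrite /= leNgt; apply/negP => H'.
  have [k Hk] := ltr_add_invr H'.
  by have [_ /=] := Yx k I; rewrite leNgt Hk.
by split => //=; rewrite (le_trans Yx)// lerDl.
Qed.

End real_probability.

(** * Compact sets and unions of boxes *)

Section sup_norm.
Context {R : realType} {k : nat}.
Implicit Types x : 'rV[R]_k.

Lemma coord_le_norm x i : `|x ord0 i| <= `|x|.
Proof.
rewrite [leRHS]/Num.norm/= mx_normrE.
exact: (@le_bigmax _ R _ 0 (fun ij => `|x ij.1 ij.2|) (ord0, i)).
Qed.

Lemma norm_le_coord x e : 0 <= e -> (forall i, `|x ord0 i| <= e) -> `|x| <= e.
Proof.
move=> e0 H; rewrite [leLHS]/Num.norm/= mx_normrE; apply/bigmax_leP; split => // -[i j] _.
by rewrite /= ord1.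
Qed.

End sup_norm.

Section compact_rV.
Context {R : realType} {k : nat}.
Implicit Types (A B : set 'rV[R]_k) (t : R).

Lemma compact_measurable_rV A : compact A -> measurable A.
Proof.
move=> cA; rewrite -(setCK A); apply: measurableC; apply: open_measurable_rV.
by rewrite openC; apply: compact_closed => //; exact: norm_hausdorff.
Qed.

Definition minkowski t A B := [set t *: a + (1 - t) *: b | a in A & b in B].

Lemma minkowskiC t A B : minkowski (1 - t) A B = minkowski t B A.
Proof.
by apply/seteqP; split => _ [a Aa [b Bb <-]]; exists b => //; exists a => //;
  rewrite subKr addrC.
Qed.

Lemma minkowski_sub t A A' B B' : A `<=` A' -> B `<=` B' ->
  minkowski t A B `<=` minkowski t A' B'.
Proof.
by move=> AA' BB' _ [a Aa [b Bb <-]]; exists a; [exact: AA'|exists b => //; exact: BB'].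
Qed.

Lemma minkowski_compact t A B : compact A -> compact B -> compact (minkowski t A B).
Proof.
move=> cA cB.
have -> : minkowski t A B =
    (fun p : 'rV[R]_k * 'rV[R]_k => t *: p.1 + (1 - t) *: p.2) @` (A `*` B).
  apply/seteqP; split => [_ [a Aa [b Bb <-]]|_ [[a b] [/= Aa Bb] <-]].
    by exists (a, b).
  by exists a => //; exists b.
apply: continuous_compact; last exact: compact_setX.
apply: continuous_subspaceT => x.
by apply: cvgD; apply: cvgZr; [exact: cvg_fst|exact: cvg_snd].
Qed.

Definition box (lo hi : 'rV[R]_k) : set 'rV[R]_k :=
  [set x | forall i, lo ord0 i <= x ord0 i <= hi ord0 i].

Lemma box_compact lo hi : compact (box lo hi).
Proof.
rewrite (_ : box lo hi =
    [set v | forall i, `[lo ord0 i, hi ord0 i]%classic (v ord0 i)]); last first.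
  by apply/seteqP; split => x + i => /(_ i); rewrite /= in_itv.
apply: (@rV_compact R k (fun i => `[lo ord0 i, hi ord0 i]%classic)) => i.
exact: segment_compact.
Qed.

Lemma measurable_half_le (i : 'I_k) (c : R) :
  measurable [set x : 'rV[R]_k | x ord0 i <= c].
Proof. by apply: measurable_le; exact: measurable_coord. Qed.

Lemma measurable_half_ge (i : 'I_k) (c : R) :
  measurable [set x : 'rV[R]_k | c <= x ord0 i].
Proof. by apply: measurable_ge; exact: measurable_coord. Qed.

Lemma closed_half_le (i : 'I_k) (c : R) :
  closed [set x : 'rV[R]_k | x ord0 i <= c].
Proof.
apply: (@closed_comp _ _ (fun x : 'rV[R]_k => x ord0 i) [set y | y <= c]).
  by move=> x _; exact: coord_continuous.
exact: closed_le.
Qed.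

Lemma closed_half_ge (i : 'I_k) (c : R) :
  closed [set x : 'rV[R]_k | c <= x ord0 i].
Proof.
apply: (@closed_comp _ _ (fun x : 'rV[R]_k => x ord0 i) [set y | c <= y]).
  by move=> x _; exact: coord_continuous.
exact: closed_ge.
Qed.

(** Unions of boxes that are undone, one after the other, by coordinate
    hyperplanes. The separating hyperplane recorded at each union is what
    the induction of Hadwiger and Ohmann cuts along. *)
Inductive polybox : set 'rV[R]_k -> Prop :=
| polybox0 : polybox set0
| polybox1 lo hi : polybox (box lo hi)
| polyboxU A1 A2 i c : polybox A1 -> polybox A2 ->
    A1 `<=` [set x | x ord0 i <= c] -> A2 `<=` [set x | c <= x ord0 i] ->
    polybox (A1 `|` A2).

Lemma polybox_compact A : polybox A -> compact A.
Proof.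
elim => [|lo hi|A1 A2 i c _ cA1 _ cA2 _ _]; [exact: compact0|exact: box_compact|].
exact: compactU.
Qed.

(** As long as the box has a side longer than e, a slab of thickness e is
    split off along it; a box whose sides are at most e is kept exactly when
    it meets K. The sides are bounded in units of e by the integers s i,
    whose sum decreases at each split. *)
Lemma polybox_approx_box (K : set 'rV[R]_k) (e : R) (m : nat) : 0 < e ->
  forall (s : 'I_k -> nat) (lo hi : 'rV[R]_k),
  (forall i, hi ord0 i - lo ord0 i <= (s i)%:R * e) -> (\sum_i s i <= m)%N ->
  exists A, [/\ polybox A, K `&` box lo hi `<=` A, A `<=` box lo hi &
    A `<=` [set x | exists2 y, K y & forall i, `|x ord0 i - y ord0 i| <= e]].
Proof.
move=> e0; elim: m => [|m IH] s lo hi shl sm.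
  have [Kne|Ke] := pselect (K `&` box lo hi !=set0); last first.
    exists set0; split => //; first exact: polybox0.
    by move=> x Kx; apply: Ke; exists x.
  have [y [Ky by_]] := Kne.
  exists (box lo hi); split => //; first exact: polybox1.
  move=> x bx; exists y => // i; have := shl i.
  have /eqP -> : s i == 0%N.
    by move: sm; rewrite leqn0 sum_nat_eq0 => /forallP/(_ i).
  move: (bx i) (by_ i); rewrite mul0r => /andP[a b] /andP[c d] f.
  by rewrite ler_norml; lra.
have [[i]|Hle] := pselect (exists i, e < hi ord0 i - lo ord0 i); last first.
  have [Kne|Ke] := pselect (K `&` box lo hi !=set0); last first.
    exists set0; split => //; first exact: polybox0.
    by move=> x Kx; apply: Ke; exists x.
  have [y [Ky by_]] := Kne.
  exists (box lo hi); split => //; first exact: polybox1.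
  move=> x bx; exists y => // i.
  have : hi ord0 i - lo ord0 i <= e.
    by rewrite leNgt; apply/negP => H; apply: Hle; exists i.
  move: (bx i) (by_ i) => /andP[a b] /andP[c d] f.
  by rewrite ler_norml; lra.
move=> ei; have si : (1 < s i)%N.
  rewrite -(@ltr_nat R) -(ltr_pM2r e0) mul1r; exact: lt_le_trans (shl i).
pose s1 j := if j == i then 1%N else s j.
pose s2 j := if j == i then (s i).-1 else s j.
have sums (f : 'I_k -> nat) : (f i < s i)%N -> (forall j, j != i -> f j = s j) ->
    (\sum_j f j <= m)%N.
  move=> fi fj; rewrite -ltnS; apply: leq_trans sm.
  rewrite (bigD1 i)//= [in ltnRHS](bigD1 i)//= (eq_bigr s)//.
  by rewrite ltn_add2r.
pose c := lo ord0 i + e.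
pose hi1 : 'rV[R]_k := \row_j if j == i then c else hi ord0 j.
pose lo2 : 'rV[R]_k := \row_j if j == i then c else lo ord0 j.
have [||A1 [pA1 KA1 A1b A1e]] := IH s1 lo hi1.
- move=> j; rewrite mxE /s1; case: eqP => [->|_]; last exact: shl.
  by rewrite /c addrAC subrr add0r mul1r.
- by apply: sums => [|j /negbTE jNi]; rewrite /s1 ?eqxx ?jNi.
have [||A2 [pA2 KA2 A2b A2e]] := IH s2 lo2 hi.
- move=> j; rewrite mxE /s2; case: eqP => [->|_]; last exact: shl.
  rewrite /c opprD addrA lerBlDr (le_trans (shl i))//.
  by rewrite -{1}(prednK (ltnW si)) -natr1 mulrDl mul1r.
- apply: sums => [|j /negbTE jNi]; last by rewrite /s2 jNi.
  by rewrite /s2 eqxx prednK//; exact: ltnW.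
exists (A1 `|` A2); split.
- apply: (@polyboxU _ _ i c) => // x.
    by move=> /A1b/(_ i); rewrite mxE eqxx => /andP[].
  by move=> /A2b/(_ i); rewrite mxE eqxx => /andP[].
- move=> x [Kx bx]; have [xc|xc] := leP (x ord0 i) c.
    left; apply: KA1; split => // j; rewrite mxE; case: eqP => [->|_]; last exact: bx.
    by rewrite xc andbT; case/andP: (bx i).
  right; apply: KA2; split => // j; rewrite mxE; case: eqP => [->|_]; last exact: bx.
  by rewrite (ltW xc); case/andP: (bx i).
- move=> x [/A1b|/A2b] bx j; have := bx j; rewrite mxE; case: eqP => [->|//].
    by move=> /andP[-> /le_trans]; apply; rewrite /c -lerBrDl ltW.
  by move=> /andP[H ->]; rewrite andbT (le_trans _ H)// lerDl ltW.
- by move=> x [/A1e|/A2e].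
Qed.

Lemma compact_in_box (K : set 'rV[R]_k) : compact K ->
  exists2 M : R, 0 < M & forall x i, K x -> `|x ord0 i| <= M.
Proof.
move=> /compact_bounded[M [Mr HM]].
exists (`|M| + 1); first by rewrite ltr_pwDr.
move=> x i Kx; have := HM (`|M| + 1).
rewrite (le_lt_trans (ler_norm M)) ?ltrDl// => /(_ isT x Kx).
by apply: le_trans; exact: coord_le_norm.
Qed.

End compact_rV.

(** * The Brunn-Minkowski inequality, from boxes to compact sets *)

Section hadwiger_ohmann.
Context {R : realType} {k : nat} (P : probability 'rV[R]_k R).
Hypothesis P0 : forall i c, pr P [set x : 'rV[R]_k | x ord0 i = c] = 0.
Implicit Types (A B K : set 'rV[R]_k) (t : R).

Definition brunn_minkowski t A B : Prop :=
  pr P A `^ t * pr P B `^ (1 - t) <= pr P (minkowski t A B).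

Let measurable_hyperplane i c : measurable [set x : 'rV[R]_k | x ord0 i = c].
Proof.
rewrite (_ : [set _ | _] =
  [set x : 'rV[R]_k | x ord0 i <= c] `&` [set x : 'rV[R]_k | c <= x ord0 i]).
  by apply: measurableI; [exact: measurable_half_le|exact: measurable_half_ge].
apply/seteqP; split => [x /= ->|x /= [? ?]]; first by rewrite lexx.
by apply/eqP; rewrite eq_le; apply/andP.
Qed.

Let pr_hyperplane A i c : measurable A ->
  A `<=` [set x | x ord0 i = c] -> pr P A = 0.
Proof.
move=> mA AH; apply/eqP; rewrite eq_le pr_ge0 andbT -(P0 i c).
exact: le_pr.
Qed.

(** If two sets of mass p and p / s * q have the same share p / s of two
    larger sets of mass s and q, the geometric mean scales by this share as
    well. *)
Let powR_ratio t (s q p : R) : 0 < s -> 0 < q -> 0 <= p ->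
  p `^ t * (p / s * q) `^ (1 - t) = p / s * (s `^ t * q `^ (1 - t)).
Proof.
move=> s0 q0 p0; rewrite powRM ?divr_ge0 ?(ltW s0) ?(ltW q0)//.
move: p0; rewrite le_eqVlt => /predU1P[<-|p0].
  rewrite !mul0r.
  have [->|t1] := eqVneq t 1; last first.
    by rewrite [0 `^ (1 - t)]powR0 ?subr_eq0 ?(eq_sym 1)// mul0r mulr0.
  by rewrite powR0 ?oner_eq0 ?mul0r.
have -> : p = p / s * s by rewrite divfK// gt_eqF.
set r := p / s; have r0 : 0 < r by rewrite divr_gt0.
rewrite mulfK ?gt_eqF// powRM ?(ltW r0) ?(ltW s0)//.
have rE : r = r `^ t * r `^ (1 - t).
  by rewrite -powRD ?(gt_eqF r0) ?implybT// subrKC powRr1// ltW.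
rewrite [r in RHS]rE; ring.
Qed.

(** The induction of Hadwiger and Ohmann. When a coordinate hyperplane
    separates A1 from A2, B is cut by a parallel hyperplane into B1 and B2
    in the proportion of the masses of A1 and A2. The combinations of A1
    with B1 and of A2 with B2 then lie on the two sides of a null
    hyperplane, so their masses add up, and as the proportions agree, the
    inequalities for the two pairs add up to the one for the unions. The
    class Bs of second arguments only has to be stable under such cuts. *)
Lemma brunn_minkowski_polybox t (Bs : set 'rV[R]_k -> Prop) A : 0 < t < 1 ->
  (forall B, Bs B -> compact B) ->
  (forall B i c, Bs B -> Bs (B `&` [set x | x ord0 i <= c])) ->
  (forall B i c, Bs B -> Bs (B `&` [set x | c <= x ord0 i])) ->
  (forall lo hi B, Bs B -> brunn_minkowski t (box lo hi) B) ->
  polybox A -> forall B, Bs B -> brunn_minkowski t A B.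
Proof.
move=> /andP[t0 t1] Bc Bl Bg Bbox; elim => [|lo hi|A1 A2 i c pA1 IH1 pA2 IH2 A1c A2c] B BsB.
- by rewrite /brunn_minkowski pr0 powR0 ?gt_eqF// mul0r pr_ge0.
- exact: Bbox.
have cB := Bc _ BsB; have mB := compact_measurable_rV cB.
have cA1 := polybox_compact pA1; have cA2 := polybox_compact pA2.
have mA1 := compact_measurable_rV cA1; have mA2 := compact_measurable_rV cA2.
have t1' : 0 < 1 - t by rewrite subr_gt0.
have mM X Y : compact X -> compact Y -> measurable (minkowski t X Y).
  by move=> cX cY; apply: compact_measurable_rV; exact: minkowski_compact.
have cAU : compact (A1 `|` A2) by exact: compactU.
have pAle := prU_le P mA1 mA2.
have [pB0|pBN] := eqVneq (pr P B) 0.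
  by rewrite /brunn_minkowski pB0 [0 `^ (1 - t)]powR0 ?gt_eqF// mulr0 pr_ge0.
have pB : 0 < pr P B by rewrite lt_neqAle eq_sym pBN pr_ge0.
have degenerate X : compact X -> X `<=` A1 `|` A2 -> brunn_minkowski t X B ->
    pr P (A1 `|` A2) <= pr P X -> brunn_minkowski t (A1 `|` A2) B.
  move=> cX XA bX pX; rewrite /brunn_minkowski (@le_trans _ _ (pr P (minkowski t X B)))//.
    apply: le_trans bX; rewrite ler_wpM2r ?powR_ge0//.
    by rewrite ge0_ler_powR ?nnegrE ?pr_ge0// ltW.
  by apply: le_pr; [exact: mM|exact: mM|exact: minkowski_sub].
have [p10|p1N] := eqVneq (pr P A1) 0.
  apply: (degenerate A2) => //; last by rewrite (le_trans pAle)// p10 add0r.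
  exact: IH2.
have [p20|p2N] := eqVneq (pr P A2) 0.
  apply: (degenerate A1) => //; last by rewrite (le_trans pAle)// p20 addr0.
  exact: IH1.
have p1 : 0 < pr P A1 by rewrite lt_neqAle eq_sym p1N pr_ge0.
have p2 : 0 < pr P A2 by rewrite lt_neqAle eq_sym p2N pr_ge0.
set s := pr P A1 + pr P A2 in pAle.
have s0 : 0 < s by rewrite addr_gt0.
pose v := pr P A1 / s * pr P B.
have vB : 0 < v < pr P B.
  rewrite /v !mulr_gt0 ?invr_gt0//= gtr_pMl// ltr_pdivrMr// mul1r.
  by rewrite /s ltrDl.
have [c' /andP[c1 c2]] := quantile mB (@measurable_coord R k i) vB.
pose B1 := B `&` [set x | x ord0 i <= c'].
pose B2 := B `&` [set x | c' <= x ord0 i].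
have mB1 : measurable B1 by apply: measurableI => //; exact: measurable_half_le.
have mB2 : measurable B2 by apply: measurableI => //; exact: measurable_half_ge.
have mBl : measurable (B `&` [set x | x ord0 i < c']).
  by apply: measurableI => //; apply: measurable_lt; exact: measurable_coord.
have pB2 : pr P A2 / s * pr P B <= pr P B2.
  have -> : pr P A2 / s * pr P B = pr P B - v.
    by rewrite /v /s; field; rewrite gt_eqF.
  rewrite lerBlDr -lerBlDl (le_trans _ c1)// lerBlDr.
  apply: le_trans (prU_le P mBl mB2); apply: le_pr => //.
    exact: measurableU.
  by move=> x Bx; have [xc|xc] := ltP (x ord0 i) c'; [left|right].
have bm1 : pr P A1 / s * (s `^ t * pr P B `^ (1 - t)) <= pr P (minkowski t A1 B1).
  rewrite -powR_ratio// ?(ltW p1)//; apply: le_trans (IH1 _ (Bl _ i c' BsB)).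
  rewrite ler_wpM2l ?powR_ge0// ge0_ler_powR ?nnegrE ?pr_ge0 ?(ltW t1')//.
  by rewrite !mulr_ge0// ?invr_ge0 ltW.
have bm2 : pr P A2 / s * (s `^ t * pr P B `^ (1 - t)) <= pr P (minkowski t A2 B2).
  rewrite -powR_ratio// ?(ltW p2)//; apply: le_trans (IH2 _ (Bg _ i c' BsB)).
  rewrite ler_wpM2l ?powR_ge0// ge0_ler_powR ?nnegrE ?pr_ge0 ?(ltW t1')//.
  by rewrite !mulr_ge0// ?invr_ge0 ltW.
have cB1 : compact B1 by apply/Bc/Bl.
have cB2 : compact B2 by apply/Bc/Bg.
pose M1 := minkowski t A1 B1; pose M2 := minkowski t A2 B2.
have mM1 : measurable M1 by exact: mM.
have mM2 : measurable M2 by exact: mM.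
have M12 : pr P (M1 `|` M2) = pr P M1 + pr P M2.
  pose M2' := M2 `&` ~` M1.
  have mM2' : measurable M2' by apply: measurableI => //; exact: measurableC.
  have -> : M1 `|` M2 = M1 `|` M2'.
    apply/seteqP; split => x [M1x|]; [by left| |by left|by case=> ? _; right].
    by have [M1x|M1x] := pselect (M1 x); [left|right].
  rewrite pr_disjU//; last by rewrite /M2' setICA setICr setI0.
  rewrite (pr_setID P mM2 mM1) (@pr_hyperplane (M2 `&` M1) i (t * c + (1 - t) * c')) ?add0r//.
    exact: measurableI.
  move=> x [[a2 A2a [b2 [_ B2b] <-]] [a1 A1a [b1 [_ B1b] e]]] /=.
  apply/eqP; rewrite eq_le; apply/andP; split.
    by rewrite -e !mxE lerD// ler_wpM2l ?(ltW t0) ?(ltW t1')//; exact: A1c.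
  by rewrite !mxE lerD// ler_wpM2l ?(ltW t0) ?(ltW t1')//; exact: A2c.
rewrite /brunn_minkowski (@le_trans _ _ (pr P (M1 `|` M2)))//; last first.
  apply: le_pr; [exact: measurableU|exact: mM|].
  by move=> x [|]; apply: minkowski_sub => y //=; by [left|right|case].
rewrite M12; apply: le_trans (lerD bm1 bm2).
rewrite -mulrDl -mulrDl divff ?gt_eqF// mul1r ler_wpM2r ?powR_ge0//.
by rewrite ge0_ler_powR ?nnegrE ?pr_ge0 ?(ltW t0) ?(ltW s0).
Qed.

(** A polybox A close to K, and containing K, has combinations with B inside
    a small neighbourhood of the compact combination of K and B, whose mass
    is close to that of the combination itself. *)
Lemma brunn_minkowski_compact t (Bs : set 'rV[R]_k -> Prop) : 0 < t < 1 ->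
  (forall B, Bs B -> compact B) ->
  (forall B i c, Bs B -> Bs (B `&` [set x | x ord0 i <= c])) ->
  (forall B i c, Bs B -> Bs (B `&` [set x | c <= x ord0 i])) ->
  (forall lo hi B, Bs B -> brunn_minkowski t (box lo hi) B) ->
  forall K B, compact K -> Bs B -> brunn_minkowski t K B.
Proof.
move=> t01 Bc Bl Bg Bbox K B cK BsB; case/andP: (t01) => t0 t1.
have cB := Bc _ BsB.
pose C := minkowski t K B; have cC : compact C by exact: minkowski_compact.
pose F n := \bigcup_(y in C) ball y (n.+1%:R^-1 : R).
have oF n : open (F n) by apply: bigcup_open => y _; exact: ball_open.
have FC : \bigcap_n F n = C.
  apply/seteqP; split => [x Fx|x Cx n _]; last by exists x => //; exact: ballxx.
  have clC : closed C by apply: compact_closed => //; exact: norm_hausdorff.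
  apply: clC => U /nbhs_ballP[e /= e0 eU].
  have [n] := ltr_add_invr e0; rewrite add0r => ne.
  have [y Cy yx] := Fx n I; exists y; split => //; apply: eU.
  by apply: ball_sym; exact: le_ball (ltW ne) _ yx.
apply/ler_addgt0Pr => e e0.
have [|n] := @pr_bigcap_lt _ _ _ P F e (fun n => open_measurable_rV (oF n)) _ e0.
  move=> m n mn; apply/subsetPset; apply: subset_bigcup => y _.
  by apply: le_ball; rewrite lef_pV2 ?posrE// ler_nat ltnS.
rewrite FC => /ltW; apply: le_trans.
have [M M0 KM] := compact_in_box cK.
have n0 : (0 : R) < n.+2%:R^-1 by rewrite invr_gt0.
have [|A [pA KA _ Ae]] := @polybox_approx_box R k K (n.+2%:R^-1)
  (\sum_(i < k) (Num.truncn (2 * M / n.+2%:R^-1)).+1) n0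
  (fun=> (Num.truncn (2 * M / n.+2%:R^-1)).+1) (const_mx (- M)) (const_mx M) _ (leqnn _).
  move=> i; rewrite !mxE opprK -ler_pdivrMr// ltW//.
  by rewrite (_ : M + M = 2 * M) ?truncnS_gt//; ring.
have cA := polybox_compact pA.
have mF : measurable (F n) by exact: open_measurable_rV.
rewrite (@le_trans _ _ (pr P A `^ t * pr P B `^ (1 - t)))//.
  rewrite ler_wpM2r ?powR_ge0// ge0_ler_powR ?nnegrE ?pr_ge0 ?(ltW t0)//.
  apply: le_pr; [exact: compact_measurable_rV|exact: compact_measurable_rV|].
  move=> x Kx; apply: KA; split => // i; rewrite !mxE -ler_norml.
  exact: KM.
apply: le_trans (brunn_minkowski_polybox t01 Bc Bl Bg Bbox pA BsB) _.
apply: le_pr => //; first by apply: compact_measurable_rV; exact: minkowski_compact.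
move=> _ [a Aa [b Bb <-]]; have [y Ky ay] := Ae _ Aa.
exists (t *: y + (1 - t) *: b); first by exists y => //; exists b.
rewrite -ball_normE /=.
rewrite opprD addrACA subrr addr0 -scalerBr normrZ gtr0_norm//.
rewrite (@le_lt_trans _ _ n.+2%:R^-1)//; last first.
  by rewrite ltf_pV2 ?posrE// ltr_nat.
rewrite (@le_trans _ _ `|y - a|)//; first by rewrite ler_piMl// ltW.
apply: norm_le_coord => [|i]; first exact: ltW.
by rewrite !mxE distrC ay.
Qed.

(** The passage from boxes to compact sets is made twice: first in the first
    argument, the second one being a box; then, the roles being exchanged,
    with arbitrary compact sets as second arguments. *)
Lemma brunn_minkowski_boxes : (forall t lo hi lo' hi', 0 < t < 1 ->
    brunn_minkowski t (box lo hi) (box lo' hi')) ->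
  forall t K L, 0 < t < 1 -> compact K -> compact L -> brunn_minkowski t K L.
Proof.
move=> Hbox t K L t01 cK cL.
have bmC s A B : brunn_minkowski (1 - s) A B -> brunn_minkowski s B A.
  by rewrite /brunn_minkowski minkowskiC subKr mulrC.
have sC (s : R) : 0 < s < 1 -> 0 < 1 - s < 1.
  by move=> /andP[? ?]; rewrite subr_gt0 gtrBl; apply/andP; split.
(* Boxes can serve as second arguments, since cutting one by a coordinate
   half-space gives a box. *)
have step1 s lo hi A : 0 < s < 1 -> compact A -> brunn_minkowski s A (box lo hi).
  move=> s01 cA.
  pose Bs B := exists lo hi, B = box lo hi.
  apply: (@brunn_minkowski_compact s Bs s01) => //; last by exists lo, hi.
  - by move=> _ [l [h ->]]; exact: box_compact.
  - move=> _ i c [l [h ->]].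
    exists l, (\row_j if j == i then Num.min c (h ord0 i) else h ord0 j).
    apply/seteqP; split => [x [bx /= xc] j|x bx].
      rewrite mxE; case: eqP => [->|_]; last exact: bx.
      by rewrite le_min xc /= bx.
    split => [j|/=].
      have := bx j; rewrite mxE; case: eqP => [->|//].
      by rewrite le_min => /andP[-> /andP[_ ->]].
    by have := bx i; rewrite mxE eqxx le_min => /andP[_ /andP[]].
  - move=> _ i c [l [h ->]].
    exists (\row_j if j == i then Num.max c (l ord0 i) else l ord0 j), h.
    apply/seteqP; split => [x [bx /= xc] j|x bx].
      rewrite mxE; case: eqP => [->|_]; last exact: bx.
      by rewrite ge_max xc /= bx.
    split => [j|/=].
      have := bx j; rewrite mxE; case: eqP => [->|//].
      by rewrite ge_max => /andP[/andP[_ ->] ->].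
    by have := bx i; rewrite mxE eqxx ge_max => /andP[/andP[]].
  - by move=> l h _ [l' [h' ->]]; exact: Hbox.
apply: (@brunn_minkowski_compact t compact t01) => //.
- by move=> B i c cB; apply: compact_closedI => //; exact: closed_half_le.
- by move=> B i c cB; apply: compact_closedI => //; exact: closed_half_ge.
- by move=> lo hi B cB; apply: bmC; apply: step1 => //; exact: sC.
Qed.

End hadwiger_ohmann.

(** * Hyperplanes and log-concavity *)

Section dot.
Context {R : realType} {n : nat}.
Implicit Types (x : 'rV[R]_n) (u : 'cV[R]_n).

Definition dot x u : R := (x *m u) ord0 ord0.

Lemma dotE x u : dot x u = \sum_i x ord0 i * u i ord0.
Proof. by rewrite /dot mxE. Qed.

Lemma dotDl x y u : dot (x + y) u = dot x u + dot y u.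
Proof. by rewrite /dot mulmxDl mxE. Qed.

Lemma dotBl x y u : dot (x - y) u = dot x u - dot y u.
Proof. by rewrite /dot mulmxBl mxE [X in _ + X]mxE. Qed.

Lemma dotZl a x u : dot (a *: x) u = a * dot x u.
Proof. by rewrite /dot -scalemxAl mxE. Qed.

Lemma continuous_dot u : continuous (dot ^~ u).
Proof.
rewrite (_ : dot ^~ u = fun x => \sum_i x ord0 i * u i ord0); last first.
  by apply/funext => x; exact: dotE.
apply: continuous_big => [|i _]; first exact: add_continuous.
by move=> x; apply: continuousM; [exact: coord_continuous|exact: cst_continuous].
Qed.

Lemma measurable_dot u : measurable_fun setT (dot ^~ u).
Proof.
rewrite (_ : dot ^~ u = fun x => \sum_i x ord0 i * u i ord0); last first.
  by apply/funext => x; exact: dotE.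
apply: measurable_sum => i; apply: measurable_funM => //.
exact: measurable_coord.
Qed.

Lemma dot_neq0 u : u != 0 -> exists x, dot x u != 0.
Proof.
move=> /eqP u0; apply/not_existsP => H; apply: u0; apply/colP => i.
rewrite mxE; have /negP := H (delta_mx ord0 i); rewrite negbK => /eqP <-.
by rewrite /dot -rowE mxE.
Qed.

Lemma measurable_dot_eq u c : measurable [set x | dot x u = c].
Proof.
rewrite (_ : [set _ | _] = [set x | dot x u <= c] `&` [set x | c <= dot x u]).
  by apply: measurableI; [apply: measurable_le|apply: measurable_ge]; exact: measurable_dot.
apply/seteqP; split => [x /= ->|x /= [? ?]]; first by rewrite lexx.
by apply/eqP; rewrite eq_le; apply/andP.
Qed.

Let proj_compl (W : {vspace 'rV[R]_n}) := 1%:M - lin1_mx (projv W).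

Let dot_proj_compl (W : {vspace 'rV[R]_n}) i x :
  dot x (col i (proj_compl W)) = (x - projv W x) ord0 i.
Proof.
by rewrite /dot colE mulmxA -colE mxE mulmxBr mulmx1 mul_rV_lin1.
Qed.

Let mem_dot (W : {vspace 'rV[R]_n}) x :
  x \in W <-> forall i, dot x (col i (proj_compl W)) = 0.
Proof.
split=> [xW i|H]; first by rewrite dot_proj_compl projv_id// subrr mxE.
rewrite -(subrK (projv W x) x) rpredD ?memv_proj//.
rewrite (_ : _ - _ = 0) ?rpred0//; apply/rowP => i.
by rewrite -dot_proj_compl H mxE.
Qed.

Lemma measurable_affine v (W : {vspace 'rV[R]_n}) :
  measurable [set x | x - v \in W].
Proof.
have -> : [set x | x - v \in W] = \bigcap_(i in [set: 'I_n])
    [set x | dot x (col i (proj_compl W)) = dot v (col i (proj_compl W))].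
  apply/seteqP; split => [x /= /mem_dot xW i _|x xW]; last first.
    by apply/mem_dot => i; rewrite dotBl (xW i I) subrr.
  by have := xW i; rewrite dotBl => /eqP; rewrite subr_eq0 => /eqP.
by apply: fin_bigcap_measurable => // i _; exact: measurable_dot_eq.
Qed.

(** A nonzero column of the complementary projection to W is a normal
    vector. *)
Lemma subspace_hyperplane (W : {vspace 'rV[R]_n}) : (\dim W < n)%N ->
  exists2 u, u != 0 & forall x, x \in W -> dot x u = 0.
Proof.
move=> Wn; have [x0 x0W] : exists x0, x0 \notin W.
  apply/not_existsP => H; move: Wn; suff -> : W = fullv.
    by rewrite dimvf /dim/= mul1n ltnn.
  by apply/vspaceP => x; rewrite memvf; apply/negPn/negP/H.
have [i x0i] : exists i, dot x0 (col i (proj_compl W)) != 0.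
  apply/not_existsP => H; case/negP: x0W; apply/mem_dot => i.
  by apply/eqP/negPn/negP/H.
exists (col i (proj_compl W)) => [|x xW]; last by move/mem_dot : xW.
by apply: contraNneq x0i => ->; rewrite /dot mulmx0 mxE.
Qed.

Lemma hyperplane_subspace u : u != 0 ->
  exists2 W : {vspace 'rV[R]_n}, (\dim W < n)%N &
    forall x, (x \in W) = (dot x u == 0).
Proof.
move=> u0; pose f : 'Hom('rV[R]_n, 'M[R]_1) := linfun (mulmxr u).
have fE x : f x = x *m u by rewrite lfunE.
exists (lker f) => [|x]; last first.
  rewrite memv_ker fE /dot; apply/eqP/eqP => [->|d0]; first by rewrite mxE.
  by apply/matrixP => i j; rewrite !ord1 d0 mxE.
have := limg_ker_dim f fullv; rewrite capfv dimvf /dim/= mul1n => dimE.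
rewrite -[ltnRHS]dimE -[ltnLHS]addn0 ltn_add2l lt0n dimv_eq0.
have [x xu] := dot_neq0 u0; apply: contraNneq xu => f0.
have : f x \in (f @: fullv)%VS by apply: memv_img; exact: memvf.
by rewrite f0 memv0 fE /dot => /eqP ->; rewrite mxE.
Qed.

End dot.

Section log_concave_basics.
Context {R : realType} {n : nat} (mu : probability 'rV[R]_n R).

Lemma log_concave_brunn_minkowski t A B : log_concave mu -> 0 < t < 1 -> compact A ->
  compact B -> brunn_minkowski mu t A B.
Proof.
move=> [_ H _] t01 cA cB; have := H t A B t01 cA cB.
have mA := compact_measurable_rV cA; have mB := compact_measurable_rV cB.
have mM := compact_measurable_rV (minkowski_compact (t := t) cA cB).
rewrite (prE mu mA) (prE mu mB) (prE mu mM) !poweR_EFin.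
by rewrite -EFinM lee_fin.
Qed.

Lemma log_concave_hyperplane u c : log_concave mu -> u != 0 ->
  mu [set x | dot x u = c] = 0%E.
Proof.
move=> [_ _ H] u0; have [W Wn WE] := hyperplane_subspace u0.
have [x xu] := dot_neq0 u0.
rewrite -(H (c / dot x u *: x) W Wn); congr (mu _); apply/seteqP; split => y /=;
  rewrite WE dotBl dotZl divfK//.
  by move=> ->; rewrite subrr.
by rewrite subr_eq0 => /eqP.
Qed.

(** It is enough that hyperplanes are null, because every affine subspace of
    smaller dimension lies in one. *)
Lemma brunn_minkowski_log_concave : (0 < n)%N ->
  (forall t A B, 0 < t < 1 -> compact A -> compact B -> brunn_minkowski mu t A B) ->
  (forall u c, u != 0 -> mu [set x | dot x u = c] = 0%E) -> log_concave mu.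
Proof.
move=> n0 Hbm H0; split => // [t A B t01 cA cB|v W Wn].
  have mA := compact_measurable_rV cA; have mB := compact_measurable_rV cB.
  have mM := compact_measurable_rV (minkowski_compact (t := t) cA cB).
  rewrite (prE mu mA) (prE mu mB) (prE mu mM) !poweR_EFin.
  by rewrite -EFinM lee_fin; exact: Hbm.
have [u u0 Wu] := subspace_hyperplane Wn.
apply/eqP; rewrite -measure_le0 -(H0 u (dot v u) u0) le_measure ?inE//.
- exact: measurable_affine.
- exact: measurable_dot_eq.
move=> x /= /Wu; rewrite dotBl.
by move/eqP; rewrite subr_eq0 => /eqP.
Qed.

End log_concave_basics.

(** * Products of log-concave measures *)

Section product_rV_theory.
Context {R : realType} {m n : nat}.
Variables (mu : probability 'rV[R]_m R) (nu : probability 'rV[R]_n R).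

Lemma tonelli_rV1 (f : 'rV[R]_(m + n) -> \bar R) : measurable_fun setT f ->
  (forall z, 0 <= f z)%E ->
  (\int[product_rV mu nu]_z f z = \int[mu]_x \int[nu]_y f (row_mx x y))%E.
Proof.
move=> mf f0; rewrite ge0_integral_distribution// fubini_tonelli1//; first exact: measurableT_comp.
by move=> z; exact: f0.
Qed.

Lemma tonelli_rV2 (f : 'rV[R]_(m + n) -> \bar R) : measurable_fun setT f ->
  (forall z, 0 <= f z)%E ->
  (\int[product_rV mu nu]_z f z = \int[nu]_y \int[mu]_x f (row_mx x y))%E.
Proof.
move=> mf f0; rewrite ge0_integral_distribution// fubini_tonelli2//; first exact: measurableT_comp.
by move=> z; exact: f0.
Qed.

Lemma measurable_row_mxl (y : 'rV[R]_n) :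
  measurable_fun setT (fun x : 'rV[R]_m => row_mx x y).
Proof.
apply: (measurableT_comp (@measurable_join_rV R m n)
  (_ : measurable_fun setT (fun x => (x, y)))).
exact: measurable_fun_pair.
Qed.

Lemma measurable_lsubmx : measurable_fun setT (@lsubmx R 1 m n).
Proof.
apply: measurable_rV => i; under eq_fun do rewrite mxE.
exact: measurable_coord.
Qed.

Lemma measurable_rsubmx : measurable_fun setT (@rsubmx R 1 m n).
Proof.
apply: measurable_rV => i; under eq_fun do rewrite mxE.
exact: measurable_coord.
Qed.

Lemma measurable_rect (A : set 'rV[R]_m) (B : set 'rV[R]_n) :
  measurable A -> measurable B ->
  measurable [set z : 'rV[R]_(m + n) | A (lsubmx z) /\ B (rsubmx z)].
Proof.
move=> mA mB; apply: measurableI.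
  by have := measurable_lsubmx measurableT mA; rewrite setTI.
by have := measurable_rsubmx measurableT mB; rewrite setTI.
Qed.

Lemma product_rV_rect (A : set 'rV[R]_m) (B : set 'rV[R]_n) :
  measurable A -> measurable B ->
  pr (product_rV mu nu) [set z | A (lsubmx z) /\ B (rsubmx z)] =
  pr mu A * pr nu B.
Proof.
move=> mA mB; apply: EFin_inj.
rewrite EFinM -!prE//; last exact: measurable_rect.
rewrite -product_measure1E//.
transitivity ((mu \x nu)%E (@join_rV R m n @^-1`
  [set z | A (lsubmx z) /\ B (rsubmx z)])) => //.
congr product_measure1; apply/seteqP.
by split => -[x y] /=; rewrite /join_rV/= row_mxKl row_mxKr.
Qed.

(** For two products of boxes both sides of the inequality factor, and boxes
    suffice. Hyperplanes are null by integration: one block of the normal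
    vector is not zero, and for each value of the other block of variables
    the section is a null hyperplane. *)
Lemma log_concave_product : log_concave mu -> log_concave nu ->
  log_concave (product_rV mu nu).
Proof.
move=> lmu lnu; have [m0 _ _] := lmu; have [n0 _ _] := lnu.
have Hh u c : u != 0 -> product_rV mu nu [set x | dot x u = c] = 0%E.
  move=> u0; have mE := measurable_dot_eq u c.
  have dE x y : dot (row_mx x y) u = dot x (usubmx u) + dot y (dsubmx u).
    by rewrite /dot -{1}(vsubmxK u) mul_row_col mxE.
  have mf : measurable_fun setT (fun z : 'rV[R]_(m + n) =>
      (\1_[set x | dot x u = c] z)%:E : \bar R).
    by apply/measurable_EFinP; exact: measurable_indic.
  have -> : product_rV mu nu [set x | dot x u = c] =
      (\int[product_rV mu nu]_z (\1_[set x | dot x u = c] z)%:E)%E.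
    by rewrite integral_indic// setIT.
  have [d0|dN] := eqVneq (dsubmx u) 0.
    rewrite tonelli_rV2//.
    apply: integral0_eq => y _.
    rewrite (_ : (fun x => _) = fun x : 'rV[R]_m =>
        (\1_[set x | dot x (usubmx u) = c - dot y (dsubmx u)] x)%:E); last first.
      apply/funext => x; rewrite !indicE; congr (nat_of_bool _)%:R%:E.
      by apply/idP/idP => /set_mem/= H; apply/mem_set => /=; move: H; rewrite dE; lra.
    rewrite integral_indic//; last exact: measurable_dot_eq.
    rewrite setIT; apply: log_concave_hyperplane => //.
    by apply: contraNneq u0 => w0; rewrite -(vsubmxK u) d0 w0 col_mx0.
  rewrite tonelli_rV1//.
  apply: integral0_eq => x _.
  rewrite (_ : (fun y => _) = fun y : 'rV[R]_n =>
      (\1_[set y | dot y (dsubmx u) = c - dot x (usubmx u)] y)%:E); last first.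
    apply/funext => y; rewrite !indicE; congr (nat_of_bool _)%:R%:E.
    by apply/idP/idP => /set_mem/= H; apply/mem_set => /=; move: H; rewrite dE; lra.
  rewrite integral_indic//; last exact: measurable_dot_eq.
  by rewrite setIT; exact: log_concave_hyperplane.
apply: brunn_minkowski_log_concave => //; first by rewrite addn_gt0 m0.
move=> t A B t01 cA cB; apply: brunn_minkowski_boxes => //.
  move=> i c; rewrite /pr -[RHS]/(fine 0%E) -(Hh (delta_mx i ord0) c).
    by congr (fine (_ _)); apply/seteqP; split => x /=; rewrite /dot -colE mxE.
  apply/eqP => /matrixP/(_ i ord0); rewrite !mxE !eqxx.
  by move/eqP; rewrite oner_eq0.
move=> s lo hi lo' hi' s01.
have boxE l h : box l h = [set z : 'rV[R]_(m + n) |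
    box (lsubmx l) (lsubmx h) (lsubmx z) /\ box (rsubmx l) (rsubmx h) (rsubmx z)].
  apply/seteqP; split => [z bz|z [bz1 bz2] i].
    by split => i; rewrite !mxE; exact: bz.
  rewrite -(fintype.splitK i); case: (fintype.split i) => j /=.
    by have := bz1 j; rewrite !mxE.
  by have := bz2 j; rewrite !mxE.
have cb k (l h : 'rV[R]_k) : compact (box l h) by exact: box_compact.
have mb k (l h : 'rV[R]_k) : measurable (box l h).
  by apply: compact_measurable_rV; exact: box_compact.
have bm1 := log_concave_brunn_minkowski lmu s01 (cb _ (lsubmx lo) (lsubmx hi)) (cb _ (lsubmx lo') (lsubmx hi')).
have bm2 := log_concave_brunn_minkowski lnu s01 (cb _ (rsubmx lo) (rsubmx hi)) (cb _ (rsubmx lo') (rsubmx hi')).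
rewrite /brunn_minkowski {1 2}boxE product_rV_rect ?powRM ?pr_ge0//.
rewrite boxE product_rV_rect ?powRM ?pr_ge0// mulrACA.
apply: le_trans (ler_pM _ _ bm1 bm2) _; rewrite ?mulr_ge0 ?powR_ge0//.
have mM1 : measurable (minkowski s (box (lsubmx lo) (lsubmx hi)) (box (lsubmx lo') (lsubmx hi'))).
  by apply: compact_measurable_rV; apply: minkowski_compact.
have mM2 : measurable (minkowski s (box (rsubmx lo) (rsubmx hi)) (box (rsubmx lo') (rsubmx hi'))).
  by apply: compact_measurable_rV; apply: minkowski_compact.
rewrite -product_rV_rect//; apply: le_pr.
- exact: measurable_rect.
- by rewrite -!boxE; apply: compact_measurable_rV; apply: minkowski_compact.
move=> z [[a1 Aa1 [b1 Bb1 e1]] [a2 Aa2 [b2 Bb2 e2]]].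
exists (row_mx a1 a2); first by rewrite /= row_mxKl row_mxKr.
exists (row_mx b1 b2); first by rewrite /= row_mxKl row_mxKr.
by rewrite !scale_row_mx add_row_mx e1 e2 hsubmxK.
Qed.

End product_rV_theory.

(** * Approximation by linear images of product laws *)

Lemma probability_setT_lty d (T : measurableType d) (R : realType)
  (P : probability T R) : (P setT < +oo)%E.
Proof. by rewrite probability_setT ltry. Qed.

Lemma mean_cst d (T : measurableType d) (R : realType)
  (P : probability T R) (c : R) : \int[P]_x c = c.
Proof.
rewrite Rintegral_cst// -[RHS]mulr1; congr (_ * _).
by have /(congr1 fine) := probability_setT P.
Qed.

Section test_functions.
Context {R : realType}.

Definition lipschitz_by n (L : R) (f : 'rV[R]_n -> R) :=
  0 <= L /\ forall x y, `|f x - f y| <= L * `|x - y|.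

(** Lipschitz functions with values in the unit interval are enough to
    distinguish weak limits, and integrating out a block of variables
    visibly preserves this class. *)
Definition test_fun n (f : 'rV[R]_n -> R) :=
  (forall x, 0 <= f x <= 1) /\ exists L, lipschitz_by L f.

Lemma lipschitz_continuous n L (f : 'rV[R]_n -> R) :
  lipschitz_by L f -> continuous f.
Proof.
move=> [L0 fL] x; apply/(@cvgrPdist_lt _ _ _ _ (nbhs_filter x)) => e e0.
have L1 : 0 < L + 1 by rewrite ltr_wpDl.
apply/nbhs_ballP; exists (e / (L + 1)) => /=; first by rewrite divr_gt0.
move=> y; rewrite -ball_normE /= ltr_pdivlMr// mulrC => xy.
by rewrite (le_lt_trans (fL _ _))// (le_lt_trans _ xy)// ler_wpM2r// lerDl.
Qed.

Lemma test_continuous n (f : 'rV[R]_n -> R) : test_fun f -> continuous f.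
Proof. by move=> [_ [L]]; exact: lipschitz_continuous. Qed.

Lemma continuous_measurable_rV n (f : 'rV[R]_n -> R) : continuous f ->
  measurable_fun setT f.
Proof.
move=> cf; apply: (measurability _ (RGenOpens.measurableE R)).
move=> _ [_ [a [b ->] <-]]; rewrite setTI; apply: open_measurable_rV.
by apply: open_comp => [x _|]; [exact: cf|exact: interval_open].
Qed.

Lemma lipschitz_measurable n L (f : 'rV[R]_n -> R) :
  lipschitz_by L f -> measurable_fun setT f.
Proof. by move=> /lipschitz_continuous /continuous_measurable_rV. Qed.

Lemma lipschitz_dist n (y : 'rV[R]_n) : lipschitz_by 1 (fun x => `|x - y|).
Proof.
split => // x z; rewrite mul1r (le_trans (ler_dist_dist _ _))//.
by rewrite opprB addrA subrK.
Qed.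

Lemma test_measurable n (f : 'rV[R]_n -> R) : test_fun f ->
  measurable_fun setT f.
Proof. by move=> /test_continuous /continuous_measurable_rV. Qed.

Lemma test_integrable n (P : probability 'rV[R]_n R) f : test_fun f ->
  P.-integrable setT (EFin \o f).
Proof.
move=> tf; apply: measurable_bounded_integrable => //.
- exact: probability_setT_lty.
- exact: test_measurable.
exists 1; split => // M M1 x _ /=; rewrite (le_trans _ (ltW M1))//.
by have [/(_ x)/andP[f0 f1] _] := tf; rewrite ger0_norm.
Qed.

Lemma test_integralE n (P : probability 'rV[R]_n R) f : test_fun f ->
  (\int[P]_x (f x)%:E = (\int[P]_x f x)%:E)%E.
Proof.
move=> tf; rewrite /Rintegral fineK//.
by apply: integrable_fin_num => //; exact: test_integrable.
Qed.

Lemma test_integral01 n (P : probability 'rV[R]_n R) f : test_fun f ->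
  0 <= \int[P]_x f x <= 1.
Proof.
move=> tf; have [f01 _] := tf; apply/andP; split.
  by apply: Rintegral_ge0 => x _; case/andP: (f01 x).
rewrite -[leRHS](mean_cst P).
apply: le_Rintegral => //; first exact: test_integrable.
  apply: (@test_integrable n P (cst 1)); split => [x|]; first by rewrite ler01 lexx.
  by exists 0; split => // x y; rewrite subrr normr0 mul0r.
by move=> x _; case/andP: (f01 x).
Qed.

Definition mx_bound m n (M : 'M[R]_(m, n)) := \sum_i \sum_j `|M i j|.

Lemma mx_bound_ge0 m n (M : 'M[R]_(m, n)) : 0 <= mx_bound M.
Proof. by apply: sumr_ge0 => i _; apply: sumr_ge0. Qed.

Lemma norm_mulmx m n (x : 'rV[R]_m) (M : 'M[R]_(m, n)) :
  `|x *m M| <= mx_bound M * `|x|.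
Proof.
apply: norm_le_coord => [|j]; first by rewrite mulr_ge0// mx_bound_ge0.
rewrite mxE (le_trans (ler_norm_sum _ _ _))// /mx_bound mulr_suml.
apply: ler_sum => i _; rewrite normrM mulrC ler_pM//; last exact: coord_le_norm.
by rewrite (bigD1 j)//= lerDl; apply: sumr_ge0.
Qed.

Lemma sum_col_le_mx_bound m n (M : 'M[R]_(m, n)) a :
  \sum_i `|M i a| <= mx_bound M.
Proof.
by apply: ler_sum => i _; rewrite (bigD1 a)//= lerDl; apply: sumr_ge0.
Qed.

Lemma test_comp_mulmx m n (f : 'rV[R]_n -> R) (M : 'M[R]_(m, n)) :
  test_fun f -> test_fun (fun x => f (x *m M)).
Proof.
move=> [f01 [L [L0 fL]]]; split => //; exists (L * mx_bound M).
split => [|x y]; first by rewrite mulr_ge0// mx_bound_ge0.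
apply: le_trans (fL _ _) _.
by rewrite -mulrA ler_wpM2l// -mulmxBl norm_mulmx.
Qed.

Lemma norm_row_mx0r m n (x : 'rV[R]_m) : `|row_mx x (0 : 'rV[R]_n)| <= `|x|.
Proof.
apply: norm_le_coord => // i; rewrite -(fintype.splitK i).
case: (fintype.split i) => j /=; rewrite ?row_mxEl ?row_mxEr; first exact: coord_le_norm.
by rewrite mxE normr0.
Qed.

Lemma norm_row_mx0l m n (y : 'rV[R]_n) : `|row_mx (0 : 'rV[R]_m) y| <= `|y|.
Proof.
apply: norm_le_coord => // i; rewrite -(fintype.splitK i).
case: (fintype.split i) => j /=; rewrite ?row_mxEl ?row_mxEr; last exact: coord_le_norm.
by rewrite mxE normr0.
Qed.

Lemma test_row_mxl m n (f : 'rV[R]_(m + n) -> R) y : test_fun f ->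
  test_fun (fun x => f (row_mx x y)).
Proof.
move=> [f01 [L [L0 fL]]]; split => //; exists L; split => // x x'.
apply: le_trans (fL _ _) _; rewrite ler_wpM2l// opp_row_mx add_row_mx subrr.
exact: norm_row_mx0r.
Qed.

Lemma test_row_mxr m n (f : 'rV[R]_(m + n) -> R) x : test_fun f ->
  test_fun (fun y => f (row_mx x y)).
Proof.
move=> [f01 [L [L0 fL]]]; split => //; exists L; split => // y y'.
apply: le_trans (fL _ _) _; rewrite ler_wpM2l// opp_row_mx add_row_mx subrr.
exact: norm_row_mx0l.
Qed.

Lemma test_partial_mean m n (P : probability 'rV[R]_n R)
    (f : 'rV[R]_m -> 'rV[R]_n -> R) :
  (forall x, test_fun (f x)) ->
  (exists2 L, 0 <= L & forall x x' y, `|f x y - f x' y| <= L * `|x - x'|) ->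
  test_fun (fun x => \int[P]_y f x y).
Proof.
move=> tf [L L0 fL]; split => [x|]; first exact: test_integral01.
exists L; split => // x x'; have le z z' :
    \int[P]_y f z y - \int[P]_y f z' y <= L * `|z - z'|.
  rewrite lerBlDr.
  have ic : P.-integrable setT (EFin \o cst (L * `|z - z'|)).
    apply: measurable_bounded_integrable => //.
      exact: probability_setT_lty.
    exact: bounded_cst.
  rewrite -[X in _ <= X + _](mean_cst P).
  rewrite -RintegralD//; last exact: test_integrable.
  apply: le_Rintegral => //; first exact: test_integrable.
    rewrite (_ : EFin \o _ = (EFin \o cst (L * `|z - z'|)) \+ (EFin \o f z')) //.
    by apply: integrableD => //; exact: test_integrable.
  by move=> y _; rewrite -lerBlDr (le_trans (ler_norm _)).
by rewrite ler_norml le andbT lerNl opprB distrC le.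
Qed.

Section product.
Variables (m n : nat) (mu : probability 'rV[R]_m R) (nu : probability 'rV[R]_n R).
Variables (f : 'rV[R]_(m + n) -> R) (tf : test_fun f).

Lemma test_mean_row_mxl : test_fun (fun x => \int[nu]_y f (row_mx x y)).
Proof.
apply: (@test_partial_mean _ _ nu (fun x y => f (row_mx x y))) => //.
  by move=> x; exact: test_row_mxr.
have [_ [L [L0 fL]]] := tf; exists L => // x x' y.
apply: le_trans (fL _ _) _; rewrite ler_wpM2l// opp_row_mx add_row_mx subrr.
exact: norm_row_mx0r.
Qed.

Lemma test_mean_row_mxr : test_fun (fun y => \int[mu]_x f (row_mx x y)).
Proof.
apply: (@test_partial_mean _ _ mu (fun y x => f (row_mx x y))) => //.
  by move=> y; exact: test_row_mxl.
have [_ [L [L0 fL]]] := tf; exists L => // y y' x.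
apply: le_trans (fL _ _) _; rewrite ler_wpM2l// opp_row_mx add_row_mx subrr.
exact: norm_row_mx0l.
Qed.

Lemma test_fubini1 :
  \int[product_rV mu nu]_z f z = \int[mu]_x \int[nu]_y f (row_mx x y).
Proof.
apply: EFin_inj; rewrite -!test_integralE//; last exact: test_mean_row_mxl.
rewrite tonelli_rV1//.
- apply: eq_integral => x _; apply: test_integralE; exact: test_row_mxr.
- by apply/measurable_EFinP; exact: test_measurable.
by move=> z; rewrite lee_fin; case: tf => /(_ z)/andP[].
Qed.

Lemma test_fubini2 :
  \int[product_rV mu nu]_z f z = \int[nu]_y \int[mu]_x f (row_mx x y).
Proof.
apply: EFin_inj; rewrite -!test_integralE//; last exact: test_mean_row_mxr.
rewrite tonelli_rV2//.
- apply: eq_integral => y _; apply: test_integralE; exact: test_row_mxl.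
- by apply/measurable_EFinP; exact: test_measurable.
by move=> z; rewrite lee_fin; case: tf => /(_ z)/andP[].
Qed.

End product.

End test_functions.

Lemma near_forall (T : Type) (U : set_system T) (FU : Filter U) (I : finType)
    (Q : I -> T -> Prop) :
  (forall i, \forall l \near U, Q i l) -> \forall l \near U, forall i, Q i l.
Proof.
move=> H; have : \forall l \near U, forall i, [set: I] i -> Q i l.
  by apply: filter_forall => i; apply: filterS (H i).
by apply: filterS => l Hl i; exact: Hl.
Qed.

Section approximable.
Context {R : realType}.

(** The laws of vectors with independent one-dimensional log-concave
    coordinates. Products are associated in all possible ways, so that
    closure under products is a constructor. *)
Inductive prodlaw : forall n, probability 'rV[R]_n R -> Prop :=
| prodlaw1 (nu : probability 'rV[R]_1 R) : log_concave nu -> prodlaw nu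
| prodlawM m n (mu : probability 'rV[R]_m R) (nu : probability 'rV[R]_n R) :
    prodlaw mu -> prodlaw nu -> prodlaw (product_rV mu nu).

Lemma prodlaw_log_concave n (P : probability 'rV[R]_n R) :
  prodlaw P -> log_concave P.
Proof. elim=> // m k mu nu _ lmu _ lnu; exact: log_concave_product. Qed.

(** mu lies in the weak closure of the linear images of product laws, as
    expressed by the basic neighbourhoods that finitely many test functions
    define. The number N of independent coordinates is unbounded. Speaking
    of neighbourhoods rather than of sequences makes the class closed under
    weak limits without any diagonal argument. *)
Definition approximable n (mu : probability 'rV[R]_n R) :=
  forall k (f : 'I_k -> 'rV[R]_n -> R) (e : R),
    (forall i, test_fun (f i)) -> 0 < e ->
    exists N (P : probability 'rV[R]_N R) (M : 'M[R]_(N, n)), prodlaw P /\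
      forall i, `|\int[P]_w f i (w *m M) - \int[mu]_x f i x| < e.

Definition approximable_class : measure_class :=
  fun n (mu : probability 'rV[R]_n R) => log_concave mu /\ approximable mu.

(** The factors are replaced one at a time: first mu, tested against the
    averages of the f i over nu; then nu, tested against their averages over
    the law that has replaced mu. *)
Lemma approximable_products : closed_products approximable_class.
Proof.
move=> m n mu nu [lmu amu] [lnu anu]; split; first exact: log_concave_product.
move=> k f e tf e0; have e2 : 0 < e / 2 by rewrite divr_gt0.
have [N1 [P1 [M1 [pP1 H1]]]] :=
  amu k _ _ (fun i => test_mean_row_mxl nu (tf i)) e2.
have tg i : test_fun (fun y => \int[P1]_w f i (row_mx (w *m M1) y)).
  apply: (@test_partial_mean _ _ _ P1 (fun y w => f i (row_mx (w *m M1) y))) => //.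
    move=> y; apply: (test_comp_mulmx (f := fun x => f i (row_mx x y))).
    exact: test_row_mxl.
  have [_ [L [L0 fL]]] := tf i; exists L => // y y' x.
  apply: le_trans (fL _ _) _; rewrite ler_wpM2l// opp_row_mx add_row_mx subrr.
  exact: norm_row_mx0l.
have [N2 [P2 [M2 [pP2 H2]]]] := anu k _ _ tg e2.
exists (N1 + N2)%N, (product_rV P1 P2), (block_mx M1 0 0 M2); split.
  exact: prodlawM.
move=> i; pose F w := f i (w *m block_mx M1 0 0 M2).
have tF : test_fun F by exact: test_comp_mulmx.
have -> : \int[product_rV P1 P2]_w f i (w *m block_mx M1 0 0 M2) =
    \int[P2]_y \int[P1]_x f i (row_mx (x *m M1) (y *m M2)).
  rewrite -/F (test_fubini2 P1 P2 tF); congr Rintegral; apply/funext => y.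
  congr Rintegral; apply/funext => x; rewrite /F mul_row_block.
  by rewrite !mulmx0 addr0 add0r.
(* Exchanges the integrals over P1 and nu, as iterated integrals of one
   test function G on the product of their spaces. *)
have E1 : \int[P1]_w \int[nu]_y f i (row_mx (w *m M1) y) =
    \int[nu]_y \int[P1]_w f i (row_mx (w *m M1) y).
  pose G (z : 'rV[R]_(N1 + n)) := f i (z *m block_mx M1 0 0 1%:M).
  have tG : test_fun G by exact: test_comp_mulmx.
  have GE x y : G (row_mx x y) = f i (row_mx (x *m M1) y).
    by rewrite /G mul_row_block !mulmx0 addr0 add0r mulmx1.
  have := test_fubini1 P1 nu tG; rewrite (test_fubini2 P1 nu tG).
  under [X in X = _ -> _]eq_Rintegral do under eq_Rintegral do rewrite GE.
  by under [X in _ = X -> _]eq_Rintegral do under eq_Rintegral do rewrite GE.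
rewrite (splitr e) (test_fubini1 mu nu (tf i)).
rewrite -(subrKA (\int[nu]_y \int[P1]_w f i (row_mx (w *m M1) y))).
apply: le_lt_trans (ler_normD _ _) _; apply: ltrD; first exact: H2.
by rewrite -E1; exact: H1.
Qed.

Lemma linear_mulmx m n (T : {linear 'rV[R]_m -> 'rV[R]_n}) x :
  T x = x *m lin1_mx T.
Proof. by rewrite mul_rV_lin1. Qed.

Lemma measurable_mulmx m n (M : 'M[R]_(m, n)) :
  measurable_fun setT (fun x : 'rV[R]_m => x *m M).
Proof.
apply: measurable_rV => i; under eq_fun do rewrite mxE.
apply: measurable_sum => j; apply: measurable_funM => //.
exact: measurable_coord.
Qed.

Lemma approximable_linear : closed_linear approximable_class.
Proof.
move=> m n mu nu T [lmu amu] lnu nuE; split => // k f e tf e0.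
have tfT i : test_fun (fun x => f i (x *m lin1_mx T)) by exact: test_comp_mulmx.
have [N [P [M [pP H]]]] := amu k _ _ tfT e0.
exists N, P, (M *m lin1_mx T); split => // i.
have mT : measurable_fun setT T.
  apply: eq_measurable_fun (measurable_mulmx (lin1_mx T)) => x _.
  by rewrite linear_mulmx.
pose X : {mfun 'rV[R]_m >-> 'rV[R]_n} := HB.pack (T : 'rV[R]_m -> 'rV[R]_n)
  (isMeasurableFun.Build _ _ _ _ _ mT).
have -> : \int[nu]_x f i x = \int[mu]_x f i (x *m lin1_mx T).
  apply: EFin_inj; rewrite -!test_integralE//.
  rewrite (eq_measure_integral (distribution mu X)); last first.
    by move=> A mA _; exact: nuE.
  rewrite ge0_integral_distribution//.
  - by apply: eq_integral => x _ /=; rewrite linear_mulmx.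
  - by apply/measurable_EFinP; exact: test_measurable.
  by move=> x; rewrite lee_fin; case: (tf i) => /(_ x)/andP[].
under eq_Rintegral do rewrite mulmxA.
exact: H.
Qed.

Lemma approximable_weak_limits : closed_weak_limits approximable_class.
Proof.
move=> n mu_ nu Cmu lnu wc; split => // k f e tf e0.
have e2 : 0 < e / 2 by rewrite divr_gt0.
have cv i : \forall j \near \oo,
    `|\int[nu]_x f i x - \int[mu_ j]_x f i x| < e / 2.
  have := wc (f i) (test_continuous (tf i)).
  have bf : bounded_fun (f i).
    exists 1; split => // M M1 x _ /=; rewrite (le_trans _ (ltW M1))//.
    by have [/(_ x)/andP[f0 f1] _] := tf i; rewrite ger0_norm.
  by move=> /(_ bf)/cvgrPdist_lt/(_ _ e2).
have [j Hj] : exists j, forall i, `|\int[nu]_x f i x - \int[mu_ j]_x f i x| < e / 2.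
  have : \forall j \near \oo, forall i,
      `|\int[nu]_x f i x - \int[mu_ j]_x f i x| < e / 2 by exact: near_forall.
  by move=> [j _ /(_ j (leqnn j)) Hj]; exists j.
have [_ /(_ k f _ tf e2)[N [P [M [pP H]]]]] := Cmu j.
exists N, P, M; split => // i.
rewrite (splitr e) -(subrKA (\int[mu_ j]_x f i x)).
by rewrite (le_lt_trans (ler_normD _ _))// ltrD// distrC.
Qed.

Lemma approximable_dim1 : contains_dim1 approximable_class.
Proof.
move=> mu lmu; split => // k f e tf e0; exists 1%N, mu, 1%:M; split.
  exact: prodlaw1.
move=> i; under eq_Rintegral do rewrite mulmx1.
by rewrite subrr normr0.
Qed.

(** The approximable log-concave measures form a class with all the required
    closure properties, hence contain the smallest one. *)
Lemma smallest_class_approximable n (mu : probability 'rV[R]_n R) :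
  smallest_class mu -> log_concave mu /\ approximable mu.
Proof.
move=> /(_ approximable_class); apply.
- by move=> ? ? [].
- exact: approximable_products.
- exact: approximable_linear.
- exact: approximable_weak_limits.
- exact: approximable_dim1.
Qed.

End approximable.

(** * Independence under product laws *)

Section independence.
Context {R : realType}.

Definition depends_on U N (J : {set 'I_N}) (f : 'rV[R]_N -> U) :=
  forall x y : 'rV[R]_N, (forall i, i \in J -> x ord0 i = y ord0 i) -> f x = f y.

(** By induction on the product: integrating first over the left block and
    then over the right one, each of the two integrals of f * g factors by
    induction. In dimension one, f or g is constant. *)
Lemma prodlaw_indep N (P : probability 'rV[R]_N R) : prodlaw P ->
  forall (J : {set 'I_N}) (f g : 'rV[R]_N -> \bar R),
  measurable_fun setT f -> measurable_fun setT g ->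
  (forall x, 0 <= f x)%E -> (forall x, 0 <= g x)%E ->
  depends_on J f -> depends_on (~: J) g ->
  (\int[P]_x (f x * g x) = \int[P]_x f x * \int[P]_x g x)%E.
Proof.
elim=> [nu lnu J f g mf mg f0 g0 Jf Jg|m n mu nu pmu IHmu pnu IHnu J f g mf mg f0 g0 Jf Jg].
  have cst_int (Q : probability 'rV[R]_1 R) (c : \bar R) : (0 <= c)%E ->
      (\int[Q]_x cst c x = c)%E.
    move=> c0; rewrite integral_cst// -[RHS]mule1; congr (_ * _)%E.
    exact: probability_setT.
  have [J0|J0] := boolP (ord0 \in J).
    have gc x : g x = g 0 by apply: Jg => i; rewrite [i]ord1 inE J0.
    have -> : (\int[nu]_x g x = g 0%R)%E.
      by under eq_integral do rewrite gc; rewrite cst_int.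
    under eq_integral do rewrite gc muleC.
    by rewrite ge0_integralZl// muleC.
  have fc x : f x = f 0 by apply: Jf => i; rewrite [i]ord1 (negbTE J0).
  have -> : (\int[nu]_x f x = f 0%R)%E.
    by under eq_integral do rewrite fc; rewrite cst_int.
  under eq_integral do rewrite fc.
  by rewrite ge0_integralZl.
pose J1 : {set 'I_m} := [set i | lshift n i \in J]%SET.
pose J2 : {set 'I_n} := [set i | rshift m i \in J]%SET.
have dep1 U (K : {set 'I_(m + n)}) (h : 'rV[R]_(m + n) -> U) y :
    depends_on K h -> depends_on [set i | lshift n i \in K]%SET (fun x => h (row_mx x y)).
  move=> Kh x x' xx'; apply: Kh => i; rewrite -(fintype.splitK i).
  by case: (fintype.split i) => j /=; rewrite ?row_mxEl ?row_mxEr// => jK;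
    apply: xx'; rewrite inE.
have dep2 U (K : {set 'I_(m + n)}) (h : 'rV[R]_(m + n) -> U) x :
    depends_on K h -> depends_on [set i | rshift m i \in K]%SET (fun y => h (row_mx x y)).
  move=> Kh y y' yy'; apply: Kh => i; rewrite -(fintype.splitK i).
  by case: (fintype.split i) => j /=; rewrite ?row_mxEl ?row_mxEr// => jK;
    apply: yy'; rewrite inE.
have CJ1 : [set i | lshift n i \in ~: J]%SET = ~: J1.
  by apply/setP => i; rewrite !inE.
have CJ2 : [set i | rshift m i \in ~: J]%SET = ~: J2.
  by apply/setP => i; rewrite !inE.
have mG (h : 'rV[R]_(m + n) -> \bar R) : measurable_fun setT h ->
    (forall x, 0 <= h x)%E ->
    measurable_fun setT (fun y => \int[mu]_x h (row_mx x y))%E.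
  move=> mh h0.
  apply: (measurable_fun_fubini_tonelli_G (m1 := mu) (h \o @join_rV R m n)) => //.
    exact: measurableT_comp.
  by move=> x /=; exact: h0.
have depG (h : 'rV[R]_(m + n) -> \bar R) K : depends_on K h ->
    depends_on [set i | rshift m i \in K]%SET (fun y => \int[mu]_x h (row_mx x y))%E.
  move=> Kh y y' yy'; apply: eq_integral => x _.
  exact: (dep2 _ K).
rewrite tonelli_rV2//; last 2 first.
- exact: emeasurable_funM.
- by move=> z; rewrite mule_ge0.
transitivity (\int[nu]_y ((\int[mu]_x f (row_mx x y)) * (\int[mu]_x g (row_mx x y))))%E.
  apply: eq_integral => y _; apply: (IHmu J1) => //.
  - exact: (measurableT_comp mf (measurable_row_mxl y)).
  - exact: (measurableT_comp mg (measurable_row_mxl y)).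
  - exact: dep1.
  - by rewrite -CJ1; exact: dep1.
rewrite (IHnu J2)//.
- by rewrite -!tonelli_rV2.
- exact: mG.
- exact: mG.
- by move=> y; exact: integral_ge0.
- by move=> y; exact: integral_ge0.
- exact: depG.
- by rewrite -CJ2; exact: depG.
Qed.

Lemma depends_onS U N (J K : {set 'I_N}) (f : 'rV[R]_N -> U) :
  J \subset K -> depends_on J f -> depends_on K f.
Proof.
by move=> /fintype.subsetP JK Jf x y xy; apply: Jf => i iJ; apply: xy; exact: JK.
Qed.

Lemma pr_indep N (P : probability 'rV[R]_N R) (J K : {set 'I_N})
    (A B : set 'rV[R]_N) : prodlaw P -> measurable A -> measurable B ->
  [disjoint J & K]%B -> depends_on J A -> depends_on K B ->
  pr P (A `&` B) = pr P A * pr P B.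
Proof.
move=> pP mA mB JK JA KB; apply: EFin_inj.
have mAB : measurable (A `&` B) by exact: measurableI.
rewrite EFinM -!prE//.
have H (C : set 'rV[R]_N) : measurable C -> P C = (\int[P]_x (\1_C x)%:E)%E.
  by move=> mC; rewrite integral_indic// setIT.
have Hm (C : set 'rV[R]_N) : measurable C ->
    measurable_fun setT (fun x => (\1_C x)%:E : \bar R).
  by move=> mC; apply/measurable_EFinP; exact: measurable_indic.
have Hd (L : {set 'I_N}) (C : set 'rV[R]_N) : depends_on L C ->
    depends_on L (fun x => (\1_C x)%:E : \bar R).
  move=> LC x y xy; rewrite !indicE; congr (nat_of_bool _)%:R%:E.
  by apply/idP/idP => /set_mem Cx; apply/mem_set; rewrite ?(LC _ _ xy) // -(LC _ _ xy).
rewrite (H _ mAB) (H _ mA) (H _ mB) -(prodlaw_indep pP (J := J))//.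
- by apply: eq_integral => x _; rewrite -EFinM indicI.
- exact: Hm.
- exact: Hm.
- exact: Hd.
- by apply: Hd; apply: depends_onS KB; rewrite -finset.disjoints_subset disjoint_sym.
Qed.

End independence.

Section partial_sums.
Context {R : realType} {N : nat}.
Implicit Types (J K : {set 'I_N}) (c : 'cV[R]_N) (w : 'rV[R]_N).

Definition psum J c w : R := \sum_(i in J) w ord0 i * c i ord0.

Lemma psum_dot J c : exists u, forall w, psum J c w = dot w u.
Proof.
exists (\col_i if i \in J then c i ord0 else 0) => w.
rewrite dotE /psum big_mkcond/=; apply: eq_bigr => i _.
by rewrite mxE; case: ifP => // _; rewrite mulr0.
Qed.

Lemma psumT c w : psum [set: 'I_N]%SET c w = dot w c.
Proof. by rewrite /psum dotE; apply: eq_bigl => i; rewrite inE. Qed.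

Lemma psum0 c w : psum finset.set0 c w = 0.
Proof. by rewrite /psum finset.big_set0. Qed.

Lemma psumU J K c w : [disjoint J & K]%B ->
  psum (J :|: K) c w = psum J c w + psum K c w.
Proof. by move=> JK; rewrite /psum -bigU//; apply: eq_bigl => i; rewrite finset.in_setU. Qed.

Lemma measurable_psum J c : measurable_fun setT (psum J c).
Proof.
have [u uE] := psum_dot J c.
by apply: eq_measurable_fun (measurable_dot u) => w _; rewrite uE.
Qed.

Lemma depends_psum U J c (f : R -> U) : depends_on J (fun w => f (psum J c w)).
Proof.
move=> x y xy; congr f; apply: eq_bigr => i iJ; by rewrite xy.
Qed.

End partial_sums.

(** * Upper tails of log-concave laws *)

Section log_concave_tail.
Context {R : realType} {N : nat} (P : probability 'rV[R]_N R).
Hypothesis lP : log_concave P.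

Lemma measurable_dot_le (u : 'cV[R]_N) x : measurable [set w | dot w u <= x].
Proof. by apply: measurable_le; exact: measurable_dot. Qed.

(** The inequality of log-concavity concerns compact sets; the parts of a
    half-space in growing boxes make it available for half-spaces. *)
Lemma halfspace_compact_approx (u : 'cV[R]_N) x (l : R) : l < 1 ->
  0 < pr P [set w | dot w u <= x] ->
  exists A, [/\ compact A, A `<=` [set w | dot w u <= x] &
    l * pr P [set w | dot w u <= x] <= pr P A].
Proof.
move=> l1 F0; set F := pr P _ in F0 *.
pose A n := [set w : 'rV[R]_N | dot w u <= x] `&` box (const_mx (- n%:R)) (const_mx n%:R).
have cA n : compact (A n).
  rewrite /A setIC; apply: compact_closedI; first exact: box_compact.
  apply: (@closed_comp _ _ (dot ^~ u) [set y | y <= x]); last exact: closed_le.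
  by move=> w _; exact: continuous_dot.
have [|||n] := @pr_bigcup_gt _ _ _ P A ((1 - l) * F).
- by move=> n; apply: compact_measurable_rV.
- move=> m n mn; apply/subsetPset => w [wx wb]; split => // i.
  have := wb i; rewrite !mxE => /andP[a b]; apply/andP; split.
    by rewrite (le_trans _ a)// lerN2 ler_nat.
  by rewrite (le_trans b)// ler_nat.
- by rewrite mulr_gt0// subr_gt0.
rewrite (_ : \bigcup_n A n = [set w | dot w u <= x]) -/F.
  move=> H; exists (A n); split => //; first by move=> w [].
  by apply: ltW; apply: le_lt_trans H; rewrite mulrBl mul1r opprB addrC subrK.
apply/seteqP; split => [w [k _ []]//|w wx].
exists (Num.truncn `|w|).+1 => //; split => // i.
by rewrite !mxE -ler_norml (le_trans (coord_le_norm _ _))// ltW// truncnS_gt.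
Qed.

(** A Minkowski combination of two parallel half-spaces is contained in the
    half-space at the combined level. *)
Lemma cdf_log_concave (u : 'cV[R]_N) x y s : 0 < s < 1 ->
  pr P [set w | dot w u <= x] `^ s * pr P [set w | dot w u <= y] `^ (1 - s) <=
  pr P [set w | dot w u <= s * x + (1 - s) * y].
Proof.
move=> /[dup] s01 /andP[s0 s1]; have s1' : 0 < 1 - s by rewrite subr_gt0.
set F := pr P [set w | dot w u <= x]; set G := pr P [set w | dot w u <= y].
set H := pr P _.
have [F0|F0] := eqVneq F 0; first by rewrite F0 powR0 ?gt_eqF// mul0r pr_ge0.
have [G0|G0] := eqVneq G 0.
  by rewrite G0 [0 `^ (1 - s)]powR0 ?gt_eqF// mulr0 pr_ge0.
have {}F0 : 0 < F by rewrite lt_neqAle eq_sym F0 pr_ge0.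
have {}G0 : 0 < G by rewrite lt_neqAle eq_sym G0 pr_ge0.
have key l : 0 < l < 1 -> l * (F `^ s * G `^ (1 - s)) <= H.
  move=> /andP[l0 l1].
  have [A [cA AF lA]] := halfspace_compact_approx l1 F0.
  have [B [cB BG lB]] := halfspace_compact_approx l1 G0.
  apply: (@le_trans _ _ ((l * F) `^ s * (l * G) `^ (1 - s))).
    rewrite !powRM ?(ltW l0) ?(ltW F0) ?(ltW G0)// mulrACA -powRD ?(gt_eqF l0) ?implybT//.
    by rewrite subrKC powRr1// ltW.
  apply: (@le_trans _ _ (pr P A `^ s * pr P B `^ (1 - s))).
    apply: ler_pM; rewrite ?powR_ge0//; apply: ge0_ler_powR => //;
      rewrite ?nnegrE ?pr_ge0 ?mulr_ge0 ?(ltW l0) ?(ltW s0) ?(ltW s1') ?(ltW F0) ?(ltW G0)//.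
  apply: le_trans (log_concave_brunn_minkowski lP s01 cA cB) _; apply: le_pr.
  - by apply: compact_measurable_rV; exact: minkowski_compact.
  - exact: measurable_dot_le.
  move=> _ [a /AF Aa [b /BG Bb <-]] /=.
  by rewrite dotDl !dotZl lerD// ler_wpM2l// ltW.
set q := F `^ s * G `^ (1 - s) in key *.
have q0 : 0 < q by rewrite mulr_gt0// powR_gt0.
rewrite leNgt; apply/negP => Hq.
have H0 : 0 <= H by exact: pr_ge0.
have : (1 + H / q) / 2 * q <= H.
  apply: key; have : H / q < 1 by rewrite ltr_pdivrMr// mul1r.
  have : 0 <= H / q by rewrite divr_ge0// ltW.
  by move=> *; apply/andP; split; lra.
rewrite mulrAC mulrDl divfK ?gt_eqF// mul1r; lra.
Qed.

End log_concave_tail.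

Section concentration.
Context {R : realType} d (T : measurableType d) (P : probability T R).
Implicit Types (Y : T -> R) (r : R).

(** One parameter r bounds both the width and the exceptional mass, as in
    the Ky Fan distance, here between Y and the constants. *)
Definition concentrated r Y := exists b, pr P [set w | r < `|Y w - b|] < r.

Lemma not_concentratedP r Y : ~ concentrated r Y <-> forall b, r <= pr P [set w | r < `|Y w - b|].
Proof.
split => [nc b|H [b]]; last by rewrite ltNge H.
by rewrite leNgt; apply/negP => H; apply: nc; exists b.
Qed.

End concentration.

Section top_tail.
Context {R : realType} {N : nat} (P : probability 'rV[R]_N R).

(** Near its top, a log-concave variable that is not concentrated behaves
    like one with a bounded density: going down by e from a level a that is
    exceeded with probability at most delta only adds a mass of order e.
    Indeed Y is below a - 2 r with probability at least r / 2, as otherwise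
    it would be within r of a - r, and the log-concave distribution function
    F interpolates between a - 2 r and a. For s = e / (2 r) this bounds F (a
    - e) from below by (1 - delta) times the power s of r / 2, and this
    power is at least 1 - s * ln (2 / r). *)
Lemma spread_tail (Y : 'rV[R]_N -> R) (u : 'cV[R]_N) (r delta a e : R) :
  log_concave P -> (forall w, Y w = dot w u) -> ~ concentrated P r Y ->
  0 < delta <= r / 2 -> pr P [set w | a < Y w] <= delta ->
  0 < e < 2 * r ->
  pr P [set w | a - e < Y w] <= ln (2 / r) / (2 * r) * e + delta.
Proof.
move=> lP YE /not_concentratedP nc /andP[d0 dr] pa /andP[e0 er].
have r0 : 0 < r by lra.
have {}YE : Y = dot ^~ u by apply/funext.
subst Y; pose Y := dot ^~ u.
have mY : measurable_fun setT Y by exact: measurable_dot.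
pose F z := pr P [set w | dot w u <= z].
have gtE z : pr P [set w | z < dot w u] = 1 - F z.
  rewrite /F -prC; last exact: measurable_dot_le.
  by congr pr; apply/seteqP; split => w /=; rewrite ltNge => /negP.
have r1 : r <= 1.
  apply: le_trans (nc 0) _; apply: pr_le1; apply: measurable_gt.
  by apply: measurableT_comp => //; apply: measurable_funB.
have Fa : 1 - delta <= F a by move: pa; rewrite gtE; lra.
have F2 : r / 2 <= F (a - 2 * r).
  have : r <= F (a - 2 * r) + delta; last lra.
  apply: le_trans (nc (a - r)) _.
  apply: le_trans (lerD (lexx _) pa); apply: le_trans (prU_le _ _ _).
  - apply: le_pr.
    + apply: measurable_gt; apply: measurableT_comp => //; exact: measurable_funB.
    + by apply: measurableU; [exact: measurable_dot_le|exact: measurable_gt].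
    move=> w /=; have [aw _|wa] := ltP a (dot w u); first by right.
    left; move: H => /=; rewrite ltr_normr => /orP[]; lra.
  - exact: measurable_dot_le.
  - exact: measurable_gt.
pose s := e / (2 * r).
have s01 : 0 < s < 1.
  by rewrite /s divr_gt0 ?mulr_gt0//= ltr_pdivrMr ?mulr_gt0// mul1r.
have /andP[s0 s1] := s01.
have := cdf_log_concave lP u (a - 2 * r) a s01.
have -> : s * (a - 2 * r) + (1 - s) * a = a - e.
  by rewrite /s; field; rewrite gt_eqF.
rewrite -!/(F _) gtE => FF.
have L0 : 0 <= ln (2 / r).
  by apply: ln_ge0; rewrite ler_pdivlMr// mul1r; lra.
have r2 : 0 < r / 2 by rewrite divr_gt0.
have e1 : 1 - s * ln (2 / r) <= F (a - 2 * r) `^ s.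
  apply: (@le_trans _ _ ((r / 2) `^ s)); last first.
    by apply: ge0_ler_powR; rewrite ?nnegrE ?pr_ge0 ?(ltW s0) ?(ltW r2).
  rewrite /powR gt_eqF//; apply: le_trans (expR_ge1Dx _).
  by rewrite -[r / 2]invf_div lnV ?posrE ?divr_gt0// mulrN.
have e2 : 1 - delta <= F a `^ (1 - s).
  have Fa0 : 0 < F a by apply: lt_le_trans Fa; lra.
  have Fa1 : F a <= 1 by apply: pr_le1; exact: measurable_dot_le.
  apply: le_trans Fa _; rewrite -{1}[F a]powRr1 ?(ltW Fa0)//.
  by apply: ger_powR; [apply/andP|lra].
have d1 : delta <= 1 by lra.
rewrite mulrAC -mulrA -/s mulrC.
have [sl|sl] := leP (s * ln (2 / r)) 1; last first.
  have : 0 <= F (a - e) by exact: pr_ge0.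
  by rewrite mulrC; lra.
have : (1 - s * ln (2 / r)) * (1 - delta) <= F (a - e).
  by apply: le_trans FF; apply: ler_pM => //; lra.
have : 0 <= s * ln (2 / r) * delta.
  by apply: mulr_ge0; [apply: mulr_ge0 => //; exact: ltW|exact: ltW].
set q := s * ln _; lra.
Qed.

End top_tail.

(** * Upper tails of sums with many spread summands *)

Lemma top_quantile d (T : measurableType d) (R : realType)
    (P : probability T R) (Y : T -> R) (delta : R) :
  measurable_fun setT Y -> 0 < delta < 1 ->
  exists a, pr P [set w | a < Y w] <= delta <= pr P [set w | a <= Y w].
Proof.
move=> mY /andP[d0 d1].
have [|c /andP[]] := @quantile _ _ _ P Y setT (1 - delta) measurableT mY.
  by rewrite prT subr_gt0 gtrBl d1.
rewrite !setTI => c1 c2; exists c; apply/andP; split.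
  rewrite (_ : [set w | _] = ~` [set w | Y w <= c]).
    by rewrite prC; [lra|exact: measurable_le].
  by apply/seteqP; split => w /=; rewrite ltNge => /negP.
rewrite (_ : [set w | _] = ~` [set w | Y w < c]).
  by rewrite prC; [lra|exact: measurable_lt].
by apply/seteqP; split => w /=; rewrite leNgt => /negP.
Qed.

Section spread_groups_tail.
Context {R : realType} {N : nat} (P : probability 'rV[R]_N R) (c : 'cV[R]_N).
Hypothesis pP : prodlaw P.
Implicit Types (J K : {set 'I_N}) (Js : seq {set 'I_N}).

Definition unions Js := foldr (@finset.setU _) finset.set0 Js.

Definition pairwise_disjoint Js := pairwise (fun J K => [disjoint J & K]%B) Js.

Lemma disjoint_unions J Js : all (fun K => [disjoint J & K]%B) Js ->
  [disjoint J & unions Js]%B.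
Proof.
elim: Js => [_|K Js IH /= /andP[JK /IH JJs]].
  by rewrite -finset.setI_eq0 finset.setI0.
by rewrite -finset.setI_eq0 finset.setIUr finset.setU_eq0 !finset.setI_eq0 JK.
Qed.

Let half_ge J a : measurable [set w | a <= psum J c w].
Proof. by apply: measurable_ge; exact: measurable_psum. Qed.

Let half_gt J a : measurable [set w | a < psum J c w].
Proof. by apply: measurable_gt; exact: measurable_psum. Qed.

(** Three bounds for a sum of independent terms. The sum is large when both
    terms are; it exceeds a + b only if one term exceeds its own level; and
    if neither does, then to come within e of a + b both must come within e
    of their levels, which by independence is a product of small
    probabilities. *)
Lemma psum_pair_tail J K a b e : [disjoint J & K]%B ->
  [/\ pr P [set w | a <= psum J c w] * pr P [set w | b <= psum K c w] <=
        pr P [set w | a + b <= psum (J :|: K) c w],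
      pr P [set w | a + b < psum (J :|: K) c w] <=
        pr P [set w | a < psum J c w] + pr P [set w | b < psum K c w] &
      pr P [set w | a + b - e < psum (J :|: K) c w] <=
        pr P [set w | a - e < psum J c w] * pr P [set w | b - e < psum K c w] +
        (pr P [set w | a < psum J c w] + pr P [set w | b < psum K c w])].
Proof.
move=> JK; split.
- rewrite -(pr_indep pP (half_ge J a) (half_ge K b) JK); last 2 first.
  + exact: (@depends_psum _ _ _ _ _ (fun z => is_true (a <= z))).
  + exact: (@depends_psum _ _ _ _ _ (fun z => is_true (b <= z))).
  apply: le_pr; [exact: measurableI|exact: half_ge|].
  by move=> w [/= ? ?]; rewrite psumU//; lra.
- apply: le_trans (prU_le _ _ _); [|exact: half_gt|exact: half_gt].
  apply: le_pr; [exact: half_gt|exact: measurableU|].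
  move=> w /=; rewrite psumU// => H.
  have [?|?] := ltP a (psum J c w); [by left|right => /=; lra].
rewrite -(pr_indep pP (half_gt J (a - e)) (half_gt K (b - e)) JK); last 2 first.
- exact: (@depends_psum _ _ _ _ _ (fun z => is_true (a - e < z))).
- exact: (@depends_psum _ _ _ _ _ (fun z => is_true (b - e < z))).
have mI := measurableI _ _ (half_gt J (a - e)) (half_gt K (b - e)).
have mU := measurableU _ _ (half_gt J a) (half_gt K b).
apply: (@le_trans _ _ (pr P (([set w | a - e < psum J c w] `&` [set w | b - e < psum K c w])
   `|` ([set w | a < psum J c w] `|` [set w | b < psum K c w])))).
  apply: le_pr; [exact: half_gt|exact: measurableU|].
  move=> w /=; rewrite psumU// => H.
  have [?|Ja] := ltP a (psum J c w); first by right; left.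
  have [?|Kb] := ltP b (psum K c w); first by right; right.
  by left; split => /=; lra.
apply: le_trans (prU_le _ mI mU) _; rewrite lerD2l.
exact: prU_le.
Qed.

(** The recursion produced by adding one group at a time: the new group
    comes within e of its level with probability at most C * e + delta,
    independently of the others, and the term m * delta accounts for some
    group exceeding its level. *)
Fixpoint tail_bound (C delta e : R) m : R :=
  if m is m'.+1 then (C * e + delta) * tail_bound C delta e m' + m%:R * delta
  else 1.

(** Each group gets as its level an upper delta-quantile, and a is the sum
    of the levels. Each spread group then contributes one factor of order e
    to the probability of coming within e of a, while a is still reached
    with probability at least the product of the deltas. *)
Lemma spread_groups_tail (r delta e : R) Js :
  0 < delta <= r / 2 -> 0 < e < 2 * r -> pairwise_disjoint Js ->
  (forall J, J \in Js -> ~ concentrated P r (psum J c)) ->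
  exists a, [/\ delta ^+ size Js <= pr P [set w | a <= psum (unions Js) c w],
    pr P [set w | a < psum (unions Js) c w] <= (size Js)%:R * delta &
    pr P [set w | a - e < psum (unions Js) c w] <=
      tail_bound (ln (2 / r) / (2 * r)) delta e (size Js)].
Proof.
move=> dr er; have /andP[d0 dr2] := dr; have /andP[e0 _] := er.
have r0 : 0 < r by lra.
elim: Js => [_ _|J Js IH /= /andP[dJ dJs] nc].
  exists 0; split => /=.
  - rewrite expr0 (_ : [set w | _] = setT) ?prT//.
    by apply/seteqP; split => // w _ /=; rewrite psum0.
  - rewrite mul0r (_ : [set w | _] = set0) ?pr0//.
    by apply/seteqP; split => // w /=; rewrite psum0 ltxx.
  - exact: pr_le1.
have [|b [b1 b2 b3]] := IH dJs; first by move=> K KJs; apply: nc; rewrite inE KJs orbT.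
have ncJ : ~ concentrated P r (psum J c) by apply: nc; rewrite inE eqxx.
have r1 : r <= 1.
  move/not_concentratedP : ncJ => /(_ 0) /le_trans; apply; apply: pr_le1.
  apply: measurable_gt; apply: measurableT_comp => //.
  by apply: measurable_funB => //; exact: measurable_psum.
have d01 : 0 < delta < 1 by apply/andP; split => //; lra.
have [a /andP[a1 a2]] := top_quantile P (measurable_psum J c) d01.
have [u uE] := psum_dot J c.
have a3 := spread_tail (prodlaw_log_concave pP) uE ncJ dr a1 er.
have [H1 H2 H3] := psum_pair_tail a b e (disjoint_unions dJ).
exists (a + b); split.
- apply: le_trans H1; rewrite exprS ler_pM// ?exprn_ge0//; exact: ltW.
- by apply: le_trans H2 _; rewrite -(natr1 (size Js)) mulrDl mul1r addrC lerD.
apply: le_trans H3 _; apply: lerD.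
  by apply: ler_pM; rewrite ?pr_ge0.
by rewrite -(natr1 (size Js)) mulrDl mul1r addrC lerD.
Qed.

(** The coordinates outside the groups are arbitrary, possibly constant.
    They are given a quantile level too, which costs one factor delta in the
    first bound and at most a factor 1 in the second. *)
Lemma total_tail (r delta e : R) Js :
  0 < delta <= r / 2 -> delta < 1 -> 0 < e < 2 * r -> pairwise_disjoint Js ->
  (forall J, J \in Js -> ~ concentrated P r (psum J c)) ->
  exists a, delta ^+ (size Js).+1 <= pr P [set w | a <= dot w c] /\
    pr P [set w | a - e < dot w c] <=
      tail_bound (ln (2 / r) / (2 * r)) delta e (size Js) +
      (size Js).+1%:R * delta.
Proof.
move=> dr d1 er dJs nc; have /andP[d0 dr2] := dr.
have [a [a1 a2 a3]] := spread_groups_tail dr er dJs nc.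
have d01 : 0 < delta < 1 by apply/andP.
have [b /andP[b1 b2]] := top_quantile P (measurable_psum (~: unions Js)%SET c) d01.
have [|H1 _ H3] := @psum_pair_tail (unions Js) (~: unions Js)%SET a b e.
  by rewrite -finset.setI_eq0 finset.setICr.
have EE f : [set w | f (psum (unions Js :|: ~: unions Js)%SET c w)] =
    [set w : 'rV[R]_N | f (dot w c) : Prop].
  by apply/funext => w /=; rewrite finset.setUCr psumT.
exists (a + b); split.
  rewrite -(EE (fun z => is_true (a + b <= z))).
  apply: le_trans H1; rewrite exprSr ler_pM// ?exprn_ge0//; exact: ltW.
rewrite -(EE (fun z => is_true (a + b - e < z))).
apply: le_trans H3 _; apply: lerD.
  rewrite -[leRHS]mulr1; apply: ler_pM; rewrite ?pr_ge0 ?pr_le1//.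
by rewrite -(natr1 (size Js)) mulrDl mul1r lerD.
Qed.

End spread_groups_tail.

(** Taking delta = e^D balances the two kinds of terms of the recursion:
    with D groups the tail is of order e^D. *)
Lemma tail_bound_order (R : realType) (r : R) (D : nat) : 0 < r <= 1 ->
  (0 < D)%N -> exists2 K : R, 0 < K & forall e, 0 < e <= 1 ->
    tail_bound (ln (2 / r) / (2 * r)) (e ^+ D) e D + D.+1%:R * e ^+ D <=
    K * e ^+ D.
Proof.
move=> /andP[r0 r1] D0; set C := ln _ / _.
have C0 : 0 <= C.
  rewrite divr_ge0//; last by rewrite mulr_ge0// ltW.
  by apply: ln_ge0; rewrite ler_pdivlMr// mul1r; lra.
clearbody C.
suff [K K0 HK] : exists2 K : R, 0 <= K & forall e, 0 < e <= 1 ->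
    tail_bound C (e ^+ D) e D <= K * e ^+ D.
  exists (K + D.+1%:R); first by rewrite ltr_wpDl.
  by move=> e e01; rewrite mulrDl lerD2r HK.
have : (D <= D)%N by [].
elim: {1 4 5}D => [_|m IH mD].
  by exists 1 => // e _; rewrite /= expr0 mulr1.
have [K K0 HK] := IH (ltnW mD).
exists ((C + 1) * K + m.+1%:R).
  by rewrite addr_ge0// mulr_ge0// addr_ge0.
move=> e /[dup] e01 /andP[e0 e1] /=.
have eD : e ^+ D <= e ^+ m.+1 by apply: ler_wiXn2l => //; exact: ltW.
have eD1 : e ^+ D <= e.
  by rewrite -[leRHS]expr1; apply: ler_wiXn2l => //; exact: ltW.
rewrite [leRHS]mulrDl; apply: lerD; last by rewrite ler_wpM2l.
rewrite exprS mulrACA; apply: ler_pM; last exact: HK.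
- by rewrite addr_ge0 ?mulr_ge0 ?exprn_ge0 ?(ltW e0).
- elim: {1}m => //= k Hk; rewrite addr_ge0// ?mulr_ge0 ?addr_ge0 ?mulr_ge0 ?exprn_ge0 ?(ltW e0)//.
- by rewrite mulrDl mul1r lerD2l.
Qed.

(** * Uniform measures on convex bodies *)

Section lebesgue_ball.
Context {R : realType}.

Let cons_rV0 n x (v : 'rV[R]_n) : cons_rV (x, v) ord0 ord0 = x.
Proof.
transitivity (row_mx (x%:M : 'rV_1) v ord0 (lshift n ord0)).
  by congr (fun_of_matrix _ _ _); exact/val_inj.
by rewrite row_mxEl mxE mulr1n.
Qed.

Let cons_rVS n x (v : 'rV[R]_n) i : cons_rV (x, v) ord0 (lift ord0 i) = v ord0 i.
Proof.
transitivity (row_mx (x%:M : 'rV_1) v ord0 (rshift 1 i)).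
  by congr (fun_of_matrix _ _ _); exact/val_inj.
by rewrite row_mxEr.
Qed.

(** Balls of the sup norm are cubes. *)
Lemma lebesgue_rV_ball n (p : 'rV[R]_n) (rho : R) : 0 < rho ->
  lebesgue_rV n (ball p rho) = ((rho *+ 2) ^+ n)%:E.
Proof.
move=> r0; elim: n p => [|n IH] p.
  rewrite expr0 /= diracE mem_set//=.
  by split => // i [].
rewrite /= /cons_lebesgue /pushforward.
have -> : @cons_rV R n @^-1` ball p rho =
    ball (p ord0 ord0) rho `*` ball (\row_i p ord0 (lift ord0 i)) rho.
  apply/seteqP; split => [[x v] [_ H]|[x v] [/= xb [_ vb]]] /=.
    split; first by have := H ord0 ord0; rewrite cons_rV0.
    split => // i j; have := H ord0 (lift ord0 j).
    by rewrite cons_rVS mxE [i]ord1.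
  split => // i j; rewrite [i]ord1; have [k ->|->] := unliftP ord0 j.
    by rewrite cons_rVS; have := vb ord0 k; rewrite mxE.
  by rewrite cons_rV0.
rewrite product_measure1E//; last 2 first.
- exact: measurable_ball.
- by apply: open_measurable_rV; exact: ball_open.
rewrite IH exprS EFinM; congr (_ * _)%E.
by apply: lebesgue_measure_ball; exact: ltW.
Qed.

End lebesgue_ball.

Section uniform.
Context {R : realType} {d : nat} (B : set 'rV[R]_d) (mu : probability 'rV[R]_d R).
Hypotheses (cB : convex_body B) (uB : uniform_on B mu).

Lemma convex_body_comb x y (t : R) : B x -> B y -> 0 <= t <= 1 ->
  B (t *: x + (1 - t) *: y).
Proof.
move=> Bx By /andP[t0 t1]; have [_ conv _] := cB.
by have := conv x y (Itv01 t0 t1) (mem_set Bx) (mem_set By); rewrite inE.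
Qed.

Lemma convex_body_inner : exists p, exists2 rho, 0 < rho & ball p rho `<=` B.
Proof.
have [_ _ [p /nbhs_ballP[rho /= r0 rB]]] := cB.
by exists p, rho.
Qed.

Lemma convex_body_bound : exists2 K : R, 0 < K & forall x, B x -> `|x| <= K.
Proof.
have [comp _ _] := cB; have [K K0 HK] := compact_in_box comp.
by exists K => // x Bx; apply: norm_le_coord => [|i]; [exact: ltW|exact: HK].
Qed.

Lemma measurable_convex_body : measurable B.
Proof. by have [comp _ _] := cB; exact: compact_measurable_rV. Qed.

Lemma lebesgue_convex_body : exists2 l : R, 0 < l & lebesgue_rV d B = l%:E.
Proof.
have [p [rho r0 rB]] := convex_body_inner.
have [K K0 HK] := convex_body_bound.
have K1 : 0 < K + 1 by rewrite addr_gt0.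
have mball (x : 'rV[R]_d) e : measurable (ball x e).
  by apply: open_measurable_rV; exact: ball_open.
have lo : (((rho *+ 2) ^+ d)%:E <= lebesgue_rV d B)%E.
  rewrite -(lebesgue_rV_ball p r0) le_measure ?inE//.
  exact: measurable_convex_body.
have hi : (lebesgue_rV d B <= (((K + 1) *+ 2) ^+ d)%:E)%E.
  rewrite -(lebesgue_rV_ball 0 K1) le_measure ?inE//; first exact: measurable_convex_body.
  by move=> x /HK xK; rewrite -ball_normE /= sub0r normrN (le_lt_trans xK)// ltrDl.
have fin : lebesgue_rV d B \is a fin_num.
  rewrite ge0_fin_numE//; exact: le_lt_trans hi (ltry _).
exists (fine (lebesgue_rV d B)); last by rewrite fineK.
rewrite -lte_fin fineK//; apply: lt_le_trans lo.
by rewrite lte_fin exprn_gt0// mulrn_wgt0.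
Qed.

Lemma uniform_setC : pr mu (~` B) = 0.
Proof.
rewrite /pr uB; last by apply: measurableC; exact: measurable_convex_body.
by rewrite setICl measure0 mul0e.
Qed.

(** The homothety centred at y with a ratio of order e takes an inner ball
    of B to a ball that lies in B, by convexity, and within e of y. *)
Lemma uniform_ball_mass : exists2 c : R, 0 < c & forall y e, B y -> 0 < e <= 1 ->
  c * e ^+ d <= pr mu [set x | `|x - y| <= e].
Proof.
have [p [rho r0 rB]] := convex_body_inner.
have [K K0 HK] := convex_body_bound.
have [l l0 lE] := lebesgue_convex_body.
(* With the ratio s = e / K' the image of the ball of radius rho around p
   lies within s * (rho + 2 * K) <= e of y. *)
pose K' := rho + 2 * K + 1.
have K'0 : 0 < K' by rewrite /K'; lra.
exists ((rho / K' *+ 2) ^+ d / l).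
  by rewrite divr_gt0// exprn_gt0// mulrn_wgt0// divr_gt0.
move=> y e By /andP[e0 e1].
pose s := e / K'.
have s0 : 0 < s by rewrite divr_gt0.
have s1 : s <= 1 by rewrite ler_pdivrMr// mul1r /K'; lra.
have srho : 0 < s * rho by rewrite mulr_gt0.
pose q := s *: p + (1 - s) *: y.
have pB : B p by apply: rB; exact: ballxx.
have mball (x : 'rV[R]_d) (u : R) : measurable (ball x u).
  by apply: open_measurable_rV; exact: ball_open.
have qB : ball q (s * rho) `<=` B.
  move=> x; rewrite -ball_normE /= => xq.
  pose z := p + s^-1 *: (x - q).
  have -> : x = s *: z + (1 - s) *: y.
    rewrite /z scalerDr scalerA divff ?gt_eqF// scale1r addrAC -/q.
    by rewrite addrC subrK.
  apply: convex_body_comb => //; last by rewrite ltW.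
  apply: rB; rewrite -ball_normE /= /z opprD addrA subrr sub0r normrN normrZ.
  by rewrite gtr0_norm ?invr_gt0// mulrC ltr_pdivrMr// distrC mulrC.
have mC : measurable [set x : 'rV[R]_d | `|x - y| <= e].
  by apply: measurable_le; exact: (lipschitz_measurable (lipschitz_dist y)).
apply: (@le_trans _ _ (pr mu (ball q (s * rho)))); last first.
  apply: le_pr => // x; rewrite -ball_normE /= => xq.
  rewrite -(subrKA q) (le_trans (ler_normD _ _))//.
  have -> : q - y = s *: (p - y).
    by apply/rowP => i; rewrite !mxE; ring.
  rewrite normrZ gtr0_norm//.
  have py : `|p - y| <= 2 * K.
    by rewrite (le_trans (ler_normB _ _))//; have := HK _ pB; have := HK _ By; lra.
  have : s * `|p - y| <= s * (2 * K) by rewrite ler_wpM2l// ltW.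
  have se : s * K' = e by rewrite /s divfK// gt_eqF.
  move: xq; rewrite distrC; have : s * K' = s * rho + s * (2 * K) + s by rewrite /K'; ring.
  lra.
rewrite /pr uB// setIidl// lebesgue_rV_ball// lE inver gt_eqF// -EFinM /=.
rewrite mulrAC ler_pM2r ?invr_gt0// -exprMn_comm ?/GRing.comm; last by rewrite mulrC.
by rewrite (_ : _ * e = s * rho *+ 2)//; rewrite /s; ring.
Qed.

End uniform.

(** * An ultrafilter of approximations *)

Section approximants.
Context {R : realType} {d : nat}.

(** The points on which the ultrafilter of approximations lives: a product
    law and a linear map from its space to the given one. *)
Record approximant := Approximant {
  ap_dim : nat;
  ap_law : probability 'rV[R]_ap_dim R;
  ap_mx : 'M[R]_(ap_dim, d);
  ap_prodlaw : prodlaw ap_law }.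

Definition tends_to (U : set_system approximant)
    (mu : probability 'rV[R]_d R) :=
  forall f e, test_fun f -> 0 < e -> \forall l \near U,
    `|\int[ap_law l]_w f (w *m ap_mx l) - \int[mu]_x f x| < e.

Let cat_fun (T : Type) k1 k2 (f1 : 'I_k1 -> T) (f2 : 'I_k2 -> T) i :=
  match fintype.split i with inl j => f1 j | inr j => f2 j end.

Let cat_funl (T : Type) k1 k2 (f1 : 'I_k1 -> T) (f2 : 'I_k2 -> T) j :
  cat_fun f1 f2 (lshift k2 j) = f1 j.
Proof. by rewrite /cat_fun (unsplitK (inl j)). Qed.

Let cat_funr (T : Type) k1 k2 (f1 : 'I_k1 -> T) (f2 : 'I_k2 -> T) j :
  cat_fun f1 f2 (rshift k1 j) = f2 j.
Proof. by rewrite /cat_fun (unsplitK (inr j)). Qed.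

(** The sets of approximants that match mu on finitely many test functions
    form a filter base. Refining it to an ultrafilter gives limits of all
    bounded quantities attached to an approximant, without extracting
    subsequences. *)
Lemma approximable_ultrafilter (mu : probability 'rV[R]_d R) :
  approximable mu ->
  exists2 U : set_system approximant, UltraFilter U & tends_to U mu.
Proof.
move=> amu.
pose I := {k : nat & (('I_k -> 'rV[R]_d -> R) * R)%type}.
pose D : set I := [set i | (forall j, test_fun ((projT2 i).1 j)) /\ 0 < (projT2 i).2].
pose S (i : I) : set approximant := [set l | forall j,
  `|\int[ap_law l]_w (projT2 i).1 j (w *m ap_mx l) - \int[mu]_x (projT2 i).1 j x|
    < (projT2 i).2].
have PF : ProperFilter (filter_from D S).
  apply: filter_from_proper.
    apply: filter_from_filter.
      by exists (existT _ 0%N (fun=> cst 0, 1)); split => //= -[].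
    move=> [k1 [f1 e1]] [k2 [f2 e2]] [/= t1 e10] [/= t2 e20].
    exists (existT _ (k1 + k2)%N (cat_fun f1 f2, Num.min e1 e2)).
      split => /= [j|]; last by rewrite lt_min e10.
      by rewrite /cat_fun; case: (fintype.split j).
    move=> l /= H; split => j /=.
      have := H (lshift k2 j); rewrite /= cat_funl.
      by rewrite lt_min => /andP[].
    have := H (rshift k1 j); rewrite /= cat_funr.
    by rewrite lt_min => /andP[].
  move=> [k [f e]] [/= tf e0].
  have [N [P [M [pP H]]]] := amu k f e tf e0.
  by exists (Approximant M pP).
have [U [UU FU]] := ultraFilterLemma PF.
exists U => // f e tf e0; apply: FU.
exists (existT _ 1%N (fun=> f, e)); first by split.
by move=> l /= /(_ ord0).
Qed.

End approximants.

Section portmanteau.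
Context {R : realType}.

Lemma pr_le_mean n (P : probability 'rV[R]_n R) A f : measurable A ->
  test_fun f -> (forall x, A x -> 1 <= f x) -> pr P A <= \int[P]_x f x.
Proof.
move=> mA tf Af; have [f01 _] := tf.
rewrite -lee_fin -prE// -test_integralE//.
rewrite (_ : P A = \int[P]_x (\1_A x)%:E)%E; last by rewrite integral_indic// setIT.
apply: ge0_le_integral => //.
- by apply/measurable_EFinP; exact: measurable_indic.
- by apply/measurable_EFinP; exact: test_measurable.
move=> x _; rewrite lee_fin indicE; case: (boolP (x \in A)) => [/set_mem/Af//|_].
by case/andP: (f01 x).
Qed.

Lemma mean_le_pr n (P : probability 'rV[R]_n R) A f : measurable A ->
  test_fun f -> (forall x, f x != 0 -> A x) -> \int[P]_x f x <= pr P A.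
Proof.
move=> mA tf fA; have [f01 _] := tf.
rewrite -lee_fin -prE// -test_integralE//.
rewrite (_ : P A = \int[P]_x (\1_A x)%:E)%E; last by rewrite integral_indic// setIT.
apply: ge0_le_integral => //.
- by move=> x _; rewrite lee_fin; case/andP: (f01 x).
- by apply/measurable_EFinP; exact: test_measurable.
- by apply/measurable_EFinP; exact: measurable_indic.
move=> x _; rewrite lee_fin indicE; have /andP[f0 f1] := f01 x.
have [->|fN] := eqVneq (f x) 0; first by case: (x \in A).
by rewrite mem_set//; exact: fA.
Qed.

(** A Lipschitz function between the indicators of [b, +oo[ and of ]a, +oo[. *)
Definition ramp (a b t : R) : R := Num.max 0 (Num.min 1 ((t - a) / (b - a))).

Lemma ramp01 a b t : 0 <= ramp a b t <= 1.
Proof. by rewrite /ramp le_max lexx ge_max ler01 ge_min lexx. Qed.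

Lemma ramp_lipschitz a b s t : a < b ->
  `|ramp a b s - ramp a b t| <= (b - a)^-1 * `|s - t|.
Proof.
move=> ab; have ba : 0 < b - a by rewrite subr_gt0.
rewrite -[X in X * `|_|]gtr0_norm ?invr_gt0// -normrM mulrC mulrBl.
rewrite /ramp; set x := (s - a) / _; set y := (t - a) / _.
have -> : s / (b - a) - t / (b - a) = x - y by rewrite /x /y; ring.
clearbody x y.
have clamp (z : R) : [\/ z <= 0 /\ Num.max 0 (Num.min 1 z) = 0,
    0 <= z <= 1 /\ Num.max 0 (Num.min 1 z) = z |
    1 <= z /\ Num.max 0 (Num.min 1 z) = 1].
  have [z1|/ltW z1] := leP z 1; last first.
    by constructor 3; rewrite max_r.
  have [z0|/ltW z0] := leP z 0; first by constructor 1.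
  by constructor 2; rewrite z0.
have h1 := ler_norm (x - y); have := ler_norm (y - x); rewrite distrC => h2.
by rewrite ler_norml; case: (clamp x) => -[xb ->]; case: (clamp y) => -[yb ->];
  apply/andP; split; lra.
Qed.

Lemma ramp_ge a b t : a < b -> b <= t -> 1 <= ramp a b t.
Proof.
move=> ab bt; rewrite /ramp le_max; apply/orP; right.
by rewrite le_min lexx/= ler_pdivlMr ?subr_gt0// mul1r lerD2r.
Qed.

Lemma ramp_le a b t : a < b -> ramp a b t != 0 -> a < t.
Proof.
move=> ab; apply: contraNT; rewrite -leNgt => ta; rewrite /ramp.
rewrite max_l// ge_min; apply/orP; right.
by rewrite pmulr_lle0 ?invr_gt0 ?subr_gt0// subr_le0.
Qed.

Lemma test_ramp n L (q : 'rV[R]_n -> R) a b : lipschitz_by L q -> a < b ->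
  test_fun (fun x => ramp a b (q x)).
Proof.
move=> [L0 qL] ab; split => [x|]; first exact: ramp01.
have ba : 0 < b - a by rewrite subr_gt0.
exists ((b - a)^-1 * L); split => [|x y]; first by rewrite mulr_ge0// invr_ge0 ltW.
apply: le_trans (ramp_lipschitz _ _ ab) _.
by rewrite -mulrA ler_wpM2l// invr_ge0 ltW.
Qed.

Context {d : nat} (mu : probability 'rV[R]_d R).
Variables (U : set_system (@approximant R d)).
Hypotheses (UU : UltraFilter U) (Umu : tends_to U mu).

(** Probabilities pass to the limit up to a gap between two thresholds, in
    which a ramp interpolates. *)
Lemma portmanteau L (q : 'rV[R]_d -> R) a b e : lipschitz_by L q -> a < b ->
  0 < e -> \forall l \near U,
    pr (ap_law l) [set w | b <= q (w *m ap_mx l)] <=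
      pr mu [set x | a < q x] + e /\
    pr mu [set x | b <= q x] - e <=
      pr (ap_law l) [set w | a < q (w *m ap_mx l)].
Proof.
move=> qL ab e0; have tr := test_ramp qL ab.
have mq := lipschitz_measurable qL.
near=> l; have : `|\int[ap_law l]_w ramp a b (q (w *m ap_mx l)) -
    \int[mu]_x ramp a b (q x)| < e.
  by near: l; exact: (Umu tr e0).
have mqM : measurable_fun setT (fun w => q (w *m ap_mx l)).
  by apply: measurableT_comp => //; exact: measurable_mulmx.
rewrite ltr_norml => /andP[H1 H2].
have trM := test_comp_mulmx (ap_mx l) tr.
have G1 : pr (ap_law l) [set w | b <= q (w *m ap_mx l)] <=
    \int[ap_law l]_w ramp a b (q (w *m ap_mx l)).
  apply: pr_le_mean => //; first exact: measurable_ge.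
  by move=> w; exact: ramp_ge.
have G2 : \int[mu]_x ramp a b (q x) <= pr mu [set x | a < q x].
  apply: mean_le_pr => //; first exact: measurable_gt.
  by move=> w; exact: ramp_le.
have G3 : pr mu [set x | b <= q x] <= \int[mu]_x ramp a b (q x).
  apply: pr_le_mean => //; first exact: measurable_ge.
  by move=> w; exact: ramp_ge.
have G4 : \int[ap_law l]_w ramp a b (q (w *m ap_mx l)) <=
    pr (ap_law l) [set w | a < q (w *m ap_mx l)].
  apply: mean_le_pr => //; first exact: measurable_gt.
  by move=> w; exact: ramp_le.
by split; lra.
Unshelve. all: by end_near. Qed.

End portmanteau.

(** * Concentrated random variables *)

Section concentrated_theory.
Context {R : realType} dp (T : measurableType dp) (P : probability T R).
Implicit Types (Y Z : T -> R) (r : R).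

Lemma measurable_dist_gt Y b r : measurable_fun setT Y ->
  measurable [set w | r < `|Y w - b|].
Proof.
move=> mY; apply: measurable_gt; apply: measurableT_comp => //.
exact: measurable_funB.
Qed.

Lemma concentrated_le r s Y : measurable_fun setT Y -> r <= s -> concentrated P r Y -> concentrated P s Y.
Proof.
move=> mY rs [b H]; exists b; apply: le_lt_trans (lt_le_trans H rs).
apply: le_pr; [exact: measurable_dist_gt|exact: measurable_dist_gt|].
by move=> w /=; exact: le_lt_trans.
Qed.

Lemma concentrated_cst r (a : R) : 0 < r -> concentrated P r (cst a).
Proof.
move=> r0; exists a; rewrite (_ : [set w | _] = set0) ?pr0//.
by apply/seteqP; split => // w /=; rewrite subrr normr0 ltNge (ltW r0).
Qed.

Lemma concentratedD r s Y Z : measurable_fun setT Y -> measurable_fun setT Z ->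
  concentrated P r Y -> concentrated P s Z -> concentrated P (r + s) (fun w => Y w + Z w).
Proof.
move=> mY mZ [a Ha] [b Hb]; exists (a + b).
apply: le_lt_trans (ltrD Ha Hb); apply: le_trans (prU_le _ _ _).
- apply: le_pr.
  + by apply: measurable_dist_gt; exact: measurable_funD.
  + by apply: measurableU; exact: measurable_dist_gt.
  move=> w /= H; have [?|Yw] := ltP r `|Y w - a|; first by left.
  right => /=; rewrite -(ltrD2l r); apply: lt_le_trans H _.
  rewrite opprD addrACA (le_trans (ler_normD _ _))//.
  by rewrite lerD2r.
- exact: measurable_dist_gt.
- exact: measurable_dist_gt.
Qed.

Lemma concentratedZ r (a L : R) Y : measurable_fun setT Y -> `|a| <= L -> 1 <= L ->
  concentrated P r Y -> concentrated P (L * r) (fun w => a * Y w).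
Proof.
move=> mY aL L1 [b Hb].
have r0 : 0 <= r by apply: le_trans (ltW Hb); exact: pr_ge0.
exists (a * b); apply: (@lt_le_trans _ _ r); last by rewrite ler_peMl.
apply: le_lt_trans Hb; apply: le_pr.
- by apply: measurable_dist_gt; exact: measurable_funM.
- exact: measurable_dist_gt.
move=> w /=; rewrite -mulrBr normrM => H; rewrite ltNge; apply/negP => H'.
move: H; rewrite ltNge => /negP; apply; apply: ler_pM => //.
Qed.

Lemma concentrated_sum (I : finType) (A : {pred I}) r (Y : I -> T -> R) : 0 < r ->
  (forall i, measurable_fun setT (Y i)) ->
  (forall i, i \in A -> concentrated P r (Y i)) ->
  concentrated P (#|A|.+1%:R * r) (fun w => \sum_(i in A) Y i w).
Proof.
move=> r0 mY cY.
have mS s : measurable_fun setT (fun w => \sum_(i <- s) Y i w).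
  by apply: measurable_sum => i.
have H s : {subset s <= A} -> concentrated P ((size s).+1%:R * r) (fun w => \sum_(i <- s) Y i w).
  elim: s => [_|i s IH sA].
    by under eq_fun do rewrite big_nil; apply: concentrated_cst; rewrite mul1r.
  under eq_fun do rewrite big_cons.
  have cYi : concentrated P r (Y i) by apply: cY; apply: sA; rewrite inE eqxx.
  have {}IH := IH (fun j js => sA j (mem_behead (s := i :: s) js)).
  have := concentratedD (mY i) (mS s) cYi IH.
  by rewrite [in X in _ -> X]/= -(natr1 (size s).+1) mulrDl mul1r addrC.
have := H (enum A); rewrite -cardE => {}H.
under eq_fun do rewrite -big_enum/=; apply: H => i.
by rewrite mem_enum.
Qed.

End concentrated_theory.

Section greedy.
Context {R : realType} {N : nat} (P : probability 'rV[R]_N R) (c : 'cV[R]_N).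
Implicit Types (J : {set 'I_N}).

(** Groups that are not concentrated are split off as long as possible. A
    minimal such group K is still concentrated at scale 2 r, being the union
    of one element and of a proper part; so if fewer than m groups can be
    split off, J is the union of concentrated parts. *)
Lemma greedy_groups (r : R) m J : 0 < r ->
  (forall i, i \in J -> concentrated P r (psum [set i]%SET c)) ->
  (exists Js, [/\ size Js = m, pairwise_disjoint Js,
     (forall K, K \in Js -> K \subset J) &
     forall K, K \in Js -> ~ concentrated P r (psum K c)]) \/
  concentrated P ((2 * m)%:R * r) (psum J c).
Proof.
move=> r0; elim: m J => [|m IH] J cJ; first by left; exists [::].
have [cJJ|ncJ] := pselect (concentrated P r (psum J c)).
  right; apply: concentrated_le cJJ; first exact: measurable_psum.
  by rewrite ler_peMl ?(ltW r0)// ler1n muln_gt0.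
pose Q K := `[< ~ concentrated P r (psum K c) >] && (K \subset J).
have [K] : {K | minset Q K}.
  by apply: ex_minset; exists J; rewrite /Q subxx andbT; apply/asboolP.
move=> /minsetP[/andP[/asboolP ncK KJ] minK].
have [K0|[i iK]] := finset.set_0Vmem K.
  case: ncK; rewrite K0 (_ : psum _ c = cst 0); first exact: concentrated_cst.
  by apply/funext => w; exact: psum0.
have cKi : concentrated P r (psum (K :\ i)%SET c).
  apply: contrapT => nc; have := minK (K :\ i)%SET; rewrite /Q.
  have -> /= : `[< ~ concentrated P r (psum (K :\ i)%SET c) >] by apply/asboolP.
  have KiK : K :\ i \subset K by exact: finset.subD1set.
  move=> /(_ (fintype.subset_trans KiK KJ) KiK) E.
  by move: iK; rewrite -E !inE eqxx.
have cK : concentrated P (r + r) (psum K c).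
  have dKi : [disjoint [set i]%SET & (K :\ i)%SET]%B.
    by rewrite -finset.setI_eq0; apply/eqP/setP => j; rewrite !inE; case: eqP.
  have := concentratedD (measurable_psum _ c) (measurable_psum _ c) (cJ i (fintype.subsetP KJ _ iK)) cKi.
  rewrite (_ : (fun w => _) = psum K c)//; apply/funext => w.
  by rewrite -psumU// finset.setD1K.
have dK : [disjoint J :\: K & K]%B.
  rewrite -finset.setI_eq0 finset.setDE -finset.setIA (finset.setIC (~: K)%SET).
  by rewrite finset.setICr finset.setI0.
have [|[Js [sJs dJs sub nc]]|cr] := IH (J :\: K)%SET.
- by move=> j; rewrite inE => /andP[_]; exact: cJ.
- left; exists (K :: Js); split => /=.
  + by rewrite sJs.
  + rewrite /pairwise_disjoint /= -/(pairwise_disjoint Js) dJs andbT; apply/allP => L /sub LJK.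
    by rewrite disjoint_sym; exact: disjointWl LJK dK.
  + move=> L; rewrite inE => /predU1P[->//|/sub LJK].
    by apply: fintype.subset_trans LJK _; exact: finset.subsetDl.
  + by move=> L; rewrite inE => /predU1P[->//|]; exact: nc.
right; have := concentratedD (measurable_psum _ c) (measurable_psum _ c) cK cr.
rewrite (_ : (fun w => _) = psum J c); last first.
  apply/funext => w; rewrite -psumU.
    by rewrite -{1}(finset.setIidPr KJ) finset.setID.
  by rewrite disjoint_sym.
apply: concentrated_le; first exact: measurable_psum.
by rewrite mulnS natrD mulrDl; lra.
Qed.

End greedy.

(** A vector with coordinates 1, t, t^2 and so on is orthogonal to v a
    exactly when t is a root of the polynomial with coefficients v a, and
    the product of these polynomials has only finitely many roots. *)
Lemma generic_functional (R : realType) n k (v : 'I_k -> 'rV[R]_n) :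
  (forall a, v a != 0) -> exists u : 'cV[R]_n, forall a, dot (v a) u != 0.
Proof.
move=> v0; pose p := \prod_a rVpoly (v a).
have p0 : p != 0.
  apply/prodf_neq0 => a _; apply: contraNneq (v0 a) => p0.
  by apply/eqP/rowP => i; rewrite mxE -coef_rVpoly_ord p0 coef0.
have [t pt] : exists t, ~~ root p t.
  apply/not_existsP => H.
  have := @max_poly_roots _ p [seq i%:R | i <- iota 0 (size p)] p0.
  rewrite size_map size_iota ltnn => K; suff : false by [].
  apply: K; last by rewrite map_inj_uniq ?iota_uniq//; exact: mulrIn (oner_neq0 _).
  by apply/allP => _ /mapP[i _ ->]; apply: contrapT => /negP; exact: H.
exists (\col_j t ^+ j) => a.
have -> : dot (v a) (\col_j t ^+ j) = (rVpoly (v a)).[t].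
  rewrite (horner_coef_wide _ (size_poly _ _)) dotE; apply: eq_bigr => i _.
  by rewrite mxE coef_rVpoly_ord.
apply: contraNneq pt => e; rewrite /root /p horner_prod; apply/prodf_eq0.
by exists a => //; rewrite e.
Qed.

(** * No more spread groups than dimensions *)

Section dot_lipschitz.
Context {R : realType} {n : nat}.

Lemma dot_lipschitz (u : 'cV[R]_n) : lipschitz_by (\sum_i `|u i ord0|) (dot ^~ u).
Proof.
split; first exact: sumr_ge0.
move=> x y; rewrite -dotBl dotE (le_trans (ler_norm_sum _ _ _))// mulr_suml.
apply: ler_sum => i _; rewrite normrM mulrC ler_wpM2l//.
exact: coord_le_norm.
Qed.

End dot_lipschitz.

Section spread_groups.
Context {R : realType} {d : nat} (B : set 'rV[R]_d) (mu : probability 'rV[R]_d R).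
Hypotheses (cB : convex_body B) (uB : uniform_on B mu).
Variables (U : set_system (@approximant R d)).
Hypotheses (UU : UltraFilter U) (Umu : tends_to U mu).

Lemma uniform_pr0 A : measurable A -> A `<=` ~` B -> pr mu A = 0.
Proof.
move=> mA AB; apply/eqP; rewrite eq_le pr_ge0 andbT -(uniform_setC cB uB).
apply: le_pr => //; apply: measurableC; exact: (measurable_convex_body cB).
Qed.

(** With h the maximum of the functional u over B, attained at x0, the cap
    of depth e contains the part of B in a ball around x0 of radius of order
    e. *)
Lemma cap_mass (u : 'cV[R]_d) : exists h c, [/\ 0 < c,
  pr mu [set x | h < dot x u] = 0 &
  forall e, 0 < e <= 1 -> c * e ^+ d <= pr mu [set x | h - e <= dot x u]].
Proof.
have [compB _ [p /interior_subset pB]] := cB.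
have [|x0 x0B Hx0] := @compact_EVT_max _ R (dot ^~ u) B (ex_intro _ p pB) compB.
  by apply: continuous_subspaceT => x; exact: continuous_dot.
have [c c0 Hc] := uniform_ball_mass cB uB.
have [L0 HL] := dot_lipschitz u; set L := \sum_i _ in L0 HL.
have L1 : 0 < L + 1 by rewrite ltr_wpDl.
exists (dot x0 u), (c / (L + 1) ^+ d); split.
- by rewrite divr_gt0// exprn_gt0.
- apply: uniform_pr0; first by apply: measurable_gt; exact: measurable_dot.
  by move=> x /= H Bx; move: H; rewrite ltNge Hx0// inE.
move=> e /andP[e0 e1].
rewrite mulrAC -mulrA -expr_div_n.
apply: le_trans (Hc x0 (e / (L + 1)) _ _) _; first by rewrite inE in x0B.
  by rewrite divr_gt0//= ler_pdivrMr// mul1r (le_trans e1)// lerDr.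
apply: le_pr.
- by apply: measurable_le; exact: (lipschitz_measurable (lipschitz_dist x0)).
- by apply: measurable_ge; exact: measurable_dot.
move=> x /= xx0; rewrite lerBlDr -lerBlDl.
rewrite (le_trans (ler_norm _))// distrC (le_trans (HL _ _))// distrC.
have : `|x - x0| * (L + 1) <= e by rewrite -ler_pdivlMr.
by rewrite mulrDr mulr1 (distrC x0 x) mulrC; have := normr_ge0 (x - x0); lra.
Qed.

(** The confrontation of the two tail estimates. In the limit, the cap of
    depth e at the top of B in the direction u has mass at least of order
    e^d. If d.+1 disjoint groups of coordinates were spread in this
    direction, then an approximant would come within e of a level t0 with
    probability at most of order e^(d+1). The level t0 cannot lie above the
    cap, because it is reached with a probability bounded below while the
    limit does not charge anything beyond the top of B. For small e this is
    a contradiction. *)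
Lemma no_spread_groups (u : 'cV[R]_d) (r : R) : 0 < r ->
  \forall l \near U, forall Js, size Js = d.+1 -> pairwise_disjoint Js ->
    ~ forall J, J \in Js -> ~ concentrated (ap_law l) r (psum J (ap_mx l *m u)).
Proof.
move=> r0.
have half_margin (x y z : R) : x <= y -> y - x / 2 <= z -> x / 2 <= z by lra.
have lt_half (x : R) : 0 < x / 2 -> ~~ (x <= x / 2) by rewrite -ltNge; lra.
have third_shift (t h e : R) : t < h + e / 3 -> t - e <= h - 2 * (e / 3) by lra.
(* Everything is concentrated at a scale larger than 1. *)
have [r1|r1] := leP r 1; last first.
  apply: nearW => l [//|J Js] _ _ H; have := H J; rewrite inE eqxx => /(_ isT).
  apply; exists 0; apply: le_lt_trans r1; apply: pr_le1.
  by apply: measurable_dist_gt; exact: measurable_psum.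
have [h [c [c0 hB Hc]]] := cap_mass u.
have [K K0 HK] := @tail_bound_order R r d.+1 (introT andP (conj r0 r1)) isT.
(* The constants are such that the cap of depth e / 3 has, up to an error
   of half of it, mass at least c' * e^d, and that K * e^(d+1) is smaller
   than this. *)
pose c' := c / (2 * 3 ^+ d).
have c'0 : 0 < c' by rewrite divr_gt0// mulr_gt0// exprn_gt0.
pose e := Num.min (r / 2) (c' / (2 * K)).
have e0 : 0 < e by rewrite lt_min !divr_gt0// mulr_gt0.
have er : e <= r / 2 by rewrite ge_min lexx.
have ec : K * e < c'.
  apply: (@le_lt_trans _ _ (c' / 2)); last by rewrite ltr_pdivrMr//; lra.
  rewrite mulrC -ler_pdivlMr// -mulrA -invfM; rewrite ge_min; apply/orP; right.
  by rewrite lexx.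
clearbody e; have e1 : e < 1 by lra.
have c'E : c' = c / (2 * 3 ^+ d) by []; clearbody c'.
pose delta := e ^+ d.+1.
have d0 : 0 < delta by rewrite exprn_gt0.
have de : delta <= e.
  by rewrite -[leRHS]expr1 /delta; apply: ler_wiXn2l => //; exact: ltW.
have deltaE : delta = e ^+ d.+1 by []; clearbody delta.
have e3 : 0 < e / 3 <= 1 by apply/andP; split; lra.
have cap0 : 0 < c * (e / 3) ^+ d / 2.
  by rewrite divr_gt0// mulr_gt0// exprn_gt0//; case/andP: e3.
have dd0 : 0 < delta ^+ d.+2 / 2 by rewrite divr_gt0// exprn_gt0.
near=> l => Js sJs dJs nc.
have [||||||t0 [t1 t2]] := @total_tail _ _ (ap_law l) (ap_mx l *m u) _ r delta e Js.
- exact: ap_prodlaw.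
- by apply/andP; split; lra.
- by lra.
- by apply/andP; split; lra.
- exact: dJs.
- exact: nc.
rewrite sJs in t1 t2.
have mS : measurable_fun setT (fun w => dot w (ap_mx l *m u)) by exact: measurable_dot.
have dE w : dot (w *m ap_mx l) u = dot w (ap_mx l *m u) by rewrite /dot mulmxA.
have [U1 _] : pr (ap_law l) [set w | h + e / 3 <= dot (w *m ap_mx l) u] <=
      pr mu [set x | h < dot x u] + delta ^+ d.+2 / 2 /\
    pr mu [set x | h + e / 3 <= dot x u] - delta ^+ d.+2 / 2 <=
      pr (ap_law l) [set w | h < dot (w *m ap_mx l) u].
  near: l; apply: (portmanteau UU Umu (dot_lipschitz u)) => //.
  by rewrite ltrDl; lra.
have [_ U2] : pr (ap_law l) [set w | h - e / 3 <= dot (w *m ap_mx l) u] <=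
      pr mu [set x | h - 2 * (e / 3) < dot x u] + c * (e / 3) ^+ d / 2 /\
    pr mu [set x | h - e / 3 <= dot x u] - c * (e / 3) ^+ d / 2 <=
      pr (ap_law l) [set w | h - 2 * (e / 3) < dot (w *m ap_mx l) u].
  near: l; apply: (portmanteau UU Umu (dot_lipschitz u)) => //.
  by case/andP: e3 => *; lra.
have {U2}U2 : c * (e / 3) ^+ d / 2 <=
    pr (ap_law l) [set w | h - 2 * (e / 3) < dot w (ap_mx l *m u)].
  under eq_set do rewrite -dE.
  exact: half_margin (Hc _ e3) U2.
have t0h : t0 < h + e / 3.
  rewrite ltNge; apply/negP => ht.
  have : delta ^+ d.+2 <= delta ^+ d.+2 / 2; last exact/negP/lt_half.
  rewrite -[leRHS]add0r -hB; apply: le_trans U1; apply: le_trans t1 _.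
  apply: le_pr; first exact: measurable_ge.
    apply: measurable_ge; apply: eq_measurable_fun mS => w _; by rewrite dE.
  by move=> w /=; rewrite dE; exact: le_trans.
have U3 : c * (e / 3) ^+ d / 2 <= K * e ^+ d.+1.
  apply: le_trans U2 _; apply: le_trans (HK e _); last by rewrite e0 ltW.
  rewrite -deltaE; apply: le_trans t2; apply: le_pr; [exact: measurable_gt|exact: measurable_gt|].
  by move=> w /=; apply: le_lt_trans; exact: third_shift.
move: U3; rewrite exprS mulrA expr_div_n leNgt => /negP; apply.
have -> : c * (e ^+ d / 3 ^+ d) / 2 = c' * e ^+ d.
  by rewrite c'E invfM; ring.
by rewrite ltr_pM2r// exprn_gt0.
Unshelve. all: by end_near. Qed.

End spread_groups.

(** * The spread coordinates of an approximation *)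

Section summand_tight.
Context {R : realType} {N : nat} (P : probability 'rV[R]_N R) (c : 'cV[R]_N).
Hypothesis pP : prodlaw P.

(** Let Z be the rest of the sum and z a median of Z. When Y is larger than
    K - z, then with probability at least one half Z is at least z, which
    pushes the sum above K; likewise on the other side. So Y stays within K
    of - z up to four times the probability that the sum is at least K in
    absolute value. *)
Lemma summand_tight (K e : R) (J : {set 'I_N}) :
  pr P [set w | K <= `|dot w c|] <= e ->
  exists b, pr P [set w | K < `|psum J c w - b|] <= 4 * e.
Proof.
move=> H; pose Y := psum J c; pose Z := psum (~: J)%SET c.
have mY : measurable_fun setT Y by exact: measurable_psum.
have mZ : measurable_fun setT Z by exact: measurable_psum.
have JC : [disjoint J & ~: J]%B by rewrite -finset.setI_eq0 finset.setICr.
have YZ w : dot w c = Y w + Z w by rewrite -psumU// finset.setUCr psumT.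
have h01 : 0 < (2^-1 : R) < 1 by apply/andP; split; lra.
have [z /andP[z1 z2]] := top_quantile P mZ h01.
have z3 : 2^-1 <= pr P [set w | Z w <= z].
  rewrite (_ : [set w | _] = ~` [set w | z < Z w]).
    by rewrite prC; [lra|exact: measurable_gt].
  by apply/seteqP; split => w /=; rewrite leNgt => /negP.
have mD : measurable [set w | K <= `|dot w c|].
  by apply: measurable_ge; apply: measurableT_comp => //; exact: measurable_dot.
have p1 : pr P [set w | K - z < Y w] * 2^-1 <= e.
  apply: le_trans H; apply: (@le_trans _ _
    (pr P [set w | K - z < Y w] * pr P [set w | z <= Z w])).
    by rewrite ler_wpM2l// pr_ge0.
  rewrite -(pr_indep pP _ _ JC); first last.
  - exact: (@depends_psum _ _ _ _ _ (fun t => is_true (z <= t))).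
  - exact: (@depends_psum _ _ _ _ _ (fun t => is_true (K - z < t))).
  - exact: measurable_ge.
  - exact: measurable_gt.
  apply: le_pr => //; first by apply: measurableI; [exact: measurable_gt|exact: measurable_ge].
  by move=> w [/= ? ?]; rewrite YZ ler_normr; apply/orP; left; lra.
have p2 : pr P [set w | Y w < - K - z] * 2^-1 <= e.
  apply: le_trans H; apply: (@le_trans _ _
    (pr P [set w | Y w < - K - z] * pr P [set w | Z w <= z])).
    by rewrite ler_wpM2l// pr_ge0.
  rewrite -(pr_indep pP _ _ JC); first last.
  - exact: (@depends_psum _ _ _ _ _ (fun t => is_true (t <= z))).
  - exact: (@depends_psum _ _ _ _ _ (fun t => is_true (t < - K - z))).
  - exact: measurable_le.
  - exact: measurable_lt.
  apply: le_pr => //; first by apply: measurableI; [exact: measurable_lt|exact: measurable_le].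
  by move=> w [/= ? ?]; rewrite YZ ler_normr; apply/orP; right; lra.
exists (- z); apply: (@le_trans _ _
  (pr P [set w | K - z < Y w] + pr P [set w | Y w < - K - z])); last lra.
apply: le_trans (prU_le _ _ _).
- apply: le_pr.
  + exact: measurable_dist_gt.
  + by apply: measurableU; [exact: measurable_gt|exact: measurable_lt].
  by move=> w /=; rewrite -/(Y w) opprK ltr_normr => /orP[?|?]; [left|right] => /=; lra.
- exact: measurable_gt.
- exact: measurable_lt.
Qed.

End summand_tight.

Lemma ultra_cvg (I : Type) (T : topologicalType) (U : set_system I)
    (A : set T) (phi : I -> T) : UltraFilter U -> compact A ->
  (forall i, A (phi i)) -> exists v : T, phi i @[i --> U] --> v.
Proof.
move=> UU cA HA; have PF : ProperFilter (phi @ U) by exact: fmap_proper_filter.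
have [|v [_ clv]] := cA (phi @ U) PF; first by apply: nearW.
exists v => V vV; have [//|nV] := in_ultra_setVsetC (phi @^-1` V) UU.
by have [x []] := clv (~` V) V nV vV.
Qed.

Lemma ultra_cvg_rV (R : realType) n (I : Type) (U : set_system I)
    (phi : I -> 'rV[R]_n) (K : R) : UltraFilter U ->
  (forall i, `|phi i| <= K) -> exists v : 'rV[R]_n, phi i @[i --> U] --> v.
Proof.
move=> UU HK.
have [|v Hv] := @ultra_cvg _ _ U _ phi UU
  (@box_compact R n (const_mx (- K)) (const_mx K)); last by exists v.
by move=> i j; rewrite !mxE -ler_norml (le_trans (coord_le_norm _ _)).
Qed.

Lemma dot_cvg (R : realType) n (I : Type) (U : set_system I)
    (phi : I -> 'rV[R]_n) (v : 'rV[R]_n) u : Filter U ->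
  phi i @[i --> U] --> v -> dot (phi i) u @[i --> U] --> dot v u.
Proof.
move=> FU Hv; exact: (cvg_comp phi (dot ^~ u) Hv (@continuous_dot R n u v)).
Qed.

Section components.
Context {R : realType} {d : nat}.

Definition row_norm (l : @approximant R d) i : R := `|row i (ap_mx l)|.
Arguments row_norm l i : clear implicits.

(** The coordinates whose contribution to the image is not yet close to a
    constant, at scale r. *)
Definition spread_idx (r : R) (l : @approximant R d) : {set 'I_(ap_dim l)} :=
  [set i | `[< ~ concentrated (ap_law l) r (fun w => row_norm l i * w ord0 i) >]]%SET.

Lemma spread_idxP r l i :
  reflect (~ concentrated (ap_law l) r (fun w => row_norm l i * w ord0 i)) (i \in spread_idx r l).
Proof. by rewrite inE; exact: asboolP. Qed.

Lemma psum1 N i (c : 'cV[R]_N) w : psum [set i]%SET c w = w ord0 i * c i ord0.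
Proof. by rewrite /psum big_set1. Qed.

Lemma ap_mulmxE (l : @approximant R d) (u : 'cV[R]_d) i :
  (ap_mx l *m u) i ord0 = dot (row i (ap_mx l)) u.
Proof. by rewrite /dot -row_mul [RHS]mxE. Qed.

Lemma dot_delta (x : 'rV[R]_d) j : dot x (delta_mx j ord0) = x ord0 j.
Proof. by rewrite /dot -colE mxE. Qed.

End components.

Arguments row_norm {R d} l i.

Section spread_coordinates.
Context {R : realType} {d : nat} (B : set 'rV[R]_d) (mu : probability 'rV[R]_d R).
Hypotheses (cB : convex_body B) (uB : uniform_on B mu).
Variables (U : set_system (@approximant R d)).
Hypotheses (UU : UltraFilter U) (Umu : tends_to U mu).

Lemma approximant_tight : exists2 K : R, 0 < K & forall e, 0 < e ->
  \forall l \near U, pr (ap_law l) [set w | K <= `|w *m ap_mx l|] <= e.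
Proof.
have [K K0 HK] := convex_body_bound cB; exists (K + 1); first by rewrite addr_gt0.
move=> e e0; near=> l.
have [H _] : pr (ap_law l) [set w | K + 1 <= `|w *m ap_mx l - 0|] <=
      pr mu [set x | K < `|x - 0|] + e /\
    pr mu [set x | K + 1 <= `|x - 0|] - e <=
      pr (ap_law l) [set w | K < `|w *m ap_mx l - 0|].
  near: l; apply: (portmanteau UU Umu (lipschitz_dist 0)) => //.
  by rewrite ltrDl.
under eq_set do rewrite -[_ *m _]subr0; apply: le_trans H _.
rewrite (uniform_pr0 cB uB) ?add0r//.
  by apply: measurable_gt; exact: (lipschitz_measurable (lipschitz_dist 0)).
by move=> x /=; rewrite subr0 => H /HK; rewrite leNgt H.
Unshelve. all: by end_near. Qed.

(** Some entry of row i of the matrix has absolute value row_norm l i, so up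
    to sign row_norm l i * w i is an independent summand of a bounded
    coordinate of the image. *)
Lemma tight_coord : exists2 K : R, 0 < K & forall e, 0 < e ->
  \forall l \near U, forall i, exists b,
    pr (ap_law l) [set w | K < `|row_norm l i * w ord0 i - b|] <= e.
Proof.
have [K K0 HK] := approximant_tight; exists K => // e e0.
have e4 : 0 < e / 4 by rewrite divr_gt0.
near=> l => i.
have H : pr (ap_law l) [set w | K <= `|w *m ap_mx l|] <= e / 4.
  by near: l; exact: HK.
have mM : measurable_fun setT (fun w : 'rV[R]_(ap_dim l) => row_norm l i * w ord0 i).
  by apply: measurable_funM => //; exact: measurable_coord.
have [r0|/mx_norm_neq0[[k j]]] := eqVneq (row_norm l i) 0.
  exists 0; rewrite (_ : [set w | _] = set0) ?pr0 ?(ltW e0)//.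
  by apply/seteqP; split => // w /=; rewrite r0 mul0r subrr normr0 ltNge (ltW K0).
rewrite [mx_norm _]/(row_norm l i) /= [k]ord1 mxE => rE.
have [|b Hb] := @summand_tight _ _ (ap_law l) (ap_mx l *m delta_mx j ord0)
    (ap_prodlaw l) K (e / 4) [set i]%SET.
  apply: le_trans H; apply: le_pr.
  - by apply: measurable_ge; apply: measurableT_comp => //; exact: measurable_dot.
  - apply: measurable_ge; apply: (measurableT_comp _ (measurable_mulmx (ap_mx l))).
    apply: continuous_measurable_rV; exact: norm_continuous.
  move=> w /= /le_trans; apply; rewrite /dot mulmxA -/(dot _ _) dot_delta.
  exact: coord_le_norm.
pose s := Num.sg (ap_mx l i j).
have sE : s * ap_mx l i j = row_norm l i by rewrite /row_norm rE /s -normrEsg.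
exists (s * b); apply: (@le_trans _ _ (4 * (e / 4))); last by lra.
apply: le_trans Hb; apply: le_pr.
- exact: measurable_dist_gt.
- by apply: measurable_dist_gt; exact: measurable_psum.
move=> w /=; rewrite psum1 ap_mulmxE dot_delta mxE -sE => /lt_le_trans; apply.
rewrite -mulrA -mulrBr normrM (mulrC (w _ _)) ler_piMl//.
by rewrite /s normr_sg; case: (_ != 0).
Unshelve. all: by end_near. Qed.

Lemma concentrated_singleton r (l : @approximant R d) i j : 0 < r -> i \notin spread_idx r l ->
  concentrated (ap_law l) r (psum [set i]%SET (ap_mx l *m delta_mx j ord0)).
Proof.
move=> r0; rewrite inE => /asboolP/contrapT H.
have E w : psum [set i]%SET (ap_mx l *m delta_mx j ord0) w = w ord0 i * ap_mx l i j.
  by rewrite psum1 ap_mulmxE dot_delta mxE.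
have le : `|ap_mx l i j| <= row_norm l i.
  by have := coord_le_norm (row i (ap_mx l)) j; rewrite mxE.
have [rn0|rnN] := eqVneq (row_norm l i) 0.
  rewrite (_ : psum _ _ = cst 0); first exact: concentrated_cst.
  apply/funext => w; rewrite E; move: le; rewrite rn0 normr_le0 => /eqP ->.
  by rewrite mulr0.
have mM : measurable_fun setT (fun w : 'rV[R]_(ap_dim l) => row_norm l i * w ord0 i).
  by apply: measurable_funM => //; exact: measurable_coord.
have rn0 : 0 < row_norm l i by rewrite lt_neqAle eq_sym rnN normr_ge0.
have := @concentratedZ _ _ _ (ap_law l) r (ap_mx l i j / row_norm l i) 1 _ mM _ (lexx _) H.
rewrite mul1r normrM normfV (gtr0_norm rn0) ler_pdivrMr// mul1r => /(_ le).
rewrite (_ : (fun w => _) = psum [set i]%SET (ap_mx l *m delta_mx j ord0))//.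
by apply/funext => w; rewrite E; field.
Qed.

(** Single coordinates outside spread_idx r l are concentrated; if their sum
    were not, greedy_groups would find d.+1 spread groups among them. *)
Lemma rest_concentrated r : 0 < r -> \forall l \near U, forall j,
  concentrated (ap_law l) ((2 * d.+1)%:R * r)
    (psum (~: spread_idx r l)%SET (ap_mx l *m delta_mx j ord0)).
Proof.
move=> r0; apply: near_forall => j.
have := no_spread_groups cB uB UU Umu (delta_mx j ord0) r0.
apply: filterS => l nog.
have [|[Js [sJs dJs _ nc]]|//] := @greedy_groups _ _ (ap_law l)
    (ap_mx l *m delta_mx j ord0) r d.+1 (~: spread_idx r l)%SET r0.
  by move=> i; rewrite inE => iN; exact: concentrated_singleton.
by case: (nog Js sJs dJs).
Qed.

(** Otherwise d.+1 spread coordinates can be chosen. Along the ultrafilter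
    the normalized rows of the matrix at these coordinates converge to unit
    vectors, and a functional u that vanishes at none of the limits sees
    each of the coordinates: they are d.+1 singletons spread in the
    direction u. *)
Lemma card_spread_idx r : 0 < r -> \forall l \near U, (#|spread_idx r l| <= d)%N.
Proof.
move=> r0; have [|bigU] := in_ultra_setVsetC [set l | (#|spread_idx r l| <= d)%N] UU; first by [].
exfalso.
have {}bigU : \forall l \near U, (d < #|spread_idx r l|)%N.
  by apply: filterS bigU => l /negP; rewrite -ltnNge.
have /choice[uh Huh] : forall l : @approximant R d, exists u : 'I_d.+1 -> 'rV[R]_d,
    (forall a, `|u a| <= 1) /\ ((d < #|spread_idx r l|)%N ->
      exists2 w : 'I_d.+1 -> 'I_(ap_dim l), injective w &
        forall a, [/\ w a \in spread_idx r l, `|u a| = 1 &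
          row (w a) (ap_mx l) = row_norm l (w a) *: u a]).
  move=> l; have [|dl] := leqP #|spread_idx r l| d.
    by exists (fun=> 0); split => [a|//]; rewrite normr0.
  (* The first d.+1 spread coordinates. *)
  pose w a := enum_val (widen_ord dl a).
  have wb a : w a \in spread_idx r l by exact: enum_valP.
  have rn0 a : row_norm l (w a) != 0.
    have /spread_idxP nc := wb a; apply/eqP => rn0; apply: nc.
    rewrite rn0 (_ : (fun _ => _) = cst 0); first exact: concentrated_cst.
    by apply/funext => x; rewrite mul0r.
  have u1 a : `|(row_norm l (w a))^-1 *: row (w a) (ap_mx l)| = 1.
    by rewrite normrZ normfV /row_norm normr_id mulVf//; exact: rn0.
  exists (fun a => (row_norm l (w a))^-1 *: row (w a) (ap_mx l)).
  split => [a|_]; first by rewrite u1.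
  exists w => [a b /enum_val_inj/(congr1 val)/= ab|a]; first exact: val_inj.
  by split => //; rewrite scalerA divff// scale1r.
have /choice[v Hv] : forall a, exists v : 'rV[R]_d, uh l a @[l --> U] --> v.
  move=> a; apply: (@ultra_cvg_rV _ _ _ U (fun l => uh l a) 1) => l.
  by have [] := Huh l.
have v0 a : v a != 0.
  apply/eqP => va0.
  have [l [dl]] : exists l, (d < #|spread_idx r l|)%N /\ `|v a - uh l a| < 1.
    apply: (@filter_ex _ U); near=> l; split; first by near: l.
    near: l; apply: cvgr_dist_lt => //; exact: Hv.
  have [_ /(_ dl)[w _ /(_ a)[_ u1 _]]] := Huh l.
  by rewrite va0 sub0r normrN u1 ltxx.
have [u Hu] := generic_functional v0.
pose c a := `|dot (v a) u| / 2.
have [c0 c00 Hc0] : exists2 c0, 0 < c0 <= 1 & forall a, c0 <= c a.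
  have [a _ Ha] := @arg_minP _ _ _ ord0 xpredT c isT.
  exists (Num.min 1 (c a)).
    by rewrite lt_min ltr01 ge_min lexx/= /c divr_gt0// normr_gt0.
  by move=> b; rewrite ge_min Ha ?orbT.
have /andP[c0p c01] := c00.
have near_dot : \forall l \near U, forall a, c0 <= `|dot (uh l a) u|.
  apply: near_forall => a.
  have cv : dot (uh l a) u @[l --> U] --> dot (v a) u.
    exact: dot_cvg.
  have ca : 0 < c a by rewrite divr_gt0// normr_gt0.
  move/cvgrPdist_lt : cv => /(_ _ ca); apply: filterS => l Hl.
  apply: le_trans (Hc0 a) _.
  have := ler_normD (dot (v a) u - dot (uh l a) u) (dot (uh l a) u).
  by rewrite subrK; move: Hl; rewrite /c; lra.
have rc0 : 0 < r * c0 by rewrite mulr_gt0.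
have [l [[nog dl] nd]] : exists l, ((forall Js, size Js = d.+1 -> pairwise_disjoint Js ->
    ~ forall J, J \in Js -> ~ concentrated (ap_law l) (r * c0) (psum J (ap_mx l *m u))) /\
    (d < #|spread_idx r l|)%N) /\
    (forall a, c0 <= `|dot (uh l a) u|).
  apply: (@filter_ex _ U); near=> l; split; last by near: l.
  split; last by near: l.
  near: l; exact: (no_spread_groups cB uB UU Umu u rc0).
have [_ /(_ dl)[w winj Hw]] := Huh l.
apply: (nog [seq [set w a]%SET | a <- enum 'I_d.+1]).
- by rewrite size_map size_enum_ord.
- rewrite /pairwise_disjoint pairwise_map; have := enum_uniq 'I_d.+1.
  rewrite uniq_pairwise; apply: sub_pairwise => a b /= ab.
  by rewrite disjoints1 inE (inj_eq winj).
move=> _ /mapP[a _ ->] cc; have [wb _ rE] := Hw a.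
move/spread_idxP : wb; apply.
have du0 : 0 < `|dot (uh l a) u| by apply: lt_le_trans (nd a).
have := @concentratedZ _ _ _ (ap_law l) (r * c0) (dot (uh l a) u)^-1 c0^-1 _ (measurable_psum _ _) _ _ cc.
rewrite normfV lef_pV2 ?posrE// => /(_ (nd a)).
rewrite invf_ge1// => /(_ c01); rewrite mulrCA mulVf ?gt_eqF// mulr1.
rewrite (_ : (fun x => _) =
  (fun x : 'rV[R]_(ap_dim l) => row_norm l (w a) * x ord0 (w a)))//.
apply/funext => x; rewrite psum1 ap_mulmxE rE dotZl.
by field; rewrite -normr_gt0.
Unshelve. all: by end_near. Qed.

End spread_coordinates.

(** * Mass near the points of the body *)

Section finitely_many_events.
Context {R : realType}.

Lemma measurable_forall dp (T : measurableType dp) (I : finType) (A : I -> set T) :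
  (forall i, measurable (A i)) -> measurable [set w | forall i, A i w].
Proof.
move=> mA; rewrite (_ : [set w | _] = \bigcap_(i in [set: I]) A i).
  by apply: fin_bigcap_measurable.
by apply/seteqP; split => w /= H i; [move=> _|]; exact: H.
Qed.

Lemma measurable_exists dp (T : measurableType dp) (I : finType) (A : I -> set T) :
  (forall i, measurable (A i)) -> measurable [set w | exists i, A i w].
Proof.
move=> mA; rewrite (_ : [set w | _] = ~` [set w | forall i, (~` A i) w]).
  by apply: measurableC; apply: measurable_forall => i; exact: measurableC.
apply/seteqP; split => w /=; first by move=> [i Ai] /(_ i).
by move=> H; apply: contrapT => H'; apply: H => i Ai; apply: H'; exists i.
Qed.

Lemma pr_exists_le dp (T : measurableType dp) (P : probability T R) (I : finType)
    (A : I -> set T) (e : R) : (forall i, measurable (A i)) ->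
  (forall i, pr P (A i) <= e) -> pr P [set w | exists i, A i w] <= #|I|%:R * e.
Proof.
move=> mA Ae.
have mU (s : seq I) : measurable (\big[setU/set0]_(i <- s) A i).
  by apply: bigsetU_measurable.
have H (s : seq I) : pr P (\big[setU/set0]_(i <- s) A i) <= (size s)%:R * e.
  elim: s => [|i s IH]; first by rewrite big_nil pr0 mul0r.
  rewrite big_cons; apply: le_trans (prU_le _ (mA i) (mU s)) _.
  by rewrite /= -natr1 mulrDl mul1r addrC lerD.
rewrite cardE; apply: le_trans (H (enum I)).
apply: le_pr => //; first exact: measurable_exists.
move=> w [i Ai]; rewrite -bigcup_seq; exists i => //=.
by rewrite mem_enum.
Qed.

Lemma pr_forall_indep N k (P : probability 'rV[R]_N R) (iota : 'I_k -> 'I_N)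
    (E : 'I_k -> set 'rV[R]_N) : prodlaw P -> injective iota ->
  (forall a, measurable (E a)) ->
  (forall a, depends_on [set iota a]%SET (E a)) ->
  pr P [set w | forall a, E a w] = \prod_a pr P (E a).
Proof.
move=> pP iinj mE dE.
have H s : uniq s -> [/\ measurable [set w | forall a, a \in s -> E a w],
    depends_on [set iota a | a in s]%SET [set w | forall a, a \in s -> E a w] &
    pr P [set w | forall a, a \in s -> E a w] = \prod_(a <- s) pr P (E a)].
  elim: s => [_|a s IH /= /andP[as_ us]].
    rewrite (_ : [set w | _] = setT); last by apply/seteqP; split.
    by rewrite big_nil prT; split => //.
  have [m1 d1 p1] := IH us.
  have -> : [set w | forall b, b \in a :: s -> E b w] =
      E a `&` [set w | forall b, b \in s -> E b w].
    apply/seteqP; split => w /=.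
      by move=> Hw; split => [|b bs]; apply: Hw; rewrite inE ?eqxx ?bs ?orbT.
    by move=> [Ea Hs] b; rewrite inE => /predU1P[->//|]; exact: Hs.
  split.
  - exact: measurableI.
  - move=> x y xy; congr (_ /\ _).
      by apply: dE => i; rewrite inE => /eqP ->; apply: xy; rewrite imset_f ?inE ?eqxx.
    apply: d1 => i /imsetP[b bs ->]; apply: xy; rewrite imset_f//.
    by rewrite inE bs orbT.
  rewrite big_cons -p1; apply: (pr_indep pP (mE a) m1) (dE a) d1.
  rewrite disjoints1; apply/imsetP => -[b bs /iinj ab].
  by move: as_; rewrite ab bs.
have [_ _] := H (enum 'I_k) (enum_uniq _).
rewrite big_enum /= => <-; congr (pr _ _).
by apply/seteqP; split => w /= Hw a; [move=> _|]; apply: Hw; rewrite ?mem_enum.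
Qed.

End finitely_many_events.

Lemma measurable_dist_mulmx (R : realType) m n (M : 'M[R]_(m, n)) y :
  measurable_fun setT (fun w : 'rV[R]_m => `|w *m M - y|).
Proof.
exact: (measurableT_comp (lipschitz_measurable (lipschitz_dist y))
  (measurable_mulmx M)).
Qed.

Section mass_near_body.
Context {R : realType} {d : nat} (B : set 'rV[R]_d) (mu : probability 'rV[R]_d R).
Hypotheses (cB : convex_body B) (uB : uniform_on B mu).
Variables (U : set_system (@approximant R d)).
Hypotheses (UU : UltraFilter U) (Umu : tends_to U mu).

Lemma near_ball_mass (e : R) : 0 < e <= 1 -> exists2 c : R, 0 < c & forall y, B y ->
  \forall l \near U, c <= pr (ap_law l) [set w | `|w *m ap_mx l - y| < 2 * e].
Proof.
move=> /andP[e0 e1]; have [c c0 Hc] := uniform_ball_mass cB uB.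
have ce : 0 < c * e ^+ d / 2 by rewrite divr_gt0// mulr_gt0// exprn_gt0.
exists (c * e ^+ d / 2) => // y By.
have Hcy : c * e ^+ d <= pr mu [set x | `|x - y| <= e] by apply: Hc => //; apply/andP.
have lipN : lipschitz_by 1 (fun x => - `|x - y|).
  have [L0 HL] := lipschitz_dist y; split => // x z.
  by rewrite -opprD normrN; exact: HL.
have eN : - (2 * e) < - e by rewrite ltrN2; lra.
have := portmanteau UU Umu lipN eN ce; apply: filterS => l [_].
under eq_set do rewrite lerN2.
under [in X in _ <= X -> _]eq_set do rewrite ltrN2.
by apply: le_trans; lra.
Qed.

(** B contains a segment of length rho parallel to a coordinate axis along
    which u has slope 1 or -1. An approximant charges neighbourhoods of both
    ends of this segment by a fixed amount, so no value can be close to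
    both. *)
Lemma spread_uniform : exists2 rho : R, 0 < rho & forall u : 'cV[R]_d,
  (forall j, `|u j ord0| <= 1) -> (exists j, `|u j ord0| = 1) ->
  \forall l \near U, ~ concentrated (ap_law l) rho (fun w => dot w (ap_mx l *m u)).
Proof.
have [p [rho r0 rB]] := convex_body_inner cB.
pose e := Num.min 1 (rho / (8 * d.+1%:R)).
have d0 : 0 < d.+1%:R :> R by [].
have e0 : 0 < e by rewrite lt_min ltr01 divr_gt0// mulr_gt0.
have e1 : e <= 1 by rewrite ge_min lexx.
have eE : d.+1%:R * (2 * e) <= rho / 4.
  have : e <= rho / (8 * d.+1%:R) by rewrite ge_min lexx orbT.
  rewrite ler_pdivlMr ?mulr_gt0//; lra.
clearbody e.
have [c c0 Hc] := near_ball_mass (introT andP (conj e0 e1)).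
exists (Num.min c (rho / 8)); first by rewrite lt_min c0 divr_gt0.
move=> u u1 [j uj].
pose pp (s : R) := p + s *: delta_mx ord0 j.
have ppB s : `|s| < rho -> B (pp s).
  move=> sr; apply: rB; rewrite -ball_normE /= /pp opprD addrA subrr sub0r normrN.
  apply: le_lt_trans sr; apply: norm_le_coord => // i.
  rewrite !mxE eqxx /= normrM; case: (i == j); rewrite ?mulr1 ?normr1 ?mulr1//.
  by rewrite normr0 mulr0.
have dpp s : dot (pp s) u = dot p u + s * u j ord0.
  by rewrite /pp dotDl dotZl; congr (_ + _ * _); rewrite /dot -rowE mxE.
have p1B : B (pp (rho / 2)) by apply: ppB; rewrite gtr0_norm; lra.
have p2B : B (pp (- (rho / 2))) by apply: ppB; rewrite normrN gtr0_norm; lra.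
near=> l => -[b].
have H1 : c <= pr (ap_law l) [set w | `|w *m ap_mx l - pp (rho / 2)| < 2 * e].
  by near: l; exact: Hc.
have H2 : c <= pr (ap_law l) [set w | `|w *m ap_mx l - pp (- (rho / 2))| < 2 * e].
  by near: l; exact: Hc.
apply/negP; rewrite -leNgt.
have key s : rho / 2 <= `|dot (pp s) u - b| ->
    c <= pr (ap_law l) [set w | `|w *m ap_mx l - pp s| < 2 * e] ->
    Num.min c (rho / 8) <= pr (ap_law l)
      [set w | Num.min c (rho / 8) < `|dot w (ap_mx l *m u) - b|].
  move=> sb cs; apply: le_trans (le_trans cs _); first by rewrite ge_min lexx.
  apply: le_pr.
  - by apply: measurable_lt; exact: measurable_dist_mulmx.
  - by apply: measurable_dist_gt; exact: measurable_dot.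
  move=> w /= ws; apply: (@le_lt_trans _ _ (rho / 8)); first by rewrite ge_min lexx orbT.
  have [_ HL] := dot_lipschitz u.
  have := HL (w *m ap_mx l) (pp s).
  have Ld : \sum_i `|u i ord0| <= d.+1%:R.
    apply: (@le_trans _ _ (\sum_(i < d) 1)); first exact: ler_sum.
    by rewrite sumr_const card_ord ler_nat.
  have : (\sum_i `|u i ord0|) * `|w *m ap_mx l - pp s| <= d.+1%:R * (2 * e).
    by apply: ler_pM => //; [exact: sumr_ge0|exact: ltW].
  move=> h1; rewrite {1}/dot -mulmxA -/(dot _ _) => h2.
  have := ler_normD (dot (pp s) u - dot w (ap_mx l *m u)) (dot w (ap_mx l *m u) - b).
  rewrite addrA subrK (distrC (dot (pp s) u) (dot w _)); lra.
have [Hb|Hb] := leP (rho / 2) `|dot (pp (rho / 2)) u - b|; first exact: key Hb H1.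
apply: key H2; move: Hb; rewrite !dpp.
have [uj1|uj1] : u j ord0 = 1 \/ u j ord0 = -1.
  move/eqP : uj; rewrite eqr_norml => /andP[/orP[/eqP ->|/eqP ->] _]; by [left|right].
  rewrite uj1 ltr_norml ler_normr => /andP[h1 h2]; apply/orP; right; lra.
rewrite uj1 ltr_norml ler_normr => /andP[h1 h2]; apply/orP; left; lra.
Unshelve. all: by end_near. Qed.

End mass_near_body.

(** * The limiting frame *)

Section spread_frame.
Context {R : realType} {d : nat} (i0 : 'I_d).
Implicit Types (l : @approximant R d) (r : R).

(** A numbering of the spread coordinates by a set that does not depend on
    l, which lets the rows be compared for different approximants. It is
    injective when there are at most d spread coordinates. *)
Definition slot r l (i : 'I_(ap_dim l)) : 'I_d :=
  odflt i0 (insub (index i (enum (spread_idx r l)))).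

(** The direction in which the spread coordinate with number a moves the
    image, and 0 if no spread coordinate has this number. *)
Definition unit_row r l (a : 'I_d) : 'rV[R]_d :=
  if [pick i in spread_idx r l | slot r i == a] is Some i
  then (row_norm l i)^-1 *: row i (ap_mx l) else 0.

Lemma slot_inj r l : (#|spread_idx r l| <= d)%N -> {in spread_idx r l &, injective (slot r (l := l))}.
Proof.
move=> bd; have lt i : i \in spread_idx r l -> (index i (enum (spread_idx r l)) < d)%N.
  by move=> ib; apply: leq_trans bd; rewrite cardE index_mem mem_enum.
move=> i j ib jb; rewrite /slot !insubT ?lt// => ib' jb' /(congr1 val) /= e.
have : nth i (enum (spread_idx r l)) (index i (enum (spread_idx r l))) = i.
  by rewrite nth_index// mem_enum.
by rewrite e nth_index ?mem_enum.
Qed.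

Lemma spread_row_norm_neq0 r l i : 0 < r -> i \in spread_idx r l -> row_norm l i != 0.
Proof.
move=> r0 /spread_idxP nc; apply/eqP => rn0; apply: nc.
rewrite (_ : (fun w => _) = cst 0); first exact: concentrated_cst.
by apply/funext => w; rewrite rn0 mul0r.
Qed.

Lemma unit_row_slot r l i : 0 < r -> (#|spread_idx r l| <= d)%N -> i \in spread_idx r l ->
  row i (ap_mx l) = row_norm l i *: unit_row r l (slot r i).
Proof.
move=> r0 bd ib; rewrite /unit_row; case: pickP => [j /andP[jb /eqP ji]|/(_ i)].
  rewrite (slot_inj bd jb ib ji) scalerA divff ?scale1r//.
  exact: spread_row_norm_neq0 ib.
by rewrite ib eqxx.
Qed.

Lemma unit_row_le1 r l a : `|unit_row r l a| <= 1.
Proof.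
rewrite /unit_row; case: pickP => [i _|_]; last by rewrite normr0.
rewrite normrZ normfV /row_norm normr_id.
have [->|n0] := eqVneq `|row i (ap_mx l)| 0; first by rewrite mulr0.
by rewrite mulVf.
Qed.

Lemma unit_row_neq0 r l a : unit_row r l a != 0 ->
  exists2 i, i \in spread_idx r l & slot r i = a.
Proof.
rewrite /unit_row; case: pickP => [i /andP[ib /eqP ia] _|]; last by rewrite eqxx.
by exists i.
Qed.

End spread_frame.

Section frame_limit.
Context {R : realType} {d : nat} (B : set 'rV[R]_d) (mu : probability 'rV[R]_d R).
Hypotheses (cB : convex_body B) (uB : uniform_on B mu).
Variables (U : set_system (@approximant R d)).
Hypotheses (UU : UltraFilter U) (Umu : tends_to U mu).
Variable i0 : 'I_d.

Lemma psum_coord_sum l (J : {set 'I_(ap_dim l)}) (u : 'cV[R]_d) w :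
  psum J (ap_mx l *m u) w =
  \sum_j u j ord0 * psum J (ap_mx l *m delta_mx j ord0) w.
Proof.
under [RHS]eq_bigr do rewrite /psum mulr_sumr.
rewrite exchange_big /=; apply: eq_bigr => i _.
rewrite mxE mulr_sumr; apply: eq_bigr => j _.
by rewrite ap_mulmxE dot_delta mxE mulrCA mulrC mulrCA mulrA.
Qed.

(** If the limit V were singular, some u of norm 1 would vanish on its rows.
    Then in the direction u the spread coordinates, which are tight,
    contribute almost a constant, and so do the other coordinates; hence the
    image would be concentrated in the direction u, against spread_uniform. *)
Lemma limit_frame : exists r (V : 'M[R]_d), [/\ 0 < r, V \in unitmx &
  forall a, unit_row i0 r l a @[l --> U] --> row a V].
Proof.
have [rho rho0 Hrho] := spread_uniform cB uB UU Umu.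
(* The spread coordinates contribute d.+1 times r to the scale of
   concentration; the other coordinates contribute d.+1 times the scale of
   rest_concentrated. *)
pose C : R := d.+1%:R + d.+1%:R * (2 * d.+1)%:R.
have C0 : 0 < C by rewrite addr_gt0// mulr_gt0// ltr0n muln_gt0.
pose r := rho / C; have r0 : 0 < r by rewrite divr_gt0.
have /choice[v Hv] : forall a, exists v : 'rV[R]_d, unit_row i0 r l a @[l --> U] --> v.
  move=> a; apply: (@ultra_cvg_rV _ _ _ U (fun l => unit_row i0 r l a) 1) => l.
  exact: unit_row_le1.
pose V := \matrix_a v a.
exists r, V; split => //; last by move=> a; rewrite rowK; exact: Hv.
apply: contrapT => /negP; rewrite unitmxE unitfE negbK -det_tr.
move=> /det0P[x x0 xV].
pose u : 'cV[R]_d := (`|x|^-1 *: x)^T.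
have nx0 : `|x| != 0 by rewrite normr_eq0.
have nx : 0 < `|x| by rewrite normr_gt0.
have uE j : `|u j ord0| = `|x ord0 j| / `|x|.
  by rewrite !mxE normrM normfV normr_id mulrC.
have u1 j : `|u j ord0| <= 1 by rewrite uE ler_pdivrMr// mul1r coord_le_norm.
have uj : exists j, `|u j ord0| = 1.
  have [[k j] /= xj] := mx_norm_neq0 nx0.
  exists j; rewrite uE; rewrite [k]ord1 in xj.
  by rewrite -[`|x ord0 j|]xj divff.
have Vu a : dot (v a) u = 0.
  have := congr1 trmx xV; rewrite trmx_mul trmxK trmx0 => /matrixP/(_ a ord0).
  rewrite mxE [RHS]mxE => H.
  transitivity (`|x|^-1 * \sum_j V a j * x^T j ord0); last by rewrite H mulr0.
  by rewrite dotE mulr_sumr; apply: eq_bigr => j _; rewrite !mxE mulrCA.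
have [K K0 HK] := tight_coord cB uB UU Umu.
have r2 : 0 < r / 2 by rewrite divr_gt0.
have rK : 0 < r / K by rewrite divr_gt0.
have near_dot : \forall l \near U, forall a, `|dot (unit_row i0 r l a) u| < r / K.
  apply: near_forall => a.
  have cv : dot (unit_row i0 r l a) u @[l --> U] --> dot (v a) u by exact: dot_cvg.
  by move/cvgrPdist_lt : cv => /(_ _ rK); apply: filterS => l; rewrite Vu sub0r normrN.
have [l [[[bc rc] [tc nd]] sp]] : exists l, (((#|spread_idx r l| <= d)%N /\
    forall j, concentrated (ap_law l) ((2 * d.+1)%:R * r)
      (psum (~: spread_idx r l)%SET (ap_mx l *m delta_mx j ord0))) /\
    ((forall i, exists b,
      pr (ap_law l) [set w | K < `|row_norm l i * w ord0 i - b|] <= r / 2) /\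
    (forall a, `|dot (unit_row i0 r l a) u| < r / K))) /\
    ~ concentrated (ap_law l) rho (fun w => dot w (ap_mx l *m u)).
  apply: (@filter_ex _ U); near=> l; split; last by near: l; exact: Hrho.
  split; split; near: l.
  - exact: (card_spread_idx cB uB UU Umu r0).
  - exact: (rest_concentrated cB uB UU Umu r0).
  - exact: (HK _ r2).
  - exact: near_dot.
apply: sp.
have mc i : measurable_fun setT (fun w : 'rV[R]_(ap_dim l) => row_norm l i * w ord0 i).
  by apply: measurable_funM => //; exact: measurable_coord.
have c1 : concentrated (ap_law l) (d.+1%:R * r) (psum (spread_idx r l) (ap_mx l *m u)).
  have H : concentrated (ap_law l) (#|spread_idx r l|.+1%:R * r)
      (fun w => \sum_(i in spread_idx r l)
        (dot (unit_row i0 r l (slot i0 r i)) u * (row_norm l i * w ord0 i))).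
    apply: concentrated_sum => // [i|i ib]; first by apply: measurable_funM.
    have [b Hb] := tc i; exists (dot (unit_row i0 r l (slot i0 r i)) u * b).
    apply: (@le_lt_trans _ _ (r / 2)); last by rewrite ltr_pdivrMr//; lra.
    apply: le_trans Hb; apply: le_pr.
    - by apply: measurable_dist_gt; apply: measurable_funM.
    - exact: measurable_dist_gt.
    move=> w /=; rewrite -mulrBr normrM => Hw; rewrite ltNge; apply/negP => wK.
    move: Hw; rewrite ltNge => /negP; apply.
    rewrite -[leRHS](divfK (lt0r_neq0 K0)); apply: ler_pM => //.
    exact: ltW (nd _).
  apply: (@concentrated_le _ _ _ _ (#|spread_idx r l|.+1%:R * r)).
  - exact: measurable_psum.
  - by rewrite ler_wpM2r ?(ltW r0)// ler_nat.
  rewrite (_ : psum _ _ = (fun w => \sum_(i in spread_idx r l)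
      (dot (unit_row i0 r l (slot i0 r i)) u * (row_norm l i * w ord0 i))))//.
  apply/funext => w; apply: eq_bigr => i ib.
  by rewrite ap_mulmxE (unit_row_slot i0 r0 bc ib) dotZl; ring.
have c2 : concentrated (ap_law l) (d.+1%:R * ((2 * d.+1)%:R * r)) (psum (~: spread_idx r l)%SET (ap_mx l *m u)).
  have := @concentrated_sum _ _ _ (ap_law l) 'I_d xpredT ((2 * d.+1)%:R * r)
    (fun j w => u j ord0 * psum (~: spread_idx r l)%SET (ap_mx l *m delta_mx j ord0) w).
  rewrite cardT size_enum_ord (_ : psum _ (ap_mx l *m u) = (fun w => \sum_(j in xpredT)
     (u j ord0 * psum (~: spread_idx r l)%SET (ap_mx l *m delta_mx j ord0) w))); last first.
    by apply/funext => w; rewrite psum_coord_sum.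
  apply; first by rewrite mulr_gt0// ltr0n muln_gt0.
    by move=> j; apply: measurable_funM => //; exact: measurable_psum.
  move=> j _; rewrite -[X in concentrated _ X]mul1r; apply: concentratedZ => //.
  exact: measurable_psum.
have := concentratedD (measurable_psum _ _) (measurable_psum _ _) c1 c2.
have -> : d.+1%:R * r + d.+1%:R * ((2 * d.+1)%:R * r) = rho.
  rewrite [in X in _ + X]mulrA -mulrDl -/C /r mulrC divfK ?gt_eqF//.
rewrite (_ : (fun w => _) = (fun w => dot w (ap_mx l *m u)))//.
apply/funext => w; rewrite -psumU ?finset.setUCr ?psumT//.
by rewrite -finset.setI_eq0 finset.setICr.
Unshelve. all: by end_near. Qed.

End frame_limit.

(** * Independent coordinates in the limit *)

Section frame_approx.
Context {R : realType} {d : nat} (B : set 'rV[R]_d) (mu : probability 'rV[R]_d R).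
Hypotheses (cB : convex_body B) (uB : uniform_on B mu).
Variables (U : set_system (@approximant R d)).
Hypotheses (UU : UltraFilter U) (Umu : tends_to U mu).
Variable i0 : 'I_d.

(** In coordinates with respect to the frame V, the image of an approximant
    is up to a small error a vector with independent coordinates, namely the
    rescaled and shifted spread coordinates of w.

    The frame comes from one fixed scale r0, whereas a small error needs the
    remaining coordinates to be concentrated at a smaller scale r. No
    coordinate is lost in between: at scale r0 all d directions of the
    invertible frame are already occupied, and at scale r there are at most
    d spread coordinates, so both scales have the same ones. *)
Lemma independent_coordinates : exists2 V : 'M[R]_d, V \in unitmx &
  forall eta kappa : R, 0 < eta -> 0 < kappa -> \forall l \near U,
    exists (iota : 'I_d -> 'I_(ap_dim l)) (C : 'I_d -> R), injective iota /\
      pr (ap_law l) [set w | exists a,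
        eta < `|dot w (ap_mx l *m col a (invmx V))
                - (row_norm l (iota a) * w ord0 (iota a) - C a)|] <= kappa.
Proof.
have [r0 [V [r00 Vu cvV]]] := limit_frame cB uB UU Umu i0.
exists V => // eta kappa eta0 kappa0; set N := invmx V.
have [K K0 HK] := tight_coord cB uB UU Umu.
pose L : R := mx_bound N + 1.
have LN a : \sum_j `|N j a| <= L.
  by rewrite (le_trans (sum_col_le_mx_bound _ _))// lerDl.
have L0 : 0 < L by rewrite ltr_wpDl// mx_bound_ge0.
clearbody L.
have d0 : 0 < d.+1%:R :> R by [].
pose e1 := kappa / (2 * d.+1%:R).
have e10 : 0 < e1 by rewrite divr_gt0// mulr_gt0.
have e1E : d%:R * e1 + d%:R * e1 <= kappa.
  have : e1 * (2 * d.+1%:R) = kappa by rewrite divfK// gt_eqF// mulr_gt0.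
  by rewrite -(natr1 d); lra.
pose s := Num.min e1 (eta / (2 * L)).
have s0 : 0 < s by rewrite lt_min e10 divr_gt0// mulr_gt0.
have sL : L * s <= eta / 2.
  have : s <= eta / (2 * L) by rewrite ge_min lexx orbT.
  by rewrite ler_pdivlMr ?mulr_gt0//; lra.
have se1 : s <= e1 by rewrite ge_min lexx.
pose e2 := eta / (2 * d.+1%:R * K).
have e20 : 0 < e2 by rewrite divr_gt0// !mulr_gt0.
have e2E : d%:R * (K * e2) <= eta / 2.
  have : e2 * (2 * d.+1%:R * K) = eta by rewrite divfK// gt_eqF// !mulr_gt0.
  rewrite -(natr1 d) => h; have : 0 < K * e2 by rewrite mulr_gt0.
  by lra.
clearbody e1 s e2.
have dd0 : 0 < (2 * d.+1)%:R :> R by [].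
pose r := Num.min r0 (s / (2 * d.+1)%:R).
have rr : 0 < r by rewrite lt_min r00 divr_gt0.
have rr0 : r <= r0 by rewrite ge_min lexx.
have rs : (2 * d.+1)%:R * r <= s.
  by rewrite mulrC -ler_pdivlMr// ge_min lexx orbT.
have row0 a : row a V != 0.
  apply/eqP => rV0; have := row_mul a V N; rewrite rV0 mul0mx mulmxV//.
  by move=> /rowP/(_ a); rewrite !mxE eqxx => /eqP; rewrite oner_eq0.
have near_ne : \forall l \near U, forall a, unit_row i0 r0 l a != 0.
  apply: near_forall => a; have ra : 0 < `|row a V| by rewrite normr_gt0.
  move/cvgrPdist_lt : (cvV a) => /(_ _ ra); apply: filterS => l.
  by apply: contraTneq => ->; rewrite subr0 ltxx.
have near_q : \forall l \near U, forall a b,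
    `|dot (unit_row i0 r0 l b) (col a N) - (b == a)%:R| < e2.
  apply: near_forall => a; apply: near_forall => b.
  have cv : dot (unit_row i0 r0 l b) (col a N) @[l --> U] --> dot (row b V) (col a N).
    exact: dot_cvg.
  move/cvgrPdist_lt : cv => /(_ _ e20); apply: filterS => l.
  have -> : dot (row b V) (col a N) = (b == a)%:R; last by rewrite distrC.
  rewrite dotE; transitivity ((V *m N) b a); last by rewrite mulmxV// mxE.
  by rewrite mxE; apply: eq_bigr => j _; rewrite !mxE.
have near_big := card_spread_idx cB uB UU Umu rr.
have near_big0 := card_spread_idx cB uB UU Umu r00.
have near_rest := rest_concentrated cB uB UU Umu rr.
have near_tight := HK _ e10.
near=> l.
have ne : forall a, unit_row i0 r0 l a != 0 by near: l.
have q1 : forall a b, `|dot (unit_row i0 r0 l b) (col a N) - (b == a)%:R| < e2 by near: l.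
have bc : (#|spread_idx r l| <= d)%N by near: l.
have bc0 : (#|spread_idx r0 l| <= d)%N by near: l.
have rc : forall j, concentrated (ap_law l) ((2 * d.+1)%:R * r)
    (psum (~: spread_idx r l)%SET (ap_mx l *m delta_mx j ord0)) by near: l.
have tc : forall i, exists b,
    pr (ap_law l) [set w | K < `|row_norm l i * w ord0 i - b|] <= e1 by near: l.
have /choice[iota Hi] : forall a, exists i, i \in spread_idx r0 l /\ slot i0 r0 i = a.
  by move=> a; have [i] := unit_row_neq0 (ne a); exists i.
have iinj : injective iota.
  by move=> a b ab; rewrite -(Hi a).2 -(Hi b).2 ab.
have mc i : measurable_fun setT (fun w : 'rV[R]_(ap_dim l) => row_norm l i * w ord0 i).
  by apply: measurable_funM => //; exact: measurable_coord.
(* The d spread coordinates at scale r0 are spread at scale r, where there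
   are at most d of them. *)
have bigE : spread_idx r l = [set iota a | a in [set: 'I_d]%SET]%SET.
  apply/esym/eqP; rewrite eqEcard card_imset// cardsT card_ord bc andbT.
  apply/fintype.subsetP => i /imsetP[a _ ->]; have [+ _] := Hi a.
  move=> /spread_idxP nc; apply/spread_idxP; apply: contra_not nc => cr.
  exact: concentrated_le (mc _) rr0 cr.
have /choice[b Hb] := fun a => tc (iota a).
have /choice[b' Hb'] := rc.
pose rho j := psum (~: spread_idx r l)%SET (ap_mx l *m delta_mx j ord0).
have mrho j : measurable_fun setT (rho j) by exact: measurable_psum.
pose q a c := dot (unit_row i0 r0 l c) (col a N) - (c == a)%:R.
(* Up to the small q a c, the spread coordinate in slot c contributes to
   the a-th frame coordinate only if c = a. *)
have XE a w : dot w (ap_mx l *m col a N) =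
    \sum_c (row_norm l (iota c) * w ord0 (iota c)) * (q a c + (c == a)%:R) + \sum_j N j a * rho j w.
  rewrite -[LHS]psumT -(finset.setUCr (spread_idx r l)) psumU; last first.
    by rewrite -finset.setI_eq0 finset.setICr.
  congr (_ + _); last first.
    by rewrite psum_coord_sum; apply: eq_bigr => j _; rewrite mxE.
  rewrite /psum bigE big_imset /=; last by move=> ? ? _ _; exact: iinj.
  rewrite big_mkcond /=; apply: eq_bigr => c _; rewrite inE.
  have [ib sl] := Hi c.
  by rewrite ap_mulmxE (unit_row_slot i0 r00 bc0 ib) dotZl sl /q subrK; ring.
(* The centre collects the constants of the good event: the centres b c of
   the spread coordinates weighted by the errors q a c, and those of the
   rest. *)
exists iota, (fun a => - (\sum_c b c * q a c + \sum_j N j a * b' j)); split => //.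
apply: le_trans e1E.
have p1 : pr (ap_law l) [set w | exists a,
    K < `|row_norm l (iota a) * w ord0 (iota a) - b a|] <= d%:R * e1.
  by rewrite -[X in X%:R * e1](card_ord d); apply: pr_exists_le => // a; exact: measurable_dist_gt.
have p2 : pr (ap_law l) [set w | exists j,
    (2 * d.+1)%:R * r < `|rho j w - b' j|] <= d%:R * e1.
  rewrite -[X in X%:R * e1](card_ord d); apply: pr_exists_le => j.
    exact: measurable_dist_gt.
  by apply: le_trans (ltW (Hb' j)) _; exact: le_trans rs se1.
apply: le_trans (lerD p1 p2); apply: le_trans (prU_le _ _ _); first last.
- by apply: measurable_exists => j; exact: measurable_dist_gt.
- by apply: measurable_exists => a; exact: measurable_dist_gt.
apply: le_pr.
- apply: measurable_exists => a; set b0 := - (_ + _).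
  pose D (w : 'rV[R]_(ap_dim l)) := dot w (ap_mx l *m col a N) -
    (row_norm l (iota a) * w ord0 (iota a) - b0).
  have mD : measurable_fun setT D.
    by apply: measurable_funB; [exact: measurable_dot|exact: measurable_funB].
  by apply: measurable_gt; apply: measurableT_comp => //.
- apply: measurableU.
    by apply: measurable_exists => a; exact: measurable_dist_gt.
  by apply: measurable_exists => a; exact: measurable_dist_gt.
move=> w /= [a]; apply: contraPP => /not_orP[n1 n2]; apply/negP; rewrite -leNgt.
have h1 c : `|row_norm l (iota c) * w ord0 (iota c) - b c| <= K.
  by rewrite leNgt; apply/negP => h; apply: n1; exists c.
have h2 j : `|rho j w - b' j| <= s.
  by apply: le_trans rs; rewrite leNgt; apply/negP => h; apply: n2; exists j.
have -> : dot w (ap_mx l *m col a N) -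
   (row_norm l (iota a) * w ord0 (iota a) - - (\sum_c b c * q a c + \sum_j N j a * b' j)) =
   \sum_c (row_norm l (iota c) * w ord0 (iota c) - b c) * q a c + \sum_j N j a * (rho j w - b' j).
  rewrite XE opprK.
  have -> : \sum_j N j a * (rho j w - b' j) = \sum_j N j a * rho j w - \sum_j N j a * b' j.
    by rewrite -sumrB; apply: eq_bigr => j _; rewrite mulrBr.
  have -> : \sum_c (row_norm l (iota c) * w ord0 (iota c) - b c) * q a c =
     \sum_c row_norm l (iota c) * w ord0 (iota c) * q a c - \sum_c b c * q a c.
    by rewrite -sumrB; apply: eq_bigr => j _; rewrite mulrBl.
  under eq_bigr do rewrite mulrDr.
  rewrite big_split /= (bigD1 a (F := fun c => _ * (c == a)%:R))//= eqxx mulr1.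
  rewrite [X in _ + (_ + X)]big1 => [|c /negPf ->]; last by rewrite mulr0.
  ring.
apply: le_trans (ler_normD _ _) _; rewrite [leRHS]splitr; apply: lerD.
  apply: le_trans e2E; apply: le_trans (ler_norm_sum _ _ _) _.
  apply: le_trans (_ : \sum_(c < d) K * e2 <= _); last first.
    by rewrite sumr_const card_ord mulr_natl.
  by apply: ler_sum => c _; rewrite normrM; apply: ler_pM => //; exact: ltW (q1 _ _).
apply: le_trans sL; apply: le_trans (ler_norm_sum _ _ _) _.
apply: le_trans (_ : \sum_j `|N j a| * s <= _).
  by apply: ler_sum => j _; rewrite normrM ler_wpM2l.
by rewrite -mulr_suml ler_wpM2r// ltW.
Unshelve. all: by end_near. Qed.

End frame_approx.

Lemma pr_cover dp (T : measurableType dp) (R : realType) (P : probability T R)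
    (A A1 A2 : set T) : measurable A -> measurable A1 -> measurable A2 ->
  (forall w, A w -> ~ A1 w -> A2 w) -> pr P A <= pr P A1 + pr P A2.
Proof.
move=> mA m1 m2 A12; apply: le_trans (prU_le _ m1 m2).
apply: le_pr => //; first exact: measurableU.
by move=> w Aw; have [|/(A12 _ Aw)] := pselect (A1 w); [left|right].
Qed.

Section box.
Context {R : realType} {d : nat} (B : set 'rV[R]_d) (mu : probability 'rV[R]_d R).
Hypotheses (cB : convex_body B) (uB : uniform_on B mu).
Variables (U : set_system (@approximant R d)).
Hypotheses (UU : UltraFilter U) (Umu : tends_to U mu).
Variable i0 : 'I_d.

(** If the recombined point x *m V were outside B, then a ball around it
    would have mass close to 0 for the approximants. But for each a, the
    a-th coordinate is near that of x with a probability bounded below,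
    because mu charges the neighbourhoods of a point y of B with the same
    a-th coordinate as x. The coordinates being almost independent, the
    probability that all of them are near those of x is bounded below by
    about the product of these bounds. *)
Lemma coordinates_recombine : exists2 V : 'M[R]_d, V \in unitmx &
  forall x : 'rV[R]_d,
    (forall a, exists y, B y /\ dot y (col a (invmx V)) = x ord0 a) -> B (x *m V).
Proof.
have [V Vu HV] := independent_coordinates cB uB UU Umu i0.
exists V => // x /choice[y Hy]; set N := invmx V in HV Hy.
have yB a := (Hy a).1; have yx a := (Hy a).2.
set z := x *m V; apply: contrapT => zB.
have [comp _ _] := cB.
have clB : closed B by apply: compact_closed => //; exact: norm_hausdorff.
have [eps /= eps0 ezB] : exists2 eps : R, 0 < eps & ball z eps `<=` ~` B.
  have : nbhs z (~` B) by apply: open_nbhs_nbhs; split => //; exact: closed_openC.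
  by move=> /nbhs_ballP[eps]; exists eps.
pose beta := mx_bound V + 1.
have beta0 : 0 < beta by rewrite ltr_wpDl// mx_bound_ge0.
pose eta := eps / (8 * beta).
have eta0 : 0 < eta by rewrite divr_gt0// mulr_gt0.
have etaE : mx_bound V * (eta + (eta + eta)) <= eps / 2.
  have h : eta * (8 * beta) = eps by rewrite divfK// gt_eqF// mulr_gt0.
  have h1 : mx_bound V * eta <= beta * eta by rewrite ler_wpM2r ?ltW// ltrDl.
  have : 0 < beta * eta by rewrite mulr_gt0.
  by lra.
clearbody eta.
pose L : R := mx_bound N + 1.
have LN a : \sum_j `|col a N j ord0| <= L.
  under eq_bigr do rewrite mxE.
  by rewrite (le_trans (sum_col_le_mx_bound _ _))// lerDl.
have L0 : 0 < L by rewrite ltr_wpDl// mx_bound_ge0.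
clearbody L.
pose e := Num.min 1 (eta / (2 * L)).
have e0 : 0 < e by rewrite lt_min ltr01 divr_gt0// mulr_gt0.
have e1 : e <= 1 by rewrite ge_min lexx.
have eL : L * (2 * e) <= eta.
  have : e <= eta / (2 * L) by rewrite ge_min lexx orbT.
  by rewrite ler_pdivlMr ?mulr_gt0//; lra.
clearbody e.
have [c c0 Hc] := near_ball_mass cB uB UU Umu (introT andP (conj e0 e1)).
(* kappa bounds two exceptional events, whose total 2 * kappa has to stay
   below the product (c / 2)^d of the probabilities of d independent
   events. *)
pose kappa := Num.min (c / 2) ((c / 2) ^+ d / 4).
have cd0 : 0 < (c / 2) ^+ d by rewrite exprn_gt0// divr_gt0.
have k0 : 0 < kappa by rewrite lt_min !divr_gt0.
have kc : kappa <= c / 2 by rewrite ge_min lexx.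
have kd : kappa <= (c / 2) ^+ d / 4 by rewrite ge_min lexx orbT.
clearbody kappa.
have lipN : lipschitz_by 1 (fun x => - `|x - z|).
  have [L1 HL] := lipschitz_dist z; split => // ? ?.
  by rewrite -opprD normrN; exact: HL.
have epsN : - eps < - (eps / 2) by rewrite ltrN2; lra.
have near_far : \forall l \near U,
    pr (ap_law l) [set w | `|w *m ap_mx l - z| <= eps / 2] <= kappa.
  have := portmanteau UU Umu lipN epsN k0; apply: filterS => l [+ _].
  under eq_set do rewrite lerN2.
  move=> /le_trans; apply.
  rewrite (uniform_pr0 cB uB) ?add0r//.
    by apply: measurable_gt; exact: (lipschitz_measurable lipN).
  move=> v /=; rewrite ltrN2 => vz; apply: ezB.
  by rewrite -ball_normE /= distrC.
have near_y : \forall l \near U, forall a,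
    c <= pr (ap_law l) [set w | `|w *m ap_mx l - y a| < 2 * e].
  by apply: near_forall => a; exact: Hc.
have near_prod := HV _ _ eta0 k0.
have [l [Hfar [Hym [iota [C [iinj HC]]]]]] := @filter_ex _ U _ _
  (filterI near_far (filterI near_y near_prod)).
pose X a (w : 'rV[R]_(ap_dim l)) := dot w (ap_mx l *m col a N).
pose Z a (w : 'rV[R]_(ap_dim l)) := row_norm l (iota a) * w ord0 (iota a) - C a.
pose E a := [set w | `|Z a w - x ord0 a| <= eta + eta].
pose bad := [set w | exists a, eta < `|X a w - Z a w|].
have mX a : measurable_fun setT (X a) by exact: measurable_dot.
have mZ a : measurable_fun setT (Z a).
  apply: measurable_funB => //; apply: measurable_funM => //; exact: measurable_coord.
have mE a : measurable (E a).
  by apply: measurable_le; apply: measurableT_comp => //; exact: measurable_funB.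
have mbad : measurable bad.
  apply: measurable_exists => a; apply: measurable_gt.
  by apply: measurableT_comp => //; exact: measurable_funB.
have pE a : c / 2 <= pr (ap_law l) (E a).
  have : pr (ap_law l) [set w | `|w *m ap_mx l - y a| < 2 * e] <=
      pr (ap_law l) bad + pr (ap_law l) (E a).
    apply: pr_cover => //; first by apply: measurable_lt; exact: measurable_dist_mulmx.
    move=> w /= wy nb; rewrite /E /=.
    have hX : `|X a w - Z a w| <= eta.
      by rewrite leNgt; apply/negP => h; apply: nb; exists a.
    have hx : `|X a w - x ord0 a| <= eta.
      have [_ HL] := dot_lipschitz (col a N).
      have := HL (w *m ap_mx l) (y a).
      rewrite {1}/dot -mulmxA -/(dot _ _) yx => /le_trans; apply; apply: le_trans eL.
      by apply: ler_pM => //; [exact: sumr_ge0|exact: ltW].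
    by rewrite (le_trans (ler_distD (X a w) _ _))// lerD// distrC.
  have := Hym a; have : pr (ap_law l) bad <= kappa by []; lra.
have pall : (c / 2) ^+ d <= pr (ap_law l) [set w | forall a, E a w].
  rewrite (pr_forall_indep (ap_prodlaw l) iinj mE); last first.
    move=> a v w vw; rewrite /E /= /Z vw//; exact: finset.set11.
  rewrite -{1}(card_ord d) -prodr_const; apply: ler_prod => a _.
  by rewrite pE andbT divr_ge0// ltW.
have : pr (ap_law l) [set w | forall a, E a w] <= pr (ap_law l) bad +
    pr (ap_law l) [set w | `|w *m ap_mx l - z| <= eps / 2].
  apply: pr_cover => //; first exact: measurable_forall.
    by apply: measurable_le; exact: measurable_dist_mulmx.
  move=> w /= Ew nb; apply: le_trans etaE.
  have -> : w *m ap_mx l - z = (w *m ap_mx l *m N - x) *m V.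
    by rewrite mulmxBl mulmxKV.
  apply: le_trans (norm_mulmx _ _) _; rewrite ler_wpM2l ?mx_bound_ge0//.
  apply: norm_le_coord => [|a]; first by rewrite !addr_ge0// ltW.
  rewrite !mxE.
  have -> : \sum_j (w *m ap_mx l) ord0 j * N j a = X a w.
    by rewrite /X /dot mulmxA mxE; apply: eq_bigr => j _; rewrite !mxE.
  have hX : `|X a w - Z a w| <= eta.
    by rewrite leNgt; apply/negP => h; apply: nb; exists a.
  by rewrite (le_trans (ler_distD (Z a w) _ _))// lerD//; exact: Ew.
have : pr (ap_law l) bad <= kappa by [].
by lra.
Qed.

End box.

(** * Recombination forces a parallelotope *)

Section parallelotope.
Context {R : realType} {d : nat} (B : set 'rV[R]_d).
Hypothesis cB : convex_body B.

(** In the coordinates given by V, B is the product of its projections: it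
    is contained in this product, and recombination gives the converse. The
    projections are segments because B is compact and convex, and they are
    not reduced to points because B has interior points. *)
Lemma recombining_parallelotope (V : 'M[R]_d) : V \in unitmx ->
  (forall x : 'rV[R]_d,
    (forall a, exists y, B y /\ dot y (col a (invmx V)) = x ord0 a) -> B (x *m V)) ->
  parallelotope B.
Proof.
move=> Vu HV; set N := invmx V in HV.
have [comp _ _] := cB; have [p [rho rho0 rB]] := convex_body_inner cB.
have Bp : B p by apply: rB; exact: ballxx.
have B0 : B !=set0 by exists p.
pose f a (y : 'rV[R]_d) := dot y (col a N).
have cf a : {within B, continuous (f a)}.
  by apply: continuous_subspaceT; exact: continuous_dot.
have fE a y : (y *m N) ord0 a = f a y.
  by rewrite /f dotE mxE; apply: eq_bigr => j _; rewrite mxE.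
have /choice[lo Hlo] : forall a, exists y, B y /\ forall x, B x -> f a y <= f a x.
  move=> a; have [y /set_mem By Hy] := compact_EVT_min B0 comp (cf a).
  by exists y; split=> // x /mem_set; exact: Hy.
have /choice[hi Hhi] : forall a, exists y, B y /\ forall x, B x -> f a x <= f a y.
  move=> a; have [y /set_mem By Hy] := compact_EVT_max B0 comp (cf a).
  by exists y; split=> // x /mem_set; exact: Hy.
pose m : 'rV[R]_d := \row_a f a (lo a).
pose len : 'rV[R]_d := \row_a (f a (hi a) - f a (lo a)).
have loB a : B (lo a) by have [] := Hlo a.
have hiB a : B (hi a) by have [] := Hhi a.
have fB a y : B y -> f a (lo a) <= f a y <= f a (hi a).
  by move=> By; rewrite (Hlo a).2// (Hhi a).2.
have len0 a : 0 < len ord0 a.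
  rewrite mxE subr_gt0; have /andP[h _] := fB a p Bp; apply: le_lt_trans h _.
  pose s := rho / (`|row a V| + 1).
  have n0 : 0 < `|row a V| + 1 by rewrite ltr_wpDl.
  have s0 : 0 < s by rewrite divr_gt0.
  have Bs : B (p + s *: row a V).
    apply: rB; rewrite -ball_normE /= opprD addrA subrr sub0r normrN normrZ gtr0_norm//.
    have : s * (`|row a V| + 1) = rho by rewrite divfK// gt_eqF.
    by lra.
  have /andP[_] := fB a _ Bs; apply: lt_le_trans.
  rewrite /f dotDl dotZl ltrDl.
  have -> : dot (row a V) (col a N) = 1; last by rewrite mulr1.
  rewrite dotE; transitivity ((V *m N) a a); last by rewrite mulmxV// mxE eqxx.
  by rewrite mxE; apply: eq_bigr => j _; rewrite !mxE.
have inB y : (forall a, f a (lo a) <= f a y <= f a (hi a)) -> B y.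
  move=> Hy; have -> : y = (y *m N) *m V by rewrite mulmxKV.
  apply: HV => a; rewrite fE; have /andP[h1 h2] := Hy a.
  have := len0 a; rewrite mxE; set M := f a (hi a); set m' := f a (lo a) => h.
  pose t := (f a y - m') / (M - m').
  exists (t *: hi a + (1 - t) *: lo a); split.
    apply: (convex_body_comb cB) => //; apply/andP; split.
      by rewrite divr_ge0 ?subr_ge0// ltW// -subr_gt0.
    by rewrite ler_pdivrMr// mul1r lerD2r.
  rewrite dotDl !dotZl -/(f a _) -/(f a _) -/M -/m' /t; field.
  by rewrite gt_eqF.
exists (diag_mx len *m V), (m *m V); split.
  rewrite unitmx_mul Vu andbT unitmxE det_diag unitfE prodf_seq_neq0.
  by apply/allP => a _ /=; rewrite gt_eqF.
have cE (x : 'rV[R]_d) a : f a (x *m (diag_mx len *m V) + m *m V) =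
    x ord0 a * len ord0 a + f a (lo a).
  by rewrite -fE mulmxA -mulmxDl -mulmxA mulmxV// mulmx1 mul_mx_diag !mxE.
apply/seteqP; split => [y By|_ [x Hx <-]].
  exists (\row_a ((f a y - f a (lo a)) / len ord0 a)).
    move=> a; rewrite mxE; have /andP[h1 h2] := fB a y By; apply/andP; split.
      by rewrite divr_ge0 ?subr_ge0// ltW.
    by rewrite ler_pdivrMr// mul1r [leRHS]mxE lerD2r.
  rewrite mulmxA -mulmxDl; apply: (canLR (mulmxKV Vu)); apply/rowP => a.
  rewrite fE mul_mx_diag !mxE; rewrite divfK ?subrK//.
  by have := len0 a; rewrite mxE => h; rewrite gt_eqF.
apply: inB => a; rewrite cE; have /andP[h1 h2] := Hx a.
have h := len0 a; apply/andP; split.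
  by rewrite lerDr mulr_ge0// ltW.
rewrite -lerBrDr; have -> : f a (hi a) - f a (lo a) = len ord0 a by rewrite mxE.
by rewrite ler_piMl// ltW.
Qed.

End parallelotope.

Theorem corollary2p16 (R : realType) (d : nat) (B : set 'rV[R]_d)
    (mu : probability 'rV[R]_d R) :
  smallest_class mu -> convex_body B -> uniform_on B mu -> parallelotope B.
Proof.
move=> /smallest_class_approximable[[d0 _ _] amu] cB uB.
have [U UU Umu] := approximable_ultrafilter amu.
have [V Vu HV] := coordinates_recombine cB uB UU Umu (Ordinal d0).
exact: recombining_parallelotope HV.
Qed.
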